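(* Let $t$ be a given positive integer, and let $F_1$ and $F_2$ be any symmetric functions. (a) If $t$ is odd, then $$(2t)^n n!\sum_{\substack{\lambda\in\mathcal{DD},\ |\lambda|=2nt\\ \#\mathcal{H}_t(\lambda)=2n}}\frac{F_1(h^2: h\in\mathcal{H}(\lambda))\,F_2(c: c\in\mathcal{C}(\lambda))}{H_t(\lambda)}$$ is a polynomial in $n$ (as a function of the positive integer $n$). (b) If $t$ is even, then $$(2t)^n n!\sum_{\substack{\lambda\in\mathcal{SC},\ |\lambda|=2nt\\ \#\mathcal{H}_t(\lambda)=2n}}\frac{F_1(h^2: h\in\mathcal{H}(\lambda))\,F_2(c: c\in\mathcal{C}(\lambda))}{H_t(\lambda)}$$ is a polynomial in $n$ (as a function of the positive integer $n$).
   Context: Integer partitions $\lambda$ are identified with their Young diagrams, whose boxes $(i,j)$ ($i$ = row, $j$ = column) satisfy $1\le j\le\lambda_i$; $|\lambda|$ is the size. The hook length of a box is the usual one (number of boxes to its right in the same row, plus number of boxes below it in the same column, plus 1), and the content of box $(i,j)$ is $j-i$. $\mathcal{H}(\lambda)$ and $\mathcal{C}(\lambda)$ are the multisets of hook lengths and of contents of all boxes of $\lambda$. For a positive integer $t$, $\mathcal{H}_t(\lambda)$ is the multiset of those $h\in\mathcal{H}(\lambda)$ divisible by $t$ (with multiplicity), $\#\mathcal{H}_t(\lambda)$ is its cardinality, and $H_t(\lambda)=\prod_{h\in\mathcal{H}_t(\lambda)}h$. A strict partition is a finite strictly decreasing sequence of positive integers $\bar\lambda=(\bar\lambda_1,\dots,\bar\lambda_\ell)$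 (possibly empty); its shifted Young diagram consists of the boxes $(i,j)$ with $1\le i\le\ell$, $i+1\le j\le i+\bar\lambda_i$. The doubled distinct partition $\bar\lambda\bar\lambda$ is the ordinary partition whose Young diagram is obtained from this shifted diagram by adding $\bar\lambda_i$ boxes to the $i$-th column, namely the boxes $(k,i)$ with $i\le k\le i+\bar\lambda_i-1$, for each $1\le i\le\ell$. For example, $(6,4,4,1,1)$ is the doubled distinct partition of $(5,2,1)$. $\mathcal{DD}$ is the set of all doubled distinct partitions, and $\mathcal{SC}$ is the set of all self-conjugate partitions ($\lambda=\lambda'$, where $\lambda'$ is the conjugate). A symmetric function is an element of the ring of symmetric functions in infinitely many variables over $\mathbb{C}$; it is evaluated at a finite multiset by substituting the elements of the multiset for finitely many of the variables and $0$ for the others. *)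

(* Defs.v *)
From mathcomp Require Import all_boot all_order all_algebra.
From mathcomp Require Import boolp reals complex.
From mathcomp Require Import mpoly.

Set Implicit Arguments.
Unset Strict Implicit.
Unset Printing Implicit Defensive.

Import GRing.Theory.

(* Partitions are nonincreasing sequences of positive naturals. Rows and
   columns are numbered from 0, so the box (i, j) of a textbook diagram is
   (i.-1, j.-1) here; contents and hook lengths do not see the shift. *)

Definition is_partition (la : seq nat) : bool := sorted geq la && (0 \notin la).

Definition is_strict_partition (mu : seq nat) : bool :=
  sorted gtn mu && (0 \notin mu).

(* The parts and the length of a partition of m are at most m, so it occurs in
   this enumeration of bounded sequences: see mem_partitions. *)
Definition partitions (m : nat) : seq (seq nat) :=
  [seq la <- [seq [seq val k | k <- s] | s : m.-bseq 'I_m.+1]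
         | is_partition la && (sumn la == m)].

Lemma partitions_uniq m : uniq (partitions m).
Proof.
apply/filter_uniq; rewrite map_inj_uniq ?enum_uniq // => s1 s2 e.
by apply/val_inj/(inj_map val_inj).
Qed.

Lemma mem_partitions m la :
  (la \in partitions m) = is_partition la && (sumn la == m).
Proof.
rewrite mem_filter; apply/idP/idP => [/andP[] //|lam]; rewrite lam /=.
have /andP[/andP[_ la0] /eqP sla] := lam.
have le_sum (s : seq nat) x : x \in s -> x <= sumn s.
  elim: s => //= y s IHs; rewrite inE => /orP[/eqP->|/IHs]; first exact: leq_addr.
  by move/leq_trans; apply; apply: leq_addl.
have sz : size la <= m.
  rewrite -sla; elim: la la0 {sla lam} => //= x s IHs.
  rewrite inE negb_or eq_sym -lt0n => /andP[x0 /IHs s0].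
  by rewrite -add1n leq_add.
have szb : size [seq inord k : 'I_m.+1 | k <- la] <= m by rewrite size_map.
apply/mapP; exists (Bseq szb); first by rewrite mem_enum.
rewrite /= -map_comp -[LHS]map_id; apply/eq_in_map => k /le_sum.
by rewrite sla /= => km; rewrite inordK.
Qed.

Definition boxes (la : seq nat) : seq (nat * nat) :=
  [seq (i, j) | i <- iota 0 (size la), j <- iota 0 (nth 0 la i)].

Definition hook_length (la : seq nat) (b : nat * nat) : nat :=
  count (fun c => (c.1 == b.1) && (b.2 < c.2)) (boxes la)
  + count (fun c => (c.2 == b.2) && (b.1 < c.1)) (boxes la) + 1.

Definition content (b : nat * nat) : int := (b.2%:Z - b.1%:Z)%R.

Definition hooks (la : seq nat) : seq nat :=
  [seq hook_length la b | b <- boxes la].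

Definition contents (la : seq nat) : seq int := [seq content b | b <- boxes la].

Definition hooks_div (t : nat) (la : seq nat) : seq nat :=
  [seq h <- hooks la | t %| h].

Definition hook_prod (t : nat) (la : seq nat) : nat :=
  \prod_(h <- hooks_div t la) h.

Definition conjugate (la : seq nat) : seq nat :=
  [seq count (fun k => j < k) la | j <- iota 0 (head 0 la)].

Definition self_conjugate (la : seq nat) : bool := conjugate la == la.

Definition in_shifted_diagram (mu : seq nat) (i j : nat) : bool :=
  (i < size mu) && (i + 1 <= j <= i + nth 0 mu i).

(* Box (k, i) is among the mu_i boxes added to column i. *)
Definition in_added_column (mu : seq nat) (k i : nat) : bool :=
  (i < size mu) && (i <= k < i + nth 0 mu i).

Definition doubled_distinct (la : seq nat) : Prop :=
  exists2 mu, is_strict_partition mu &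
    forall i j, (j < nth 0 la i) =
      in_shifted_diagram mu i j || in_added_column mu i j.

(* The ring of symmetric functions as the graded inverse limit of the rings of
   symmetric polynomials: a family of symmetric polynomials of bounded degree,
   one in each number of variables, compatible with setting the last variable
   to 0. *)

Local Open Scope ring_scope.

Definition mpoly_last0 (R : comNzRingType) (m : nat) (p : {mpoly R[m.+1]}) :
  {mpoly R[m]} :=
  p \mPo [tuple oapp (fun j : 'I_m => 'X_j) 0 (unlift ord_max i) | i < m.+1].

Record symfun (R : comNzRingType) := Symfun {
  symfun_poly :> forall m : nat, {mpoly R[m]};
  symfun_sym : forall m, symfun_poly m \is symmetric;
  symfun_last0 : forall m, mpoly_last0 (symfun_poly m.+1) = symfun_poly m;
  symfun_bounded : exists d : nat, forall m, (msize (symfun_poly m) <= d)%N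
}.

(* By symfun_last0, evaluating the component in [size s] variables amounts to
   substituting s, followed by zeros, in the symmetric function. *)
Definition symfun_eval (R : comNzRingType) (F : symfun R) (s : seq R) : R :=
  (F (size s)).@[fun i => s`_i].

(* Main.v *)
(** A partition is encoded by the set of its beads la_i + m - 1 - i, so that its
    hooks are the distances from a bead to a hole below it. Doubled distinct
    (d = 1) and self-conjugate (d = 0) partitions are those whose beads and holes
    are exchanged by p |-> 2m + d - 1 - p. Write t = 2s + d and split the beads
    along the residues mod t. The reflection pairs these classes, except for the
    class of 0 when t is odd, which is symmetric and amounts to a strict
    partition. A quadratic inequality shows that |la| = t #H_t(la) forces all
    classes to have equally many beads. Hence the sum runs over families (a strict
    partition if d = 1, and s partitions) of total size n, and t^(2n) / H_t(la)
    becomes the product of the Plancherel weights 2^(-l) / Hbar^2 and 1 / H^2,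
    while the power sums of squared hooks and of contents become polynomials in
    those of the bead positions of the components.

    For one component, let S_n be the weighted sum of such a polynomial f over
    size n. Growing a diagram by one box changes f by a polynomial in the position
    of the box, and the moments of the transition weights are complete homogeneous
    functions of the bead power sums (Lagrange interpolation). So
    n! c^(-n) S_n, with c = 1 or 1/2, has differences of the same form for an f of
    smaller degree, and is a polynomial in n by induction. Binomial convolution
    preserves this property and adds the constants c, which gives
    c = s + d/2 = t/2 in total. *)

Require Import Defs.
From mathcomp Require Import all_boot all_order all_algebra.
From mathcomp Require Import boolp finmap reals complex.
From mathcomp Require Import mpoly.
From mathcomp Require Import ring lra zify.

Set Implicit Arguments.
Unset Strict Implicit.
Unset Printing Implicit Defensive.

Import Order.TTheory GRing.Theory Num.Theory.
Local Open Scope ring_scope.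

(** * Complete homogeneous functions and interpolation *)

(** The obstacle is that finitely many beads leave room for finitely many rows: K beads describe the
    growth from size n to n + 1 correctly only for n < K. Hence all levels carry a truncation K,
    positions are normalised by the vacuum so that K drops out, and [expoly] asks for one polynomial
    valid for every K >= n. The final sum takes K = 2n, so that the t K beads are as many as the
    boxes and certainly enough for the rows.

    The factor (2t)^n is exactly what the constants require: the 2n hooks divisible by t contribute
    t^(-2n), the families contribute (t/2)^n / n!, and (2t)^n t^(-2n) (t/2)^n = 1.

    The induction on the degree closes because one filtration governs both ingredients: the
    increment of a function of weight d has total degree below d in state and position, and
    averaging turns the k-th power of the position into a function of weight k.

    Squares of hooks matter because an even power of x - y is symmetric, so that pairs of beads can
    be summed without regard to order. *)

Section CompleteHomogeneous.
Variable F : numFieldType.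
Implicit Types (q : nat -> F) (c : F) (k : nat).

Fixpoint hseq q k : seq F :=
  if k is k'.+1 then
    let s := hseq q k' in
    rcons s ((k'.+1%:R)^-1 * \sum_(i < k'.+1) q i.+1 * s`_(k' - i))
  else [:: 1].

(* [hq q k] is the complete homogeneous function h_k with power sums
   [q 1, q 2, ...], through Newton's identity [hqE]. *)
Definition hq q k : F := (hseq q k)`_k.

Lemma size_hseq q k : size (hseq q k) = k.+1.
Proof. by elim: k => //= k IHk; rewrite size_rcons IHk. Qed.

Lemma nth_hseq q k i : (i <= k)%N -> (hseq q k)`_i = hq q i.
Proof.
elim: k => [|k IHk]; first by case: i.
rewrite leq_eqVlt => /orP[/eqP -> //|ik].
by rewrite /= nth_rcons size_hseq ik IHk.
Qed.

Lemma hq0 q : hq q 0 = 1. Proof. by []. Qed.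

Lemma hqE q k :
  k.+1%:R * hq q k.+1 = \sum_(i < k.+1) q i.+1 * hq q (k - i).
Proof.
rewrite /hq /= nth_rcons size_hseq ltnn eqxx mulrA divff ?mul1r; last first.
  by rewrite pnatr_eq0.
by apply: eq_bigr => i _; rewrite nth_hseq // leq_subr.
Qed.

Lemma hq_unique q (h : nat -> F) : h 0 = 1 ->
  (forall k, k.+1%:R * h k.+1 = \sum_(i < k.+1) q i.+1 * h (k - i)%N) ->
  forall k, h k = hq q k.
Proof.
move=> h0 hS; elim/ltn_ind => -[|k] IHk; first by rewrite hq0.
have k0 : k.+1%:R != 0 :> F by rewrite pnatr_eq0.
apply: (mulfI k0); rewrite hS hqE; apply: eq_bigr => i _.
by rewrite IHk // ltnS leq_subr.
Qed.

Lemma eq_hq q q' : (forall i, (0 < i)%N -> q i = q' i) -> hq q =1 hq q'.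
Proof.
move=> qq'; apply: hq_unique => // k; rewrite hqE.
by apply: eq_bigr => i _; rewrite qq'.
Qed.

Lemma hq_null q : (forall i, (0 < i)%N -> q i = 0) -> forall k, hq q k.+1 = 0.
Proof.
move=> q0 k; apply: (mulfI (x := k.+1%:R)); first by rewrite pnatr_eq0.
by rewrite hqE mulr0 big1 // => i _; rewrite q0 ?mul0r.
Qed.

(* Removing the variable [c] multiplies the generating series by [1 - c X]. *)
Lemma hq_remove q c k :
  hq (fun i => q i - c ^+ i) k.+1 = hq q k.+1 - c * hq q k.
Proof.
pose g k := if k is k'.+1 then hq q k'.+1 - c * hq q k' else 1.
suff /(_ k.+1) <- : forall k, g k = hq (fun i => q i - c ^+ i) k by [].
apply: hq_unique => // {}k; rewrite [g k.+1]/g.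
have split_sum (a : nat -> F) : \sum_(i < k.+1) a i * g (k - i)%N =
    \sum_(i < k.+1) a i * hq q (k - i) -
    c * \sum_(i < k) a i * hq q (k.-1 - i).
  rewrite 2!big_ord_recr /= subnn hq0 [g 0]/g [RHS]addrAC; congr (_ + _).
  rewrite mulr_sumr -sumrB; apply: eq_bigr => i _.
  have ik : (i < k)%N by [].
  rewrite -subn1 subnAC subn1.
  have -> : (k - i = (k - i).-1.+1)%N by rewrite prednK // subn_gt0.
  by move: (k - i).-1 => j; rewrite /g /=; ring.
under eq_bigr do rewrite mulrBl.
rewrite sumrB (split_sum (fun i => q i.+1)) (split_sum (fun i => c ^+ i.+1)).
(* The powers of c telescope against their shift and only the term i = 0 survives; it is what turns
   the factor k of Newton's identity at h_k into k + 1. *)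
have -> : \sum_(i < k.+1) c ^+ i.+1 * hq q (k - i) -
    c * (\sum_(i < k) c ^+ i.+1 * hq q (k.-1 - i)) = c * hq q k.
  rewrite big_ord_recl subn0 expr1 mulr_sumr -addrA -sumrB big1 ?addr0 //.
  move=> i _; rewrite lift0 exprS -mulrA -mulrBr -mulrBr.
  by rewrite subnS -subn1 subnAC subn1 subrr !mulr0.
rewrite mulrBr hqE; case: k {split_sum} => [|k].
  by rewrite !big_ord1 big_ord0 mul1r mulr0 subr0.
by rewrite -pred_Sn -!hqE -[k.+2]addn1 natrD; ring.
Qed.

End CompleteHomogeneous.

(** * Divided differences of polynomials with prescribed zeros *)

Section DividedDifferences.
Variable F : numFieldType.
Implicit Types (a b : seq F) (f : F -> F) (c x : F).

Definition psum a i : F := \sum_(x <- a) x ^+ i.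

Definition divdiff a f : F :=
  \sum_(x <- a) f x / \prod_(y <- a | y != x) (x - y).

(** h_(k - d), extended by 0 to negative indices instead of truncating the subtraction. On d nodes
    the divided difference of x^k is h_(k + 1 - d), whence the successors in the arguments below. *)
Definition hq_shift (q : nat -> F) (d k : nat) : F :=
  if (d <= k)%N then hq q (k - d) else 0.

Lemma hq_shift_remove (q : nat -> F) c d k :
  hq_shift (fun i => q i - c ^+ i) d k.+1 =
  hq_shift q d k.+1 - c * hq_shift q d k.
Proof.
rewrite /hq_shift; case: (leqP d k) => [dk|kd].
  by rewrite leqW // subSn // hq_remove.
rewrite mulr0 subr0; case: leqP => // dk.
have -> : d = k.+1 by apply/eqP; rewrite eqn_leq dk.
by rewrite subnn.
Qed.

Lemma eq_hq_shift (q q' : nat -> F) d k :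
  (forall i, (0 < i)%N -> q i = q' i) -> hq_shift q d k = hq_shift q' d k.
Proof. by move=> qq'; rewrite /hq_shift (eq_hq qq'). Qed.

Lemma eq_divdiff a f f' : {in a, f =1 f'} -> divdiff a f = divdiff a f'.
Proof.
by move=> ff'; rewrite /divdiff big_seq [RHS]big_seq; apply: eq_bigr => x /ff' ->.
Qed.

Lemma divdiffB a f f' :
  divdiff a (fun x => f x - f' x) = divdiff a f - divdiff a f'.
Proof.
by rewrite /divdiff -sumrB; apply: eq_bigr => x _; rewrite mulrBl.
Qed.

Lemma divdiffZ a c f : divdiff a (fun x => c * f x) = c * divdiff a f.
Proof.
by rewrite /divdiff mulr_sumr; apply: eq_bigr => x _; rewrite mulrA.
Qed.

Lemma divdiff_perm a a' f : perm_eq a a' -> divdiff a f = divdiff a' f.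
Proof.
move=> aa'; rewrite /divdiff (perm_big _ aa'); apply: eq_bigr => x _.
by rewrite (perm_big _ aa').
Qed.

Lemma divdiff_cons c a f : c \notin a ->
  divdiff (c :: a) (fun x => (x - c) * f x) = divdiff a f.
Proof.
move=> ca; rewrite /divdiff big_cons subrr mul0r mul0r add0r.
rewrite big_seq [RHS]big_seq; apply: eq_bigr => x xa.
have cx : c != x by apply: contraNneq ca => ->.
rewrite big_cons cx; have xc : x - c != 0 by rewrite subr_eq0 eq_sym.
by rewrite -mulf_div divff // mul1r.
Qed.

(** Write c' - c = (x - c) - (x - c'). A factor x - c deletes the node c, so for at least three
    nodes the claim reduces to two smaller node sets; two nodes are computed directly. *)
Lemma divdiff_const a : uniq a -> (1 < size a)%N -> divdiff a (fun=> 1) = 0.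
Proof.
elim: {a}(size a).-2 {-2}a (erefl (size a).-2) => [|n IHn] [|c [|c' a]] //=;
  rewrite inE negb_or => size_a /and3P[/andP[cc' ca] c'a ua] _.
  case: a size_a ca c'a ua => // _ _ _ _; rewrite /divdiff !(big_cons, big_nil).
  rewrite !eqxx cc' eq_sym cc' /= !mulr1.
  by rewrite addr0 -[c - c']opprB invrN mulrN addrC subrr.
have cc'0 : c' - c != 0 by rewrite subr_eq0 eq_sym.
apply: (mulfI cc'0); rewrite mulr0 -divdiffZ.
rewrite (@eq_divdiff _ _ (fun x => (x - c) * 1 - (x - c') * 1)); last first.
  by move=> x _ /=; ring.
rewrite divdiffB divdiff_cons ?inE ?negb_or ?cc' //.
rewrite (@divdiff_perm (c :: c' :: a) (c' :: c :: a)); last first.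
  exact: (permEl (perm_catCA [:: c] [:: c'] a)).
rewrite divdiff_cons ?inE ?negb_or ?[c' == c]eq_sym ?cc' //.
by rewrite !IHn ?subrr //= ?size_a ?c'a ?ca ?ua.
Qed.

(** Both sides obey the same recursion: in x^(k+1) = (x - c) x^k + c x^k the factor x - c deletes
    the node c, as [hq_remove] deletes the variable c from h. *)
Lemma divdiff_exp a k : uniq a -> a != [::] ->
  divdiff a (fun x => x ^+ k) = hq_shift (psum a) (size a) k.+1.
Proof.
elim: a k => // c a IHa k /=/andP[ca ua] _.
have psum_cons d j : hq_shift (psum a) d j.+1 =
    hq_shift (psum (c :: a)) d j.+1 - c * hq_shift (psum (c :: a)) d j.
  rewrite -hq_shift_remove; apply: eq_hq_shift => i _.
  by rewrite /psum big_cons addrC addKr.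
case: (eqVneq a [::]) => [a0|a0].
  subst a; elim: k => [|k IHk]; rewrite {1}/divdiff big_seq1 big_cons big_nil eqxx.
    by rewrite expr0 divr1 /hq_shift.
  rewrite exprS divr1; move/eqP: (psum_cons 1%N k.+1).
  rewrite {1}/hq_shift /= subSS subn0 hq_null; last first.
    by move=> i _; rewrite /psum big_nil.
  rewrite eq_sym subr_eq0 => /eqP ->; rewrite -IHk.
  by rewrite /divdiff big_seq1 big_cons big_nil eqxx divr1.
elim: k => [|k IHk].
  by rewrite divdiff_const /hq_shift /= ?ca //; case: (a) a0.
rewrite (@eq_divdiff _ _ (fun x => (x - c) * x ^+ k - (- c) * x ^+ k)).
  rewrite divdiffB divdiffZ divdiff_cons // IHk IHa // mulNr opprK.
  have := psum_cons (size a).+1 k.+1; rewrite {1}/hq_shift ltnS subSS => e.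
  by rewrite {1}/hq_shift e addrNK.
by move=> x _; rewrite exprS mulNr opprK -mulrDl subrK.
Qed.

(** A numerator factor x - c acts on h like the removal of a variable c. So the poles [a] and the
    zeros [b] enter through p_i(a) - p_i(b) only, and this is how transition weights are summed
    later on. *)
Lemma divdiff_rational a b k : uniq a -> a != [::] ->
  divdiff a (fun x => x ^+ k * \prod_(y <- b) (x - y)) =
  hq_shift (fun i => psum a i - psum b i) (size a) (k + size b).+1.
Proof.
move=> ua a0; elim: b k => [|c b IHb] k.
  rewrite addn0 -(eq_hq_shift (q := psum a)).
    rewrite -divdiff_exp //; apply: eq_divdiff => x _.
    by rewrite big_nil mulr1.
  by move=> i _; rewrite /psum big_nil subr0.
rewrite (@eq_divdiff _ _ (fun x => x ^+ k.+1 * \prod_(y <- b) (x - y) -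
   c * (x ^+ k * \prod_(y <- b) (x - y)))).
  rewrite divdiffB divdiffZ !IHb addSn -hq_shift_remove [size (_ :: _)]/= addnS.
  apply: eq_hq_shift => i _; rewrite /psum big_cons.
  by rewrite opprD addrA [_ - _ - _]addrAC.
by move=> x _; rewrite big_cons exprS; ring.
Qed.

End DividedDifferences.

(** * Exponential polynomials *)

Section Summation.
Variable F : numFieldType.
Implicit Types (P Q : {poly F}) (u v : nat -> nat -> F) (c : F).

Lemma antidifference P :
  exists2 Q : {poly F}, Q.[0] = 0 & forall x, Q.[x + 1] - Q.[x] = P.[x].
Proof.
pose ad (P : {poly F}) :=
  exists2 Q : {poly F}, Q.[0] = 0 & forall x, Q.[x + 1] - Q.[x] = P.[x].
have adD P1 P2 : ad P1 -> ad P2 -> ad (P1 + P2).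
  move=> [Q1 Q10 Q1E] [Q2 Q20 Q2E]; exists (Q1 + Q2) => [|x].
    by rewrite hornerD Q10 Q20 addr0.
  by rewrite !hornerD -Q1E -Q2E; ring.
have adZ c P1 : ad P1 -> ad (c *: P1).
  move=> [Q1 Q10 Q1E]; exists (c *: Q1) => [|x].
    by rewrite hornerZ Q10 mulr0.
  by rewrite !hornerZ -Q1E; ring.
have ad0 : ad 0 by exists 0 => [|x]; rewrite !horner0 ?subrr.
have adX k : ad 'X^k.
  elim/ltn_ind: k => k IHk.
  (* (x + 1)^(k+1) - x^(k+1) is (k + 1) x^k plus lower powers; Q is an antidifference of the
     latter. *)
  have [Q Q0 QE] : ad (\sum_(j < k) 'C(k.+1, j)%:R *: 'X^j).
    by elim/big_ind: _ => // j _; apply/adZ/IHk.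
  exists (k.+1%:R^-1 *: ('X^(k.+1) - Q)) => [|x].
    by rewrite hornerZ !hornerE Q0 subr0 expr0n mulr0.
  have k0 : k.+1%:R != 0 :> F by rewrite pnatr_eq0.
  apply: (mulfI k0); rewrite !hornerZ mulrBr !mulVKf // !hornerE.
  have := QE x; rewrite horner_sum => /eqP; rewrite subr_eq => /eqP ->.
  rewrite [x + 1]addrC exprDn 2!big_ord_recr /= subnn subSnn binn binSn.
  rewrite expr1n !mul1r mulr1n -mulr_natl.
  rewrite (eq_bigr (fun i : 'I_k => ('C(k.+1, i)%:R *: 'X^i).[x])); first ring.
  by move=> i _; rewrite !hornerE expr1n mul1r mulr_natl.
rewrite -[P]coefK poly_def.
by elim/big_ind: _ => // j _; apply/adZ/adX.
Qed.

(* [K] bounds the level [n] up to which the truncated model [u K] is exact. *)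
Definition expoly c u := exists P : {poly F}, forall K n, (n <= K)%N ->
  n`!%:R * u K n = c ^+ n * P.[n%:R].

Lemma eq_expoly c u v : (forall K n, (n <= K)%N -> u K n = v K n) ->
  expoly c v -> expoly c u.
Proof. by move=> uv [P PE]; exists P => K n nK; rewrite uv // PE. Qed.

Lemma expolyD c u v :
  expoly c u -> expoly c v -> expoly c (fun K n => u K n + v K n).
Proof.
move=> [P PE] [Q QE]; exists (P + Q) => K n nK.
by rewrite mulrDr PE // QE // hornerD mulrDr.
Qed.

Lemma expoly0 c : expoly c (fun _ _ => 0).
Proof. by exists 0 => K n _; rewrite mulr0 horner0 mulr0. Qed.

Definition conv u v K n := \sum_(i < n.+1) u K i * v K (n - i)%N.

(** For constant P and Q this is the binomial theorem. A factor i in P is absorbed by i C(n, i) = n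
    C(n - 1, i - 1), which lowers the degree; the induction is on P, then by symmetry on Q. *)
Lemma binomial_conv_poly c d P Q : c + d != 0 ->
  exists R : {poly F}, forall n : nat,
    \sum_(i < n.+1) 'C(n, i)%:R * (c ^+ i * P.[i%:R]) *
       (d ^+ (n - i) * Q.[(n - i)%:R]) = (c + d) ^+ n * R.[n%:R].
Proof.
pose S c d P Q n : F := \sum_(i < n.+1)
  'C(n, i)%:R * (c ^+ i * P.[i%:R]) * (d ^+ (n - i) * Q.[(n - i)%:R]).
pose ok c d P Q :=
  exists R : {poly F}, forall n : nat, S c d P Q n = (c + d) ^+ n * R.[n%:R].
rewrite -/(ok c d P Q).
have SC c1 d1 P1 Q1 n : S c1 d1 P1 Q1 n = S d1 c1 Q1 P1 n.
  rewrite /S (reindex_inj rev_ord_inj); apply: eq_bigr => i _ /=.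
  have ni : (i <= n)%N by rewrite -ltnS.
  by rewrite subSS subKn // bin_sub // -!mulrA; congr (_ * _); ring.
have okS c1 d1 P1 Q1 a : c1 + d1 != 0 -> ok c1 d1 (P1 \Po ('X + 1)) Q1 ->
    ok c1 d1 (a%:P) Q1 -> ok c1 d1 (P1 * 'X + a%:P) Q1.
  move=> cd0 [R RE] [R' R'E].
  (* At n + 1 this gives (n + 1) R(n) from the absorbed factor, and c1 / (c1 + d1) corrects the
     exponent of c1 + d1 after the shift. *)
  exists ((c1 / (c1 + d1)) *: ('X * (R \Po ('X - 1))) + R') => n.
  rewrite hornerD mulrDr -R'E.
  have -> : S c1 d1 (P1 * 'X + a%:P) Q1 n = S c1 d1 (P1 * 'X) Q1 n +
                                          S c1 d1 a%:P Q1 n.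
    rewrite /S -big_split; apply: eq_bigr => i _ /=.
    by rewrite hornerD mulrDr mulrDr mulrDl.
  congr (_ + _); case: n => [|n].
    by rewrite /S big_ord1 hornerZ !hornerM !hornerX !(mulr0, mul0r).
  rewrite hornerZ hornerM hornerX horner_comp hornerD hornerN hornerX hornerC.
  have -> : n.+1%:R - 1 = n%:R :> F by rewrite -natr1 addrK.
  have -> : (c1 + d1) ^+ n.+1 * (c1 / (c1 + d1) * (n.+1%:R * R.[n%:R])) =
            (c1 + d1) ^+ n * c1 * ((n%:R + 1) * R.[n%:R]).
    rewrite exprSr natr1 mulrA -(mulrA _ (c1 + d1)) [(c1 + d1) * _]mulrC.
    by rewrite divfK.
  have -> : (c1 + d1) ^+ n * c1 * ((n%:R + 1) * R.[n%:R]) =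
            (n%:R + 1) * c1 * S c1 d1 (P1 \Po ('X + 1)) Q1 n.
    by rewrite RE; ring.
  rewrite /S big_ord_recl hornerM hornerX !(mulr0, mul0r) add0r mulr_sumr.
  apply: eq_bigr => i _; rewrite lift0 subSS hornerM hornerX horner_comp.
  rewrite hornerD hornerX hornerC.
  have -> : i.+1%:R = i%:R + 1 :> F by rewrite -natr1.
  have e : 'C(n.+1, i.+1)%:R * (i%:R + 1) = (n%:R + 1) * 'C(n, i)%:R :> F.
    by rewrite !natr1 -!natrM mulnC -mul_bin_diag.
  rewrite exprS.
  transitivity ('C(n.+1, i.+1)%:R * (i%:R + 1) * (c1 * c1 ^+ i * P1.[i%:R + 1] * (d1 ^+ (n - i) * Q1.[(n - i)%:R]))).
    by ring.
  by rewrite e; ring.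
have ok_const c1 d1 a b : ok c1 d1 a%:P b%:P.
  exists (a * b)%:P => n; rewrite hornerC exprDn_comm; last exact: mulrC.
  rewrite mulr_suml /S (reindex_inj rev_ord_inj); apply: eq_bigr => i _ /=.
  have ni : (i <= n)%N by rewrite -ltnS.
  by rewrite subSS subKn // bin_sub // !hornerC -mulr_natl; ring.
have okC c1 d1 P1 Q1 : ok c1 d1 P1 Q1 -> ok d1 c1 Q1 P1.
  by move=> [R RE]; exists R => n; rewrite SC RE [c1 + _]addrC.
have ind c1 d1 Q1 : c1 + d1 != 0 -> (forall a, ok c1 d1 a%:P Q1) ->
    forall P1, ok c1 d1 P1 Q1.
  move=> cd0 okc P1; elim: {P1}(size P1) {-2}P1 (leqnn (size P1)) => [|k IHk] P1.
    by rewrite leqn0 size_poly_eq0 => /eqP ->; apply: okc.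
  elim/poly_ind: P1 => [_|P1 a _]; first exact: okc.
  rewrite size_MXaddC => sP.
  apply: okS (okc a) => //; apply: IHk; rewrite size_comp_poly2 ?size_XaddC //.
  by move: sP; case: ifP => // /andP[/eqP -> _]; rewrite size_poly0.
move=> cd0; apply: (ind) => // a; apply: okC; apply: ind; first by rewrite addrC.
by move=> b; apply: ok_const.
Qed.

Lemma expoly_conv c d u v : c + d != 0 ->
  expoly c u -> expoly d v -> expoly (c + d) (conv u v).
Proof.
move=> cd0 [P PE] [Q QE].
have [R RE] := binomial_conv_poly P Q cd0.
exists R => K n nK; rewrite -RE /conv mulr_sumr; apply: eq_bigr => i _.
have ni : (i <= n)%N by rewrite -ltnS.
rewrite -(PE K) ?(leq_trans ni) // -(QE K) ?(leq_trans (leq_subr _ _)) //.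
by rewrite -(bin_fact ni) !natrM; ring.
Qed.

(* The sequence [n! c^(-n) u K n] has polynomial differences. *)
Lemma expoly_step c u v a : c != 0 -> (forall K, u K 0 = a) ->
  (forall K n, (n < K)%N -> n.+1%:R * u K n.+1 = c * (u K n + v K n)) ->
  expoly c v -> expoly c u.
Proof.
move=> c0 u0 uS [P PE]; have [Q Q0 QE] := antidifference P.
exists (Q + a%:P) => K; elim=> [|n IHn] nK.
  by rewrite u0 hornerD Q0 hornerC add0r fact0.
rewrite factS natrM mulrAC [_ * u _ _]uS //.
rewrite -mulrA [_ * n`!%:R]mulrC mulrDr IHn ?(ltnW nK) // PE ?(ltnW nK) //.
by rewrite exprS !hornerD !hornerC -QE natr1; ring.
Qed.

End Summation.

(** * Growth of weighted sums along a graded graph *)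

Section Growth.
Variables (F : numFieldType) (X : eqType) (I : Type).
Variables (wt : I -> nat) (gen : I -> X -> F).

(** Polynomials in the generators of weighted degree at most d, as an inductive predicate on
    functions so that proofs may follow a presentation. *)
Inductive fil : nat -> (X -> F) -> Prop :=
| fil_const c : fil 0 (fun=> c)
| fil_gen i : fil (wt i) (gen i)
| fil_add d f g : fil d f -> fil d g -> fil d (fun x => f x + g x)
| fil_mul d e f g : fil d f -> fil e g -> fil (d + e) (fun x => f x * g x)
| fil_le d e f : (d <= e)%N -> fil d f -> fil e f.

Lemma fil_ext d f g : f =1 g -> fil d f -> fil d g.
Proof. by move=> /funext ->. Qed.

Lemma filZ d c f : fil d f -> fil d (fun x => c * f x).
Proof. by move=> df; rewrite -[d]add0n; apply: fil_mul => //; apply: fil_const. Qed.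

Lemma fil0 d : fil d (fun=> 0).
Proof. exact: fil_le (leq0n d) (fil_const 0). Qed.

Lemma fil_sum d (J : Type) (s : seq J) (P : pred J) (f : J -> X -> F) :
  (forall j, P j -> fil d (f j)) -> fil d (fun x => \sum_(j <- s | P j) f j x).
Proof.
move=> df; elim: s => [|j s IHs].
  by apply: fil_ext (fil0 d) => x; rewrite big_nil.
case Pj: (P j); last by apply: fil_ext IHs => x; rewrite big_cons Pj.
by apply: fil_ext (fil_add (df j Pj) IHs) => x; rewrite big_cons Pj.
Qed.

Lemma fil_hq (q : nat -> X -> F) :
  (forall i, (0 < i)%N -> fil i (q i)) ->
  forall k, fil k (fun x => hq (fun i => q i x) k).
Proof.
move=> dq; elim/ltn_ind => -[|k] IHk.
  by apply: fil_ext (fil_const 1) => x; rewrite hq0.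
apply: (@fil_ext _ (fun x => k.+1%:R^-1 *
    \sum_(i < k.+1) q i.+1 x * hq (fun i => q i x) (k - i))) => [x|].
  by rewrite -hqE mulKf // pnatr_eq0.
apply/filZ/fil_sum => i _; have ik : (i <= k)%N by rewrite -ltnS.
have ki : (i.+1 + (k - i) <= k.+1)%N by rewrite addSn subnKC.
by apply: fil_le ki (fil_mul _ _); [apply: dq|apply: IHk; rewrite ltnS leq_subr].
Qed.

(* Functions of a state and of the position of a move, of degree less than d. *)
Inductive expansion (d : nat) : (X -> F -> F) -> Prop :=
| expansion0 : expansion d (fun _ _ => 0)
| expansionD e k f h : (e + k < d)%N -> fil e f -> expansion d h ->
    expansion d (fun x v => f x * v ^+ k + h x v).

Lemma expansion_ext d h h' :
  (forall x v, h x v = h' x v) -> expansion d h -> expansion d h'.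
Proof. by move=> hh'; have -> : h = h' by apply/funext => x; apply/funext. Qed.

Lemma expansion_le d d' h : (d <= d')%N -> expansion d h -> expansion d' h.
Proof.
move=> dd'; elim=> [|e k f {}h ekd ef _ IHh]; first exact: expansion0.
by apply: expansionD (leq_trans ekd dd') ef IHh.
Qed.

Lemma expansion_add d h h' :
  expansion d h -> expansion d h' -> expansion d (fun x v => h x v + h' x v).
Proof.
move=> dh dh'; elim: dh => [|e k f {}h ekd ef _ IHh].
  by apply: expansion_ext dh' => x v; rewrite add0r.
by apply: expansion_ext (expansionD ekd ef IHh) => x v; rewrite addrA.
Qed.

Lemma expansion_fil d e k f h : fil e f -> expansion d h ->
  expansion (e + k + d) (fun x v => f x * v ^+ k * h x v).
Proof.
move=> ef; elim=> [|e' k' f' {}h ekd ef' _ IHh].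
  by apply: expansion_ext (expansion0 _) => x v; rewrite mulr0.
have ekd' : ((e + e') + (k + k') < e + k + d)%N by rewrite addnACA ltn_add2l.
apply: expansion_ext (expansionD ekd' (fil_mul ef ef') IHh) => x v.
by rewrite exprD; ring.
Qed.

Lemma expansion_mul d d' h h' : expansion d h -> expansion d' h' ->
  expansion (d + d') (fun x v => h x v * h' x v).
Proof.
move=> dh dh'; elim: dh => [|e k f {}h ekd ef _ IHh].
  by apply: expansion_ext (expansion0 _) => x v; rewrite mul0r.
have ekd' : (e + k + d' <= d + d')%N by rewrite leq_add2r ltnW.
apply: expansion_ext
  (expansion_add (expansion_le ekd' (expansion_fil k ef dh')) IHh) => x v.
by rewrite mulrDl.
Qed.

Lemma expansion_horner d (P : {poly F}) :
  (size P <= d)%N -> expansion d (fun _ v => P.[v]).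
Proof.
move=> sP; suff: forall n, (n <= d)%N ->
    expansion d (fun _ v => \sum_(i < n) P`_i * v ^+ i).
  by move=> /(_ _ sP) /(expansion_ext _); apply => _ v; rewrite horner_coef.
elim=> [_|n IHn nd].
  by apply: expansion_ext (expansion0 _) => x v; rewrite big_ord0.
have := expansionD (e := 0) nd (fil_const P`_n) (IHn (ltnW nd)).
by move/expansion_ext; apply => x v; rewrite big_ord_recr addrC.
Qed.

(* A state [x] grows to [up x y] with transition weight [theta x y]; [v x y]
   is the position at which it grows. *)
Variables (Y : eqType) (lev : nat -> nat -> seq X) (w : X -> F) (c : F).
Variables (node : X -> seq Y) (up : X -> Y -> X) (theta v : X -> Y -> F).
Variables (x0 : nat -> X) (ok : pred X) (dgen : I -> {poly F}).
Hypothesis c0 : c != 0.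
Hypothesis lev0 : forall K, lev K 0 = [:: x0 K].
Hypothesis w0 : forall K, w (x0 K) = 1.
Hypothesis gen0 : forall K i, gen i (x0 K) = gen i (x0 0).
Hypothesis levS : forall K n (g : X -> F), (n < K)%N ->
  n.+1%:R * \sum_(x <- lev K n.+1) w x * g x =
  c * \sum_(x <- lev K n) w x * \sum_(y <- node x) theta x y * g (up x y).
Hypothesis lev_ok : forall K n, (n < K)%N -> {in lev K n, forall x, ok x}.
Hypothesis size_dgen : forall i, (size (dgen i) <= wt i)%N.
Hypothesis gen_up : forall i x y, ok x -> y \in node x ->
  gen i (up x y) = gen i x + (dgen i).[v x y].
Hypothesis theta_sum : forall x, ok x -> \sum_(y <- node x) theta x y = 1.
Hypothesis theta_moment : forall k, exists2 mu, fil k mu &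
  forall x, ok x -> \sum_(y <- node x) theta x y * v x y ^+ k = mu x.

(** Discrete Leibniz rule: the increment of f g is f Dg + g Df + Df Dg, and each term has lost at
    least one unit of total degree. *)
Lemma fil_up d f : fil d f -> exists2 h, expansion d h &
  forall x y, ok x -> y \in node x -> f (up x y) = f x + h x (v x y).
Proof.
elim=> {d f} [a|i|d f g _ [h dh fh] _ [h' dh' gh']
  |d e f g df [h dh fh] eg [h' dh' gh']|d e f de _ [h dh fh]].
- by exists (fun _ _ => 0) => [|x y _ _]; rewrite ?addr0 //; apply: expansion0.
- exists (fun _ v => (dgen i).[v]); last exact: gen_up.
  exact: expansion_horner.
- exists (fun x v => h x v + h' x v); first exact: expansion_add.
  by move=> x y xok xy; rewrite fh // gh' // addrACA.
- exists (fun x v => f x * v ^+ 0 * h' x v + (g x * v ^+ 0 * h x v + h x v * h' x v)).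
    apply: expansion_add; first by rewrite -{1}[d]addn0; apply: expansion_fil.
    apply: expansion_add; last exact: expansion_mul.
    by rewrite addnC -{1}[e]addn0; apply: expansion_fil.
  by move=> x y xok xy; rewrite fh // gh' // expr0; ring.
- by exists h => //; apply: expansion_le dh.
Qed.

(** The k-th moment has weight k, so averaging preserves the total degree of every term. For d = 0
    the expansion is zero and [d.-1] loses nothing. *)
Lemma expansion_average d h : expansion d h -> exists2 g, fil d.-1 g &
  forall x, ok x -> \sum_(y <- node x) theta x y * h x (v x y) = g x.
Proof.
elim=> [|e k f {}h ekd ef _ [g dg hg]].
  exists (fun=> 0) => [|x _]; first exact: fil0.
  by rewrite big1 // => y _; rewrite mulr0.
have [mu kmu muE] := theta_moment k.
exists (fun x => f x * mu x + g x) => [|x xok].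
  apply: fil_add dg; apply: fil_le (fil_mul ef kmu).
  by move: ekd; case: (d).
rewrite -hg // -muE // mulr_sumr -big_split; apply: eq_bigr => y _ /=.
by ring.
Qed.

Lemma fil_x0 d f : fil d f -> forall K, f (x0 K) = f (x0 0).
Proof.
elim=> // {d f} [d f g _ fK _ gK|d e f g _ fK _ gK] K; by rewrite fK gK.
Qed.

Theorem growth_expoly d g : fil d g ->
  expoly c (fun K n => \sum_(x <- lev K n) w x * g x).
Proof.
elim: d g => [|d IHd] g dg.
  have g0 := fil_x0 dg.
  apply: (expoly_step (v := fun _ _ => 0) (a := g (x0 0))) => // [K|K n nK|].
  - by rewrite lev0 big_seq1 w0 mul1r.
  - have [h dh gh] := fil_up dg; rewrite levS // addr0; congr (_ * _).
    rewrite big_seq [RHS]big_seq; apply: eq_bigr => x xl; congr (_ * _).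
    have xok := lev_ok nK xl; rewrite -[RHS]mul1r -(theta_sum xok) mulr_suml.
    rewrite big_seq [RHS]big_seq; apply: eq_bigr => y yx; congr (_ * _).
    (* An expansion of degree below 0 is zero, so a function of weight 0 does not change along
       moves. *)
    rewrite gh //; move: dh.
    by case=> [|e k f h']; rewrite ?addr0 // ltn0.
  - exact: expoly0.
have [h dh gh] := fil_up dg; have [Dg dDg hDg] := expansion_average dh.
have g0 := fil_x0 dg.
apply: (expoly_step (a := g (x0 0)) _ _ _ (IHd _ dDg)) => // [K|K n nK].
  by rewrite lev0 big_seq1 w0 mul1r.
rewrite levS // -big_split; congr (_ * _).
rewrite [LHS]big_seq [RHS]big_seq; apply: eq_bigr => x xl /=; rewrite -mulrDr.
have xok := lev_ok nK xl; rewrite -hDg // -[g x]mul1r -(theta_sum xok).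
rewrite mulr_suml -big_split; congr (_ * _).
rewrite [LHS]big_seq [RHS]big_seq; apply: eq_bigr => y yx /=.
by rewrite gh // mulrDr.
Qed.

End Growth.

(** * Plancherel weights of partitions *)

Section FsetBig.
Local Open Scope fset_scope.
Variables (R : Type) (idx : R) (op : Monoid.com_law idx).
Implicit Types (B C : {fset nat}).

Lemma big_seq_bij (T1 T2 : eqType) (s1 : seq T1) (s2 : seq T2)
    (P1 : pred T1) (P2 : pred T2) (f : T1 -> T2) (g : T2 -> T1) (F : T2 -> R) :
  uniq s1 -> uniq s2 ->
  (forall x, x \in s1 -> P1 x -> [/\ f x \in s2, P2 (f x) & g (f x) = x]) ->
  (forall y, y \in s2 -> P2 y -> [/\ g y \in s1, P1 (g y) & f (g y) = y]) ->
  \big[op/idx]_(y <- s2 | P2 y) F y = \big[op/idx]_(x <- s1 | P1 x) F (f x).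
Proof.
move=> u1 u2 fs gs; rewrite -big_filter -[RHS]big_filter -[RHS](big_map f xpredT).
apply: perm_big; apply: uniq_perm; first exact: filter_uniq.
  rewrite map_inj_in_uniq ?filter_uniq // => x x'; rewrite !mem_filter.
  move=> /andP[Px xs] /andP[Px' xs'] e.
  by have [_ _ <-] := fs x xs Px; rewrite e; have [_ _ ->] := fs x' xs' Px'.
move=> y; rewrite mem_filter; apply/andP/mapP => [[Py ys]|[x]].
  by have [gys Pgy <-] := gs y ys Py; exists (g y); rewrite ?mem_filter ?Pgy.
by rewrite mem_filter => /andP[Px xs] ->; have [] := fs x xs Px.
Qed.

(** Used to count the edges of a growth graph from either end: (state, move up) against (state, move
    down). *)
Lemma big_pair_bij (X X' Y Y' : eqType) (s : seq X) (A : X -> seq Y)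
    (P : X -> pred Y) (s' : seq X') (A' : X' -> seq Y') (P' : X' -> pred Y')
    (f : X * Y -> X' * Y') (g : X' * Y' -> X * Y) (F : X' -> Y' -> R) :
  uniq s -> uniq s' -> (forall x, uniq (A x)) -> (forall x, uniq (A' x)) ->
  (forall x y, x \in s -> y \in A x -> P x y ->
     [/\ (f (x, y)).1 \in s', (f (x, y)).2 \in A' (f (x, y)).1,
      P' (f (x, y)).1 (f (x, y)).2 & g (f (x, y)) = (x, y)]) ->
  (forall x y, x \in s' -> y \in A' x -> P' x y ->
     [/\ (g (x, y)).1 \in s, (g (x, y)).2 \in A (g (x, y)).1,
      P (g (x, y)).1 (g (x, y)).2 & f (g (x, y)) = (x, y)]) ->
  \big[op/idx]_(x <- s') \big[op/idx]_(y <- A' x | P' x y) F x y =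
  \big[op/idx]_(x <- s) \big[op/idx]_(y <- A x | P x y)
    F (f (x, y)).1 (f (x, y)).2.
Proof.
move=> us us' uA uA' fP gP.
have flat (Z W : eqType) (r : seq Z) (D : Z -> seq W) (Q : Z -> pred W) G :
    \big[op/idx]_(x <- r) \big[op/idx]_(y <- D x | Q x y) G x y =
    \big[op/idx]_(p <- [seq (x, y) | x <- r, y <- D x] | Q p.1 p.2) G p.1 p.2.
  rewrite [RHS]big_mkcond big_allpairs_dep; apply: eq_bigr => x _.
  by rewrite [LHS]big_mkcond.
have uniq_flat (Z W : eqType) (r : seq Z) (D : Z -> seq W) :
    uniq r -> (forall x, uniq (D x)) -> uniq [seq (x, y) | x <- r, y <- D x].
  move=> ur uD; apply: allpairs_uniq_dep => // [[x1 y1] [x2 y2] _ _ /= e].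
  by case: e => -> ->.
rewrite !flat; under [RHS]eq_bigr do rewrite -surjective_pairing.
apply: (@big_seq_bij _ _ _ _ _ _ f g (fun p => F p.1 p.2)).
- exact: uniq_flat.
- exact: uniq_flat.
- move=> [x y] /allpairsPdep [x1 [y1 [xs yA [-> ->]]]] /= Pxy.
  have [fs fA fP' fg] := fP _ _ xs yA Pxy; split => //.
  by rewrite [f _]surjective_pairing; apply/allpairsPdep; exists (f (x1, y1)).1, (f (x1, y1)).2.
- move=> [x y] /allpairsPdep [x1 [y1 [xs yA [-> ->]]]] /= Pxy.
  have [fs fA fP' fg] := gP _ _ xs yA Pxy; split => //.
  by rewrite [g _]surjective_pairing; apply/allpairsPdep; exists (g (x1, y1)).1, (g (x1, y1)).2.
Qed.

Lemma big_fset_neq B b (F : nat -> R) :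
  \big[op/idx]_(c <- B | c != b) F c = \big[op/idx]_(c <- B `\ b) F c.
Proof.
rewrite -big_filter; apply: perm_big; apply: uniq_perm.
- by rewrite filter_uniq ?fset_uniq.
- exact: fset_uniq.
- by move=> c; rewrite mem_filter !inE.
Qed.

Lemma big_ord_fset B n (F : nat -> R) :
  \big[op/idx]_(i < n | (i : nat) \in B) F i = \big[op/idx]_(i <- B | (i < n)%N) F i.
Proof.
rewrite -(big_mkord (fun i => i \in B)) -big_filter -[RHS]big_filter.
apply: perm_big; apply: uniq_perm.
- by rewrite filter_uniq ?iota_uniq.
- by rewrite filter_uniq ?fset_uniq.
- by move=> i; rewrite !mem_filter mem_index_iota andbC.
Qed.

Lemma big_pairs_fsetU1 c C (k : nat -> nat -> R) : c \notin C ->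
  \big[op/idx]_(x <- c |` C) \big[op/idx]_(y <- c |` C | (y < x)%N) k x y =
  op (\big[op/idx]_(x <- C) \big[op/idx]_(y <- C | (y < x)%N) k x y)
     (\big[op/idx]_(y <- C) (if (y < c)%N then k c y else k y c)).
Proof.
move=> cC; rewrite big_fsetU1 //=.
have -> : \big[op/idx]_(y <- c |` C | (y < c)%N) k c y =
          \big[op/idx]_(y <- C | (y < c)%N) k c y.
  by rewrite big_mkcond big_fsetU1 //= ltnn Monoid.mul1m -big_mkcond.
have -> : \big[op/idx]_(x <- C) \big[op/idx]_(y <- c |` C | (y < x)%N) k x y =
    op (\big[op/idx]_(x <- C | (c < x)%N) k x c)
       (\big[op/idx]_(x <- C) \big[op/idx]_(y <- C | (y < x)%N) k x y).
  rewrite [\big[op/idx]_(x <- C | (c < x)%N) _]big_mkcond -big_split.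
  apply: eq_bigr => x _ /=.
  by rewrite big_mkcond big_fsetU1 //= -big_mkcond.
have AC a b p : op a (op b p) = op p (op a b) by rewrite Monoid.mulmA Monoid.mulmC.
rewrite AC; congr (op _ _).
rewrite big_mkcond [\big[op/idx]_(x <- C | (c < x)%N) _]big_mkcond -big_split.
rewrite [LHS]big_seq [RHS]big_seq; apply: eq_bigr => y yC /=.
case: ltngtP => // [_|_|yc]; rewrite ?Monoid.mulm1 ?Monoid.mul1m //.
by move: cC; rewrite -yc yC.
Qed.

End FsetBig.

Section Gaps.
Local Open Scope fset_scope.
Implicit Types (B : {fset nat}).

(** For a bead x this is the part of the partition encoded by x. *)
Definition gaps_below B x := (\sum_(y < x | (y : nat) \notin B) 1)%N.

Lemma sum_pairs B :
  (\sum_(x <- B) \sum_(y <- B | (y < x)%N) 1)%N = 'C(#|` B|, 2).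
Proof.
elim/fset1U_rect: B => [|c C cC IH]; first by rewrite big_seq_fset0 cardfs0.
rewrite big_pairs_fsetU1 // IH cardfsU1 cC add1n binS bin1; congr (_ + _)%N.
by under eq_bigr do rewrite if_same; rewrite big_const_seq count_predT iter_addn_0 mul1n.
Qed.

Lemma sum_gaps B :
  (\sum_(x <- B) gaps_below B x + 'C(#|` B|, 2) = \sum_(x <- B) x)%N.
Proof.
rewrite -sum_pairs -big_split; apply: eq_bigr => x _ /=.
rewrite -big_ord_fset addnC -(bigID (fun y : 'I_x => (y : nat) \in B) xpredT) /=.
by rewrite sum_nat_const card_ord muln1.
Qed.

End Gaps.

Section ChargedModel.
Local Open Scope fset_scope.
Local Open Scope ring_scope.
Variable F : numFieldType.
Implicit Types (B C : {fset nat}).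

Lemma fset_sum_ge B b : b \in B -> (b <= \sum_(x <- B) x)%N.
Proof. by move=> bB; rewrite (big_fsetD1 b) //= leq_addr. Qed.

Definition vacuum K : {fset nat} := [fset i in iota 0 K].

Lemma in_vacuum K b : (b \in vacuum K) = (b < K)%N.
Proof. by rewrite in_fset mem_iota. Qed.

Lemma card_vacuum K : #|` vacuum K| = K.
Proof. by rewrite card_fseq undup_id ?iota_uniq ?size_iota. Qed.

(* A set [B] of [K] beads encodes the partition obtained by sorting it
   decreasingly and subtracting [K-1, ..., 1, 0]. *)
Definition bead_level K n : seq {fset nat} :=
  [seq B <- fpowerset (vacuum (n + 'C(K, 2)).+1) |
    (#|` B| == K) && (\sum_(b <- B) b == n + 'C(K, 2))%N].

Lemma mem_bead_level K n B : (B \in bead_level K n) =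
  (#|` B| == K) && (\sum_(b <- B) b == n + 'C(K, 2))%N.
Proof.
rewrite mem_filter; apply: andb_idr => /andP[_ /eqP sB].
rewrite fpowersetE; apply/fsubsetP => b /fset_sum_ge; rewrite sB => bn.
by rewrite in_vacuum ltnS.
Qed.

Lemma bead_level_uniq K n : uniq (bead_level K n).
Proof. exact/filter_uniq/fset_uniq. Qed.

Lemma sum_gaps_level K n B : B \in bead_level K n ->
  (\sum_(x <- B) gaps_below B x = n)%N.
Proof.
rewrite mem_bead_level => /andP[/eqP cB /eqP]; rewrite -sum_gaps cB.
by move/addIn.
Qed.

Lemma bead_level_bound K n B b : B \in bead_level K n -> b \in B ->
  (b < n + K)%N.
Proof.
move=> Bl bB; have gb : (gaps_below B b <= n)%N.
  by rewrite -(sum_gaps_level Bl) (big_fsetD1 b) //= leq_addr.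
move: Bl; rewrite mem_bead_level => /andP[/eqP cB _].
suff : (b < gaps_below B b + #|` B|)%N by rewrite cB => /leq_trans; apply; rewrite leq_add2r.
rewrite -[X in (X < _)%N]card_ord -sum1_card (bigID (fun y : 'I_b => (y : nat) \in B)) /=.
rewrite addnC -addnS leq_add2l (big_ord_fset addn B b (fun=> 1%N)) -[X in (_ < X)%N]sum1_size (big_fsetD1 b) //=.
rewrite add1n ltnS big_mkcond (big_fsetD1 b) //= ltnn add0n.
by apply: leq_sum => i _; case: ifP.
Qed.

(** With position 0 empty all K parts would be positive, forcing n >= K. A bead at 0 means a zero
    part, hence room for a new row; this is where n < K enters. *)
Lemma bead_level_0in K n B : (n < K)%N -> B \in bead_level K n -> 0%N \in B.
Proof.
move=> nK Bl; apply: contraTT nK => B0; rewrite -leqNgt -(sum_gaps_level Bl).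
move: Bl; rewrite mem_bead_level => /andP[/eqP <- _].
rewrite -sum1_size big_seq [X in (_ <= X)%N]big_seq; apply: leq_sum => x xB.
have x0 : (0 < x)%N by case: x xB => // xB; rewrite xB in B0.
by rewrite /gaps_below (bigD1 (Ordinal x0)) //= leq_addr.
Qed.

Lemma bead_level0 K : bead_level K 0 = [:: vacuum K].
Proof.
have vE B : B \in bead_level K 0 -> B = vacuum K.
  move=> Bl; apply/eqP; move: (Bl); rewrite mem_bead_level => /andP[/eqP cB _].
  rewrite eqEfcard; apply/andP; split.
    by apply/fsubsetP => b /(bead_level_bound Bl); rewrite in_vacuum.
  by rewrite cB card_vacuum.
have vl : vacuum K \in bead_level K 0.
  rewrite mem_bead_level card_vacuum eqxx /= -{2}(card_vacuum K) -sum_gaps.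
  rewrite big1_seq // => x /= xK; rewrite /gaps_below big_pred0 // => y.
  rewrite in_vacuum (ltn_trans (ltn_ord y)) //.
  by move: xK; rewrite in_vacuum.
apply: perm_small_eq => //; apply: uniq_perm => //; first exact: bead_level_uniq.
by move=> B; rewrite inE; apply/idP/eqP => [/vE|->].
Qed.

(** Frobenius' formula for the inverse of the product of all hook lengths; see [hook_inv_gaps]. *)
Definition hook_inv B : F := (\prod_(x <- B) x`!%:R)^-1 *
  \prod_(x <- B) \prod_(y <- B | (y < x)%N) (x - y)%:R.

Definition bead_up B b : {fset nat} := b.+1 |` (B `\ b).

(** The factor by which [hook_inv] changes when the bead b moves to b + 1. It vanishes when b + 1 is
    occupied, so sums may run over all beads; likewise for [down_ratio]. *)
Definition up_ratio B b : F := b.+1%:R^-1 *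
  \prod_(c <- B | c != b) ((b.+1%:R - c%:R) / (b%:R - c%:R)).

Definition down_ratio B b : F := b%:R *
  \prod_(c <- B | c != b) ((b%:R - 1 - c%:R) / (b%:R - c%:R)).

Lemma natr_subr_neq0 (m n : nat) : m != n -> m%:R - n%:R != 0 :> F.
Proof. by rewrite subr_eq0 eqr_nat. Qed.

Lemma hook_inv_fsetU1 c C : c \notin C -> hook_inv (c |` C) =
  hook_inv C * (c`!%:R^-1 * \prod_(y <- C) (if (y < c)%N then (c - y)%:R else (y - c)%:R)).
Proof.
move=> cC; rewrite /hook_inv big_pairs_fsetU1 // big_fsetU1 //= invfM.
by ring.
Qed.

Lemma hook_inv_up B b : b \in B -> b.+1 \notin B ->
  hook_inv (bead_up B b) = hook_inv B * up_ratio B b.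
Proof.
move=> bB b1B; have bC : b \notin B `\ b by rewrite !inE eqxx.
have b1C : b.+1 \notin B `\ b by rewrite !inE negb_and b1B orbT.
rewrite /bead_up -{2}(fsetD1K bB) /up_ratio big_fset_neq !hook_inv_fsetU1 //.
set p1 := \prod_(y <- _) _; set p2 := \prod_(y <- _) _; set p3 := \prod_(y <- _) _.
suff -> : p1 = p2 * p3 by rewrite factS natrM invfM; ring.
rewrite -big_split /p1 big_seq [RHS]big_seq; apply: eq_bigr => c cC /=.
have [cb cb1] : c != b /\ c != b.+1.
  by split; [apply: contraTneq cC => ->|apply: contraTneq cC => ->].
have bc0 : b%:R - c%:R != 0 :> F by rewrite natr_subr_neq0 // eq_sym.
case: (ltngtP c b) => [cb'|bc|e]; last by rewrite e eqxx in cb.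
  by rewrite leqW // !natrB ?leqW 1?ltnW // mulrCA divff // mulr1.
have b1c : (b.+1 < c)%N by rewrite ltn_neqAle eq_sym cb1.
rewrite ltnNge (ltnW b1c) /= !natrB 1?ltnW // -[c%:R - _]opprB -[c%:R - b%:R]opprB.
by rewrite mulNr mulrCA divff // mulr1.
Qed.

Lemma down_up_ratio B b : b \in B -> b.+1 \notin B ->
  down_ratio (bead_up B b) b.+1 * up_ratio B b = 1.
Proof.
move=> bB b1B; have b1C : b.+1 \notin B `\ b by rewrite !inE negb_and b1B orbT.
rewrite /down_ratio /up_ratio !big_fset_neq fsetU1K // mulrACA divff ?mul1r.
  rewrite -big_split big1_seq // => c /= cC.
  have [cb cb1] : c != b /\ c != b.+1.
    by split; [apply: contraTneq cC => ->; rewrite !inE eqxx|apply: contraTneq cC => ->].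
  have -> : b.+1%:R - 1 = b%:R :> F by rewrite -natr1 addrK.
  by rewrite mulrA divfK ?divff // natr_subr_neq0 // eq_sym.
by rewrite pnatr_eq0.
Qed.

Lemma up_ratio_eq0 B b : b.+1 \in B -> up_ratio B b = 0.
Proof.
move=> b1B; rewrite /up_ratio big_fset_neq (big_fsetD1 b.+1) /=.
  by rewrite subrr !(mul0r, mulr0).
by rewrite !inE b1B andbT -[b.+1]addn1 -[X in _ != X]addn0 eqn_add2l.
Qed.

Lemma down_ratio_eq0 B b : (b == 0%N) || (b.-1 \in B) -> down_ratio B b = 0.
Proof.
rewrite /down_ratio; case: b => [|b] /=; first by rewrite mul0r.
move=> bB; rewrite big_fset_neq (big_fsetD1 b) /=.
  by rewrite -natr1 addrK subrr !(mul0r, mulr0).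
by rewrite !inE bB andbT -[b.+1]addn1 -[X in X != _]addn0 eqn_add2l.
Qed.

(** The right side is the size of the partition, so this is the branching rule for the numbers of
    standard tableaux. The down ratios are the negated terms of the divided difference of x times
    the product of the x - (c + 1) over the nodes c in B, which is h_2 for the power sums p_i(B) -
    p_i(B + 1). *)
Lemma sum_down_ratio B :
  \sum_(b <- B) down_ratio B b = (\sum_(b <- B) b)%:R - 'C(#|` B|, 2)%:R.
Proof.
have [->|B0] := eqVneq B fset0.
  by rewrite !big_seq_fset0 cardfs0 subrr.
pose a := [seq b%:R : F | b <- B]; pose b := [seq c%:R + 1 : F | c <- B].
have ua : uniq a.
  by rewrite map_inj_uniq ?fset_uniq // => x y /eqP; rewrite eqr_nat => /eqP.
have a0 : a != [::].
  by rewrite -size_eq0 size_map -lt0n cardfs_gt0.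
have := divdiff_rational b 1 ua a0.
have [sa sb] : size a = #|` B| /\ size b = #|` B| by rewrite !size_map.
rewrite /hq_shift sa sb add1n leqW // -addn2 addKn.
set q := (fun i => psum a i - psum b i); have q1 : q 1%N = - #|` B|%:R.
  rewrite /q /psum !big_map -sumrB -sum1_size natr_sum -sumrN.
  by apply: eq_bigr => i _; rewrite !expr1; ring.
have q2 : q 2%N = - #|` B|%:R - 2%:R * (\sum_(b <- B) b)%:R.
  rewrite /q /psum !big_map -sumrB -sum1_size !natr_sum -sumrN mulr_sumr -sumrB.
  by apply: eq_bigr => i _; ring.
have -> : hq q 2 = 'C(#|` B|, 2)%:R - (\sum_(b <- B) b)%:R.
  have n2 : 2%:R != 0 :> F by rewrite pnatr_eq0.
  apply: (mulfI n2); rewrite hqE !big_ord_recl big_ord0 /= !subn0 subnn hq0.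
  have := hqE q 0; rewrite big_ord1 hq0 mul1r mulr1 => ->; rewrite q1 q2.
  have -> : 2%:R * ('C(#|` B|, 2)%:R - (\sum_(b <- B) b)%:R) =
    #|` B|%:R * (#|` B|%:R - 1) - 2%:R * (\sum_(b <- B) b)%:R :> F.
    rewrite mulrBr; congr (_ - _); rewrite -natrM.
    have := mul_bin_diag #|` B| 1; rewrite bin1 => <-.
    case: (#|` B|) => [|k]; first by rewrite mul0n mul0r.
    by rewrite natrM -[k.+1%:R]natr1 addrK natr1.
  by ring.
move/(congr1 -%R); rewrite opprB => <-.
rewrite /divdiff big_map -sumrN big_seq [RHS]big_seq; apply: eq_bigr => c cB.
rewrite expr1 !big_map (big_fsetD1 c) //=.
have -> : c%:R - (c%:R + 1) = -1 :> F by ring.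
rewrite mulN1r mulrN mulNr opprK -mulrA; congr (_ * _).
under [X in _ / X]eq_bigl do rewrite eqr_nat.
rewrite [in RHS]big_fset_neq /down_ratio big_fset_neq -prodf_div.
by apply: eq_bigr => d _; rewrite opprD addrA addrAC.
Qed.

End ChargedModel.

(** * Moments of the transition weights for one partition *)

Section ChargedGrowth.
Local Open Scope fset_scope.
Local Open Scope ring_scope.
Variable F : numFieldType.
Implicit Types (B C : {fset nat}).

(** Measuring from the number of beads and subtracting the vacuum makes the value depend on the
    partition only, not on how many beads represent it. *)
Definition bead_psum j B : F :=
  \sum_(b <- B) (b%:R - #|` B|%:R) ^+ j -
  \sum_(b < #|` B|) (b%:R - #|` B|%:R) ^+ j.

(** The left side is p_i(poles) - p_i(zeros) for the up moves. The vacuum part of the right side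
    telescopes to the term (- K)^i, and only indices j < i remain. *)
Lemma bead_psum_newton i B : (0 < i)%N ->
  \sum_(b <- B) (b.+1%:R - #|` B|%:R) ^+ i + (- #|` B|%:R) ^+ i -
  \sum_(b <- B) (b%:R - #|` B|%:R) ^+ i =
  \sum_(j < i) 'C(i, j)%:R * bead_psum j B.
Proof.
move=> i0; set K : F := #|` B|%:R.
have diff (b : nat) : (b.+1%:R - K) ^+ i - (b%:R - K) ^+ i =
    \sum_(j < i) 'C(i, j)%:R * (b%:R - K) ^+ j.
  have -> : b.+1%:R - K = 1 + (b%:R - K) by rewrite -natr1; ring.
  rewrite exprDn big_ord_recr /= subnn mul1r binn mulr1n addrK.
  by apply: eq_bigr => j _; rewrite expr1n mul1r mulr_natl.
rewrite addrAC -sumrB; under eq_bigr do rewrite diff.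
rewrite exchange_big /=; under eq_bigr do rewrite -mulr_sumr.
have -> : (- K) ^+ i =
    - \sum_(j < i) 'C(i, j)%:R * \sum_(b < #|` B|) (b%:R - K) ^+ j.
  under eq_bigr do rewrite mulr_sumr.
  rewrite exchange_big /=; under eq_bigr do rewrite -diff.
  rewrite -(big_mkord xpredT (fun b => (b.+1%:R - K) ^+ i - (b%:R - K) ^+ i)).
  rewrite (telescope_sumr (fun b : nat => (b%:R - K) ^+ i)) // subrr expr0n.
  by rewrite eqn0Ngt i0 /= sub0r sub0r opprK.
by rewrite -sumrB; apply: eq_bigr => j _; rewrite -mulrBr.
Qed.

(** Divided difference with nodes - K and b + 1 - K and zeros b - K. The extra node makes one node
    more than zeros, so that h_k results, and it contributes nothing because 0 in B gives a zero at
    - K. *)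
Lemma sum_up_ratio B k : 0%N \in B ->
  \sum_(b <- B) up_ratio F B b * (b.+1%:R - #|` B|%:R) ^+ k =
  hq (fun i => \sum_(j < i) 'C(i, j)%:R * bead_psum j B) k.
Proof.
move=> B0; set K : F := #|` B|%:R.
pose a := - K :: [seq b.+1%:R - K : F | b <- B].
pose z := [seq b%:R - K : F | b <- B].
have ua : uniq a.
  rewrite /= map_inj_uniq ?fset_uniq ?andbT; last first.
    by move=> x y /addIr/eqP; rewrite eqr_nat eqSS => /eqP.
  apply/mapP => -[b _ /eqP]; rewrite -subr_eq0 -opprD oppr_eq0 addrCA subrr addr0.
  by rewrite pnatr_eq0.
have := divdiff_rational z k ua isT.
have [sa sz] : size a = #|` B|.+1 /\ size z = #|` B| by rewrite /= !size_map.
rewrite /hq_shift sa sz subSS addnK ltnS leq_addl.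
rewrite (@eq_hq _ _ (fun i => \sum_(j < i) 'C(i, j)%:R * bead_psum j B)) => [<-|i i0].
  rewrite /divdiff big_cons [X in _ * X / _](_ : _ = 0) => [|].
    rewrite mulr0 mul0r add0r big_map big_seq [RHS]big_seq.
    apply: eq_bigr => b bB; rewrite mulrC -mulrA; congr (_ * _).
    rewrite /z !big_map (big_fsetD1 b) //= big_cons.
    have -> : b.+1%:R - K - (b%:R - K) = 1 by rewrite -natr1; ring.
    have neq : - K != b.+1%:R - K.
      by rewrite -subr_eq0 -opprD oppr_eq0 addrCA subrr addr0 pnatr_eq0.
    rewrite neq big_map mul1r.
    have -> : \prod_(c <- B | c.+1%:R - K != b.+1%:R - K)
        (b.+1%:R - K - (c.+1%:R - K)) = \prod_(c <- B `\ b) (b%:R - c%:R).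
      rewrite -big_fset_neq; apply: eq_big => [c|c _].
        by rewrite (inj_eq (addIr _)) eqr_nat eqSS.
      by rewrite -!natr1; ring.
    have -> : b.+1%:R - K - - K = b.+1%:R by ring.
    have -> : \prod_(c <- B `\ b) (b.+1%:R - K - (c%:R - K)) =
              \prod_(c <- B `\ b) (b.+1%:R - c%:R).
      by apply: eq_bigr => c _; ring.
    by rewrite /up_ratio !big_fset_neq prodf_div invfM mulrCA.
  by rewrite /z big_map (big_fsetD1 0%N) //= sub0r subrr mul0r.
by rewrite /psum big_cons !big_map -bead_psum_newton // [X in X - _]addrC.
Qed.

Lemma hook_inv_vacuum K : hook_inv F (vacuum K) = 1.
Proof.
rewrite /hook_inv mulrC [X in X / _](_ : _ = \prod_(x <- vacuum K) x`!%:R).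
  by apply: divff; rewrite prodf_seq_neq0; apply/allP => x _; rewrite pnatr_eq0 -lt0n fact_gt0.
rewrite big_seq [RHS]big_seq; apply: eq_bigr => x; rewrite in_vacuum => xK.
rewrite -big_ord_fset (eq_bigl xpredT) => [|y]; last first.
  by rewrite in_vacuum (ltn_trans (ltn_ord y)).
rewrite -natr_prod; congr (_ %:R).
rewrite fact_prod big_add1 /= big_mkord (reindex_inj rev_ord_inj) /=.
by apply: eq_bigr => i _; rewrite subKn.
Qed.

Lemma bead_up_level K n B b : B \in bead_level K n -> b \in B ->
  b.+1 \notin B -> bead_up B b \in bead_level K n.+1.
Proof.
rewrite !mem_bead_level => /andP[/eqP cB /eqP sB] bB b1B.
have b1C : b.+1 \notin B `\ b by rewrite !inE negb_and b1B orbT.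
rewrite /bead_up cardfsU1 b1C big_fsetU1 //= !addSn add0n -sB (big_fsetD1 b bB) /=.
by rewrite eqxx andbT -add1n -cB [X in _ == X](cardfsD1 b) bB.
Qed.

Definition bead_down B b : {fset nat} := b.-1 |` (B `\ b).

Lemma bead_down_level K n B b : B \in bead_level K n.+1 -> b \in B ->
  (0 < b)%N -> b.-1 \notin B -> bead_down B b \in bead_level K n.
Proof.
rewrite !mem_bead_level => /andP[/eqP cB /eqP sB] bB b0 b1B.
have b1C : b.-1 \notin B `\ b by rewrite !inE negb_and b1B orbT.
rewrite /bead_down cardfsU1 b1C big_fsetU1 //=.
move: sB; rewrite (big_fsetD1 b bB) /= -{1}(prednK b0) !addSn => -[->].
by rewrite eqxx andbT -cB [X in _ == X](cardfsD1 b) bB.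
Qed.

Lemma bead_upK B b : b \in B -> b.+1 \notin B -> bead_down (bead_up B b) b.+1 = B.
Proof.
move=> bB b1B; have b1C : b.+1 \notin B `\ b by rewrite !inE negb_and b1B orbT.
by rewrite /bead_down /bead_up fsetU1K // fsetD1K.
Qed.

Lemma bead_downK B b : b \in B -> (0 < b)%N -> b.-1 \notin B ->
  bead_up (bead_down B b) b.-1 = B.
Proof.
move=> bB b0 b1B; have b1C : b.-1 \notin B `\ b by rewrite !inE negb_and b1B orbT.
by rewrite /bead_down /bead_up fsetU1K // prednK // fsetD1K.
Qed.

(** Writing n + 1 as the sum of the down ratios turns both sides into sums over the edges between
    two levels. In the squared weight one factor r = [up_ratio] cancels the down ratio of the edge,
    the other is the transition weight. *)
Lemma bead_level_step K n (g : {fset nat} -> F) :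
  n.+1%:R * \sum_(B <- bead_level K n.+1) hook_inv F B ^+ 2 * g B =
  \sum_(B <- bead_level K n) hook_inv F B ^+ 2 *
    \sum_(b <- B | b.+1 \notin B) up_ratio F B b * g (bead_up B b).
Proof.
transitivity (\sum_(B <- bead_level K n.+1) \sum_(b <- B | (0 < b)%N && (b.-1 \notin B))
   hook_inv F B ^+ 2 * down_ratio F B b * g B).
  rewrite mulr_sumr big_seq [RHS]big_seq; apply: eq_bigr => B.
  rewrite mem_bead_level => /andP[/eqP cB /eqP sB].
  have := sum_down_ratio F B; rewrite cB sB natrD addrK => <-.
  rewrite mulr_suml [LHS](bigID (fun b => (0 < b)%N && (b.-1 \notin B))) /=.
  rewrite [X in _ + X]big1 ?addr0; first by apply: eq_bigr => b _; ring.
  by move=> b; rewrite negb_and -eqn0Ngt negbK => /down_ratio_eq0 ->; rewrite mul0r.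
rewrite (big_pair_bij +%R (s := bead_level K n) (A := fun B => B : seq nat)
  (P := fun B b => b.+1 \notin B) (f := fun p => (bead_up p.1 p.2, p.2.+1))
  (g := fun p => (bead_down p.1 p.2, p.2.-1))) /=; first last.
- move=> B b Bl bB /andP[b0 b1B]; rewrite bead_downK // prednK // bead_down_level //.
  by rewrite fset1U1 /bead_down !inE gtn_eqF ?ltn_predL // eqxx.
- move=> B b Bl bB b1B; rewrite bead_upK // bead_up_level // fset1U1 /=.
  by rewrite /bead_up !inE ltn_eqF // eqxx.
- by move=> B; apply: fset_uniq.
- by move=> B; apply: fset_uniq.
- exact: bead_level_uniq.
- exact: bead_level_uniq.
rewrite big_seq [RHS]big_seq; apply: eq_bigr => B Bl; rewrite mulr_sumr.
rewrite big_seq_cond [RHS]big_seq_cond; apply: eq_bigr => b /andP[bB b1B].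
rewrite hook_inv_up //; set h := hook_inv F B; set r := up_ratio F B b.
transitivity (h ^+ 2 * r * (down_ratio F (bead_up B b) b.+1 * r) * g (bead_up B b)).
  by ring.
by rewrite down_up_ratio // mulr1 mulrA.
Qed.

(** The j-th power sum gets weight j + 1: then the combinations of [bead_psum_newton], which stop at
    j < i, have weight i, and the k-th moment has weight k. *)
Theorem charged_expoly d g : fil S bead_psum d g ->
  expoly 1 (fun K n => \sum_(B <- bead_level K n) hook_inv F B ^+ 2 * g B).
Proof.
apply: (@growth_expoly _ _ _ S bead_psum _ bead_level _ 1
  (fun B => [seq b <- B | b.+1 \notin B]) bead_up (up_ratio F)
  (fun B b => b.+1%:R - #|` B|%:R) vacuum (fun B => 0%N \in B)
  (* With v the new position of the bead, measured from K, its old position is v - 1. *)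
  (fun j => 'X^j - ('X - 1) ^+ j)).
- exact: oner_neq0.
- exact: bead_level0.
- by move=> K; rewrite hook_inv_vacuum expr1n.
- move=> K j; rewrite /bead_psum !card_vacuum big_ord0 subr0.
  have vE K' : \sum_(b <- vacuum K') (b%:R - K%:R : F) ^+ j =
     \sum_(b < K') (b%:R - K%:R) ^+ j.
    rewrite -(big_mkord xpredT (fun b => (b%:R - K%:R) ^+ j)); apply: perm_big.
    apply: uniq_perm; rewrite ?fset_uniq ?iota_uniq // => b.
    by rewrite in_vacuum mem_index_iota.
  rewrite vE subrr; symmetry.
  by rewrite big1_seq // => b /andP[_]; rewrite in_vacuum.
- move=> K n g' nK; rewrite mul1r bead_level_step; apply: eq_bigr => B _.
  by rewrite big_filter.
- by move=> K n nK B; apply: bead_level_0in.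
- move=> j; rewrite (leq_trans (size_polyD _ _)) // geq_max size_polyXn leqnn.
  by rewrite size_polyN -polyC1 size_exp_XsubC ltnSn.
- move=> j B b B0; rewrite mem_filter => /andP[b1B bB].
  have b1C : b.+1 \notin B `\ b by rewrite !inE negb_and b1B orbT.
  have cE : #|` bead_up B b| = #|` B|.
    by rewrite /bead_up cardfsU1 b1C add1n [RHS](cardfsD1 b) bB.
  rewrite /bead_psum cE /bead_up big_fsetU1 //= [\sum_(i <- B) _](big_fsetD1 b) //=.
  rewrite hornerD hornerN hornerXn horner_exp -polyC1 hornerXsubC -natr1.
  have -> : b%:R + 1 - #|` B|%:R - 1 = b%:R - #|` B|%:R :> F by ring.
  by ring.
- move=> B B0; have := sum_up_ratio 0 B0; rewrite hq0 => <-.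
  rewrite big_filter [RHS](bigID (fun b => b.+1 \notin B)) /=.
  rewrite [X in _ = _ + X]big1 ?addr0 => [|b]; last first.
    by rewrite negbK => /(up_ratio_eq0 F) ->; rewrite mul0r.
  by apply: eq_bigr => b _; rewrite expr0 mulr1.
- move=> k; exists (fun B => hq (fun i => \sum_(j < i) 'C(i, j)%:R * bead_psum j B) k).
    apply: fil_hq => i i0; apply: fil_sum => j _; apply: filZ.
    by apply: fil_le (fil_gen _ _ _).
  move=> B B0; rewrite -sum_up_ratio // big_filter.
  rewrite [RHS](bigID (fun b => b.+1 \notin B)) /=.
  rewrite [X in _ = _ + X]big1 ?addr0 // => b.
  by rewrite negbK => /(up_ratio_eq0 F) ->; rewrite mul0r.
Qed.

End ChargedGrowth.

(** * Plancherel weights of strict partitions *)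

Section StrictModel.
Local Open Scope fset_scope.
Local Open Scope ring_scope.
Variable F : numFieldType.
Implicit Types (T C : {fset nat}).

Definition strict_level n : seq {fset nat} :=
  [seq T : {fset nat} <- fpowerset (vacuum n.+1) | (0%N \notin T) && (\sum_(x <- T) x == n)%N].

Lemma mem_strict_level n T :
  (T \in strict_level n) = (0%N \notin T) && (\sum_(x <- T) x == n)%N.
Proof.
rewrite mem_filter; apply: andb_idr => /andP[_ /eqP sT].
by rewrite fpowersetE; apply/fsubsetP => b /fset_sum_ge; rewrite sT in_vacuum ltnS.
Qed.

Lemma strict_level_uniq n : uniq (strict_level n).
Proof. exact/filter_uniq/fset_uniq. Qed.

(** Schur's formula for the inverse of the product of the shifted hook lengths. *)
Definition shook_inv T : F := (\prod_(x <- T) x`!%:R)^-1 *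
  \prod_(x <- T) \prod_(y <- T | (y < x)%N) ((x - y)%:R / (x + y)%:R).

Definition strict_weight T : F := 2%:R ^- #|` T| * shook_inv T ^+ 2.

(* For x = 0 a new part 1 is created, since 0 is not in T. *)
Definition strict_up T x : {fset nat} := x.+1 |` (T `\ x).

Definition strict_down T x : {fset nat} := (x.-1 |` (T `\ x)) `\ 0%N.

Definition sup_ratio T x : F := x.+1%:R^-1 * \prod_(c <- T `\ x)
  ((x.+1%:R - c%:R) * (x%:R + c%:R) / ((x%:R - c%:R) * (x.+1%:R + c%:R))).

Definition sdown_ratio T x : F := x%:R * \prod_(c <- T `\ x)
  ((x%:R - 1 - c%:R) * (x%:R + c%:R) / ((x%:R - c%:R) * (x%:R - 1 + c%:R))).

(** Creating a part costs a factor 1/2 in 2^(-l). Once a common 1/2 is taken out of all moves, those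
    that keep the number of parts carry a 2. *)
Definition strict_theta T x : F := (if x == 0%N then 1 else 2%:R) * sup_ratio T x.

Lemma shook_inv_fsetU1 c C : c \notin C -> shook_inv (c |` C) =
  shook_inv C * (c`!%:R^-1 * \prod_(y <- C)
    ((if (y < c)%N then (c - y)%:R else (y - c)%:R) / (c + y)%:R)).
Proof.
move=> cC; rewrite /shook_inv big_pairs_fsetU1 // big_fsetU1 //= invfM.
rewrite [X in _ = _ * (_ * X)](eq_bigr (fun y =>
   if (y < c)%N then (c - y)%:R / (c + y)%:R else (y - c)%:R / (y + c)%:R)).
  by ring.
by move=> y _; case: ifP => // _; rewrite addnC.
Qed.

Section Moves.
Variables (T : {fset nat}) (x : nat).
Hypotheses (T0 : 0%N \notin T) (xT : x \in 0%N |` T) (x1T : x.+1 \notin T).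

Let x1C : x.+1 \notin T `\ x. Proof. by rewrite !inE negb_and x1T orbT. Qed.

Let neqC c : c \in T `\ x -> [/\ c != x, c != x.+1 & (0 < c)%N].
Proof.
rewrite !inE => /andP[cx cT]; split=> //; first by apply: contraTneq cT => ->.
by rewrite lt0n; apply: contraTneq cT => ->.
Qed.

Lemma shook_inv_up : shook_inv (strict_up T x) = shook_inv T * sup_ratio T x.
Proof.
have fC c : c \in T `\ x ->
  (if (c < x.+1)%N then (x.+1 - c)%:R else (c - x.+1)%:R) / (x.+1 + c)%:R =
  (if (c < x)%N then (x - c)%:R else (c - x)%:R) / (x + c)%:R *
  ((x.+1%:R - c%:R) * (x%:R + c%:R) / ((x%:R - c%:R) * (x.+1%:R + c%:R))) :> F.
  move=> /neqC[cx cx1 c0].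
  have xc0 : x%:R - c%:R != 0 :> F by rewrite natr_subr_neq0 // eq_sym.
  have [xc1 xc2] : (x%:R + c%:R != 0 :> F) /\ (x.+1%:R + c%:R != 0 :> F).
    by rewrite -!natrD !pnatr_eq0 !addn_eq0 [c == _]gtn_eqF // !andbF.
  rewrite !natrD; case: (ltngtP c x) => [cx'|xc|e]; last by rewrite e eqxx in cx.
    rewrite leqW // !natrB ?leqW 1?ltnW //.
    by field; rewrite ?nat1r xc0 xc1 xc2.
  have x1c : (x.+1 < c)%N by rewrite ltn_neqAle eq_sym cx1.
  rewrite ltnNge (ltnW x1c) /= !natrB 1?ltnW //.
  by field; rewrite ?nat1r xc0 xc1 xc2.
move: xT; rewrite !inE => /orP[/eqP x0|xT'].
  have TC : T `\ x = T.
    by apply/fsetP => c; rewrite !inE x0; case: eqP => // ->; rewrite (negPf T0).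
  (* A part 0 would contribute factors c / c = 1; inserting them lets the creation of a part use the
     same factorwise identity [fC]. *)
  have fT : \prod_(c <- T) ((if (c < x)%N then (x - c)%:R else (c - x)%:R) / (x + c)%:R) = 1 :> F.
    rewrite big1_seq // => c /andP[_ cT]; rewrite x0 ltn0 subn0 add0n divff //.
    by rewrite pnatr_eq0; apply: contraNneq T0 => <-.
  rewrite /strict_up /sup_ratio shook_inv_fsetU1 // TC; congr (_ * (_ * _)).
    by rewrite x0.
  rewrite -[RHS]mul1r -[X in _ = X * _]fT -big_split big_seq [RHS]big_seq.
  by apply: eq_bigr => c; rewrite -{1}TC => /fC.
have xC : x \notin T `\ x by rewrite !inE eqxx.
rewrite /strict_up -{2}(fsetD1K xT') /sup_ratio !shook_inv_fsetU1 //.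
set p1 := \prod_(y <- _) _; set p2 := \prod_(y <- _) _; set p3 := \prod_(y <- _) _.
suff -> : p1 = p2 * p3 by rewrite factS natrM invfM; ring.
by rewrite -big_split /p1 big_seq [RHS]big_seq; apply: eq_bigr => c /fC.
Qed.

Lemma sdown_up_ratio : sdown_ratio (strict_up T x) x.+1 * sup_ratio T x = 1.
Proof.
rewrite /sdown_ratio /sup_ratio /strict_up fsetU1K // mulrACA divff ?mul1r.
  rewrite -big_split big1_seq // => c /= /neqC[cx cx1 c0].
  have -> : x.+1%:R - 1 = x%:R :> F by rewrite -natr1 addrK.
  have xc0 : x%:R - c%:R != 0 :> F by rewrite natr_subr_neq0 // eq_sym.
  have xc3 : x.+1%:R - c%:R != 0 :> F by rewrite natr_subr_neq0 // eq_sym.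
  have [xc1 xc2] : (x%:R + c%:R != 0 :> F) /\ (x.+1%:R + c%:R != 0 :> F).
    by rewrite -!natrD !pnatr_eq0 !addn_eq0 [c == _]gtn_eqF // !andbF.
  by field; rewrite ?nat1r xc0 xc1 xc2 xc3.
by rewrite pnatr_eq0.
Qed.

Lemma card_strict_up : #|` strict_up T x| = (#|` T| + (x == 0%N))%N.
Proof.
rewrite /strict_up cardfsU1 x1C add1n [#|` T|](cardfsD1 x).
move: xT; rewrite !inE; case: eqP => [-> _|_ /= ->]; last by rewrite addn0.
by rewrite (negPf T0) addn1.
Qed.

Lemma strict_weight_up : strict_weight (strict_up T x) *
  sdown_ratio (strict_up T x) x.+1 = 2%:R^-1 * (strict_weight T * strict_theta T x).
Proof.
rewrite /strict_weight shook_inv_up card_strict_up exprD invfM /strict_theta.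
have n2 : 2%:R != 0 :> F by rewrite pnatr_eq0.
have -> : (2%:R ^+ (x == 0%N))^-1 = 2%:R^-1 * (if x == 0%N then 1 else 2%:R) :> F.
  by case: eqP => _; rewrite ?expr1 ?expr0 ?mulr1 // invr1 mulVf.
set m := if _ then _ else _; set s := sup_ratio T x.
transitivity (2%:R ^- #|` T| * (2%:R^-1 * m) * shook_inv T ^+ 2 * s *
   (sdown_ratio (strict_up T x) x.+1 * s)); first by ring.
by rewrite sdown_up_ratio; ring.
Qed.

Lemma sum_strict_up (g : nat -> F) : g 0%N = 0 ->
  \sum_(c <- strict_up T x) g c = \sum_(c <- T) g c + (g x.+1 - g x).
Proof.
move=> g0; rewrite /strict_up big_fsetU1 //=.
move: xT; rewrite !inE => /orP[/eqP x0|xT']; last first.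
  by rewrite [\sum_(c <- T) _](big_fsetD1 x) //=; ring.
have -> : T `\ x = T.
  by apply/fsetP => c; rewrite !inE x0; case: eqP => // ->; rewrite (negPf T0).
by rewrite x0 g0; ring.
Qed.

End Moves.

Lemma sup_ratio_eq0 T x : x.+1 \in T -> sup_ratio T x = 0.
Proof.
move=> b1B; rewrite /sup_ratio (big_fsetD1 x.+1) /=.
  by rewrite subrr !(mul0r, mulr0).
by rewrite !inE b1B andbT -[x.+1]addn1 -[X in _ != X]addn0 eqn_add2l.
Qed.

Lemma sdown_ratio_eq0 T x : (x == 0%N) || (x.-1 \in T) -> sdown_ratio T x = 0.
Proof.
rewrite /sdown_ratio; case: x => [|x] /=; first by rewrite mul0r.
move=> bB; rewrite (big_fsetD1 x) /=.
  by rewrite -natr1 addrK subrr !(mul0r, mulr0).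
by rewrite !inE bB andbT -[x.+1]addn1 -[X in X != _]addn0 eqn_add2l.
Qed.

Lemma natr_mulS (x : nat) : x%:R * x.+1%:R = x%:R * (x%:R + 1) :> F.
Proof. by rewrite natr1. Qed.

Lemma natr_mul_pred (x : nat) : (x * x.-1)%:R = x%:R * (x%:R - 1) :> F.
Proof. by case: x => [|x]; rewrite ?mul0n ?mul0r // natrM -[x.+1%:R]natr1 addrK. Qed.

(** The ratios are rational in x(x - 1), as (x - c)(x - 1 + c) = x(x - 1) - c(c - 1) and (x - 1 -
    c)(x + c) = x(x - 1) - c(c + 1). The divided difference is h_1, and the own factor x(x - 1) -
    x(x + 1) = - 2x supplies the constant - 2. *)
Lemma sum_sdown_ratio T : 0%N \notin T ->
  \sum_(x <- T) sdown_ratio T x = (\sum_(x <- T) x)%:R.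
Proof.
move=> T0; have [->|nT0] := eqVneq T fset0; first by rewrite !big_seq_fset0.
pose a := [seq (x * x.-1)%:R : F | x <- T].
pose z := [seq (x * x.+1)%:R : F | x <- T].
have T_gt0 c : c \in T -> (0 < c)%N by move=> cT; rewrite lt0n; apply: contraNneq T0 => <-.
have mono : {in T &, forall x y, (x < y)%N -> (x * x.-1 < y * y.-1)%N}.
  by move=> x y /T_gt0 x0 /T_gt0 y0 xy; nia.
have ainj : {in T &, injective (fun x => (x * x.-1)%:R : F)}.
  move=> x y xT yT /eqP; rewrite eqr_nat => /eqP e.
  by case: (ltngtP x y) => // [/(mono _ _ xT yT)|/(mono _ _ yT xT)]; rewrite e ltnn.
have ua : uniq a by rewrite map_inj_in_uniq ?fset_uniq.
have a0 : a != [::] by rewrite -size_eq0 size_map -lt0n cardfs_gt0.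
have := divdiff_rational z 0 ua a0.
have [sa sz] : size a = #|` T| /\ size z = #|` T| by rewrite !size_map.
rewrite /hq_shift sa sz add0n leqW // subSnn.
set q := (fun i => psum a i - psum z i).
have := hqE q 0; rewrite big_ord1 hq0 mul1r mulr1 => ->.
have -> : q 1%N = - (2%:R * (\sum_(x <- T) x)%:R).
  rewrite /q /psum !big_map -sumrB natr_sum mulr_sumr -sumrN.
  by apply: eq_bigr => i _; rewrite !expr1 natr_mul_pred natrM -natr1; ring.
have n2 : - 2%:R != 0 :> F by rewrite oppr_eq0 pnatr_eq0.
rewrite -mulNr => e; apply: (mulfI n2); rewrite -e.
rewrite /divdiff big_map mulr_sumr big_seq [RHS]big_seq; apply: eq_bigr => x xT.
rewrite expr0 mul1r !big_map (big_fsetD1 x) //=.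
have -> : \prod_(c <- T | (c * c.-1)%:R != (x * x.-1)%:R :> F)
    ((x * x.-1)%:R - (c * c.-1)%:R) =
    \prod_(c <- T `\ x) ((x%:R - c%:R) * (x%:R - 1 + c%:R)) :> F.
  rewrite -big_fset_neq big_seq_cond [RHS]big_seq_cond; apply: eq_big => [c|c _].
    by apply: andb_id2l => cT; rewrite (inj_in_eq ainj).
  by rewrite !natr_mul_pred; ring.
have -> : \prod_(c <- T `\ x) ((x * x.-1)%:R - (c * c.+1)%:R) =
    \prod_(c <- T `\ x) ((x%:R - 1 - c%:R) * (x%:R + c%:R)) :> F.
  by apply: eq_bigr => c _; rewrite natr_mul_pred natrM -natr1; ring.
rewrite /sdown_ratio prodf_div natr_mul_pred natrM -natr1; ring.
Qed.

(** Odd exponents only: (x + 1)^n - x^n is invariant under x |-> - 1 - x, hence a polynomial in x(x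
    + 1), exactly for odd n > 0. *)
Definition strict_psum j T : F := \sum_(x <- T) x%:R ^+ j.*2.+1.

(** x^i ((x + 1)^i - (x - 1)^i) keeps the terms x^(i + l) with i - l odd, so i + l is odd; and (i +
    l)./2 < i bounds the weight by i. *)
Lemma strict_psum_newton i T : (0 < i)%N ->
  \sum_(x <- T) ((x * x.+1)%:R ^+ i - (x * x.-1)%:R ^+ i) =
  \sum_(l < i) (if odd (i - l) then 'C(i, l)%:R * 2%:R * strict_psum (i + l)./2 T
               else 0).
Proof.
move=> i0; have E (x : nat) : (x * x.+1)%:R ^+ i - (x * x.-1)%:R ^+ i =
    \sum_(l < i) (if odd (i - l) then 'C(i, l)%:R * 2%:R * x%:R ^+ (i + l)./2.*2.+1
                  else 0) :> F.
  rewrite natr_mul_pred natrM -[x.+1%:R]natr1 !exprMn -mulrBr.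
  rewrite [x%:R + 1]addrC [x%:R - 1]addrC !exprDn !big_ord_recr /= subnn !expr0.
  rewrite opprD addrACA subrr addr0 -sumrB mulr_sumr; apply: eq_bigr => l _.
  have li : (l <= i)%N by rewrite ltnW.
  rewrite expr1n -signr_odd; case: ifP => oil; last by rewrite expr0 subrr mulr0.
  have -> : (i + l)./2.*2.+1 = (i + l)%N.
    rewrite -[RHS]odd_double_half oddD addbC; move: oil.
    by rewrite oddB // addbC => ->.
  rewrite exprD expr1 mul1r mulN1r mulNrn opprK -[_ *+ _]mulr_natl.
  by ring.
under eq_bigr do rewrite E.
rewrite exchange_big; apply: eq_bigr => l _ /=; case: ifP => _.
  by rewrite -mulr_sumr.
by rewrite big1.
Qed.

(** Nodes x(x + 1) for x = 0 and x in T, zeros x(x - 1) for x in T. At x in T the own zero gives 2x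
    and the node 0 gives x(x + 1); their quotient 2 / (x + 1) is the origin of the 2 in
    [strict_theta]. *)
Lemma sum_strict_theta T k : 0%N \notin T ->
  \sum_(x <- 0%N |` T) strict_theta T x * (x * x.+1)%:R ^+ k =
  hq (fun i => \sum_(l < i) (if odd (i - l)
       then 'C(i, l)%:R * 2%:R * strict_psum (i + l)./2 T else 0)) k.
Proof.
move=> T0.
pose a := [seq (x * x.+1)%:R : F | x <- 0%N |` T].
pose z := [seq (x * x.-1)%:R : F | x <- T].
have ainj : injective (fun x => (x * x.+1)%:R : F).
  move=> x y /eqP; rewrite eqr_nat => /eqP e; nia.
have ua : uniq a by rewrite map_inj_uniq ?fset_uniq.
have a0 : a != [::] by rewrite -size_eq0 size_map -lt0n cardfs_gt0; apply/fset0Pn; exists 0%N; rewrite fset1U1.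
have := divdiff_rational z k ua a0.
have [sa sz] : size a = #|` T|.+1 /\ size z = #|` T|.
  by rewrite !size_map; split=> //; rewrite -[size _]/(#|` 0%N |` T|) cardfsU1 T0.
rewrite /hq_shift sa sz subSS addnK ltnS leq_addl.
rewrite -(@eq_hq _ (fun i => psum a i - psum z i)) => [<-|i i0]; last first.
  rewrite /psum !big_map big_fsetU1 //= mul0n expr0n eqn0Ngt i0 add0r -sumrB.
  exact: strict_psum_newton.
rewrite /divdiff big_map big_seq [RHS]big_seq; apply: eq_bigr => x xT.
rewrite mulrC -mulrA; congr (_ * _).
have -> : \prod_(y <- a | y != (x * x.+1)%:R) ((x * x.+1)%:R - y) =
   \prod_(c <- (0%N |` T) `\ x) ((x%:R - c%:R) * (x.+1%:R + c%:R)) :> F.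
  rewrite -big_fset_neq big_map; apply: eq_big => [c|c _].
    by rewrite (inj_eq ainj).
  by rewrite !natrM -!natr1; ring.
rewrite /z big_map /strict_theta /sup_ratio prodf_div.
move: xT; rewrite !inE => /orP[/eqP x0|xT].
  rewrite x0 eqxx fsetU1K // mul1r invr1 mul1r.
  have -> : T `\ 0%N = T.
    by apply/fsetP => c; rewrite !inE; case: eqP => // ->; rewrite (negPf T0).
  congr (_ / _); apply: eq_bigr => c _; rewrite natr_mul_pred; ring.
have x_gt0 : (0 < x)%N by rewrite lt0n; apply: contraNneq T0 => <-.
have -> : (0%N |` T) `\ x = 0%N |` (T `\ x).
  by apply/fsetP => c; rewrite !inE; case: (eqVneq c 0%N) => // ->; rewrite ltn_eqF.
have x0C : 0%N \notin T `\ x by rewrite !inE negb_and T0 orbT.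
rewrite [\prod_(c <- T) _](big_fsetD1 x xT) big_fsetU1 //= gtn_eqF // subr0 addr0.
have -> : \prod_(c <- T `\ x) ((x * x.+1)%:R - (c * c.-1)%:R) =
    \prod_(c <- T `\ x) ((x.+1%:R - c%:R) * (x%:R + c%:R)) :> F.
  by apply: eq_bigr => c _; rewrite natr_mul_pred natrM -natr1; ring.
have -> : (x * x.+1)%:R - (x * x.-1)%:R = 2%:R * x%:R :> F.
  by rewrite natr_mul_pred natrM -natr1; ring.
have xn0 : x%:R != 0 :> F by rewrite pnatr_eq0 -lt0n.
have x1n0 : x.+1%:R != 0 :> F by rewrite pnatr_eq0.
rewrite !invfM; set p := \prod_(c <- _) _; set p' := (\prod_(c <- _) _)^-1.
transitivity (2%:R * (x%:R / x%:R) * (x.+1%:R^-1 * (p * p'))); last by ring.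
by rewrite divff // mulr1; ring.
Qed.

(* The polynomials (x + 1)^n + (- x)^n in x (x + 1), for n = 2 j and 2 j + 1. *)
Fixpoint pow_sum_poly j : {poly F} * {poly F} :=
  if j is j'.+1 then
    let: (q, p) := pow_sum_poly j' in
    (p + 'X * q, p + 'X * q + 'X * p)
  else (2%:R%:P, 1).

(** x + 1 and - x are the roots of z^2 = z + x(x + 1), whence the recurrence in [pow_sum_poly]. *)
Lemma horner_pow_sum j (x : F) :
  (pow_sum_poly j).1.[x * (x + 1)] = (x + 1) ^+ j.*2 + x ^+ j.*2 /\
  (pow_sum_poly j).2.[x * (x + 1)] = (x + 1) ^+ j.*2.+1 - x ^+ j.*2.+1.
Proof.
elim: j => [|j]; first by rewrite /= !hornerC !expr0 !expr1; split; ring.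
rewrite /=; case: (pow_sum_poly j) => q p /= [qE pE].
by rewrite !(hornerD, hornerM, hornerX) qE pE doubleS !exprS; split; ring.
Qed.

Lemma size_pow_sum j :
  (size (pow_sum_poly j).1 <= j.+1)%N /\ (size (pow_sum_poly j).2 <= j.+1)%N.
Proof.
elim: j => [|j]; first by rewrite /= size_poly1 size_polyC leq_b1.
rewrite /=; case: (pow_sum_poly j) => q p /= [sq sp].
have sX (r : {poly F}) : (size r <= j.+1)%N -> (size ('X * r)%R <= j.+2)%N.
  by move=> sr; rewrite mulrC; apply: leq_trans (size_polyMleq _ _) _; rewrite size_polyX addn2.
have sQ : (size (p + 'X * q)%R <= j.+2)%N.
  by rewrite (leq_trans (size_polyD _ _)) // geq_max sX // leqW.
by split=> //; rewrite (leq_trans (size_polyD _ _)) // geq_max sQ sX.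
Qed.

(** Edges are counted twice as in [bead_level_step]; the state 0 added to T stands for the creation
    of a part, and the constant 1/2 comes from [strict_weight_up]. *)
Lemma strict_level_step n (g : {fset nat} -> F) :
  n.+1%:R * \sum_(T <- strict_level n.+1) strict_weight T * g T =
  2%:R^-1 * \sum_(T <- strict_level n) strict_weight T *
    \sum_(x <- 0%N |` T | x.+1 \notin T) strict_theta T x * g (strict_up T x).
Proof.
transitivity (\sum_(T <- strict_level n.+1) \sum_(x <- T | (0 < x)%N && (x.-1 \notin T))
   strict_weight T * sdown_ratio T x * g T).
  rewrite mulr_sumr big_seq [RHS]big_seq; apply: eq_bigr => T.
  rewrite mem_strict_level => /andP[T0 /eqP sT].
  have := sum_sdown_ratio T0; rewrite sT => <-.
  rewrite mulr_suml [LHS](bigID (fun b => (0 < b)%N && (b.-1 \notin T))) /=.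
  rewrite [X in _ + X]big1 ?addr0; first by apply: eq_bigr => b _; ring.
  by move=> b; rewrite negb_and -eqn0Ngt negbK => /sdown_ratio_eq0 ->; rewrite mul0r.
rewrite (big_pair_bij +%R (s := strict_level n) (A := fun T => (0%N |` T) : seq nat)
  (P := fun T x => x.+1 \notin T) (f := fun p => (strict_up p.1 p.2, p.2.+1))
  (g := fun p => (strict_down p.1 p.2, p.2.-1))) /=; first last.
- move=> T x; rewrite mem_strict_level => /andP[T0 /eqP sT] xT /andP[x0 x1T].
  have x1C : x.-1 \notin T `\ x by rewrite !inE negb_and x1T orbT.
  have xD : x \notin strict_down T x.
    by rewrite /strict_down !inE eqxx /= orbF [x == x.-1]gtn_eqF ?ltn_predL // andbF.
  have x1D : x.-1 \in 0%N |` strict_down T x.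
    by rewrite /strict_down !inE eqxx andbT; case: (x.-1 == 0%N).
  have upD : strict_up (strict_down T x) x.-1 = T.
    rewrite /strict_up prednK //; apply/fsetP => c; rewrite /strict_down !inE.
    have [->|cx] := eqVneq c x; first by rewrite xT.
    have [->|cx1] := eqVneq c x.-1; first by rewrite (negPf x1T).
    by have [->|c0] := eqVneq c 0%N; rewrite //= (negPf T0).
  have D0 : 0%N \notin strict_down T x by rewrite /strict_down !inE eqxx.
  rewrite upD prednK // x1D xD; split=> //.
  rewrite mem_strict_level D0 /=.
  have := @sum_strict_up _ x.-1 D0 x1D; rewrite prednK // => /(_ xD).
  move=> /(_ (fun c => c%:R) erefl); rewrite upD -natrB ?leq_pred //.
  rewrite -[x in (x - _)%N](prednK x0) subSnn -!natr_sum -natrD sT => /eqP.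
  by rewrite eqr_nat addn1 eqSS eq_sym.
- move=> T x; rewrite mem_strict_level => /andP[T0 /eqP sT] xT x1T.
  have x1C : x.+1 \notin T `\ x by rewrite !inE negb_and x1T orbT.
  split.
  + rewrite mem_strict_level; apply/andP; split.
      by rewrite /strict_up !inE negb_or /= negb_and T0 orbT.
    have := @sum_strict_up _ x T0 xT x1T (fun c => c%:R) erefl.
    rewrite -natrB // subSnn -!natr_sum -natrD sT => /eqP.
    by rewrite eqr_nat addn1.
  + by rewrite fset1U1.
  + by rewrite /strict_up !inE negb_or [x == x.+1]ltn_eqF //= eqxx.
  + congr pair; rewrite /strict_down /strict_up fsetU1K //; apply/fsetP => c.
    rewrite !inE; have [->|c0] := eqVneq c 0%N; first by rewrite (negPf T0).
    move: xT; rewrite !inE /=; have [e|cx] //= := eqVneq c x.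
    by rewrite -e (negPf c0) /= => ->.
- by move=> T; apply: fset_uniq.
- by move=> T; apply: fset_uniq.
- exact: strict_level_uniq.
- exact: strict_level_uniq.
rewrite mulr_sumr big_seq [RHS]big_seq; apply: eq_bigr => T.
rewrite mem_strict_level => /andP[T0 _]; rewrite !mulr_sumr.
rewrite big_seq_cond [RHS]big_seq_cond; apply: eq_bigr => x /andP[xT x1T].
by rewrite strict_weight_up // -!mulrA.
Qed.

Theorem strict_expoly d g : fil S strict_psum d g ->
  expoly 2%:R^-1 (fun _ n => \sum_(T <- strict_level n) strict_weight T * g T).
Proof.
have sl0 : strict_level 0 = [:: fset0].
  apply: perm_small_eq => //; apply: uniq_perm => //; first exact: strict_level_uniq.
  move=> T; rewrite inE mem_strict_level; apply/andP/eqP => [[T0 /eqP sT]|->].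
    apply/fsetP => c; rewrite !inE; apply/negP => cT; have := fset_sum_ge cT.
    by rewrite sT leqn0 => /eqP c0; rewrite -c0 cT in T0.
  by rewrite inE big_seq_fset0.
apply: (@growth_expoly _ _ _ S strict_psum _ (fun _ => strict_level) _ 2%:R^-1
  (fun T => [seq x <- 0%N |` T | x.+1 \notin T]) strict_up strict_theta
  (fun T x => (x * x.+1)%:R) (fun=> fset0) (fun T => 0%N \notin T)
  (fun j => (pow_sum_poly j).2)) => //.
- by rewrite invr_eq0 pnatr_eq0.
- by move=> _; rewrite /strict_weight /shook_inv cardfs0 !big_seq_fset0 !(invr1, mulr1, expr1n).
- move=> K n g' nK; rewrite strict_level_step; congr (_ * _); apply: eq_bigr => T _.
  by rewrite big_filter.
- by move=> K n nK T; rewrite mem_strict_level => /andP[].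
- by move=> j; have [] := size_pow_sum j.
- move=> j T x T0; rewrite mem_filter => /andP[x1T xT].
  have [_ e] := horner_pow_sum j x%:R.
  rewrite natrM natr_mulS e natr1.
  have g0 : 0%:R ^+ j.*2.+1 = 0 :> F by rewrite expr0n.
  by rewrite /strict_psum (@sum_strict_up _ _ T0 xT x1T (fun c => c%:R ^+ j.*2.+1) g0).
- move=> T T0; have := sum_strict_theta 0 T0; rewrite hq0 => <-.
  rewrite big_filter [RHS](bigID (fun b => b.+1 \notin T)) /=.
  rewrite [X in _ = _ + X]big1 ?addr0 => [|b]; last first.
    by rewrite negbK /strict_theta => /sup_ratio_eq0 ->; rewrite mulr0 mul0r.
  by apply: eq_bigr => b _; rewrite expr0 mulr1.
- move=> k; exists (fun T => hq (fun i => \sum_(l < i) (if odd (i - l)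
       then 'C(i, l)%:R * 2%:R * strict_psum (i + l)./2 T else 0)) k).
    apply: fil_hq => i i0; apply: fil_sum => l _; case: (odd (i - l)); last exact: fil0.
    apply: filZ; apply: fil_le (fil_gen _ _ _).
    rewrite ltn_half_double -addnn ltn_add2l //.
  move=> T T0; rewrite -sum_strict_theta // big_filter.
  rewrite [RHS](bigID (fun b => b.+1 \notin T)) /=.
  rewrite [X in _ = _ + X]big1 ?addr0 // => b.
  by rewrite negbK /strict_theta => /sup_ratio_eq0 ->; rewrite mulr0 mul0r.
Qed.

End StrictModel.

(** * Beads, hooks and contents of a partition *)

Section Beads.
Local Open Scope fset_scope.
Implicit Types (la : seq nat) (B : {fset nat}).

Definition bead la m i := (nth 0 la i + (m - i.+1))%N.
Definition beads la m : {fset nat} := [fset bead la m i | i in iota 0 m].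
Definition col_len la j := count (fun k => j < k)%N la.
(** Along the border path of the diagram each row gives a bead and each column a hole; this is the
    hole of column j. *)
Definition hole la m j := (j + m - col_len la j)%N.

Lemma ltn_col_len la j k : is_partition la ->
  (k < col_len la j)%N = (j < nth 0 la k)%N.
Proof.
rewrite /col_len => /andP[+ _]; elim: la k => [|x la IHla] k sla.
  by rewrite nth_nil.
have [jx|xj] := ltnP j x.
  by rewrite /= jx add1n; case: k => [|k] //=; rewrite ltnS IHla ?(path_sorted sla).
have xl : all (fun y => y <= j)%N (x :: la).
  rewrite /= xj; apply: sub_all (order_path_min _ sla) => [y yx|].
    exact: leq_trans yx xj.
  by move=> a b c ab bc; apply: leq_trans bc ab.
have -> : count (fun k => j < k)%N (x :: la) = 0%N.
  apply/eqP; rewrite eqn0Ngt -has_count -all_predC; apply: sub_all xl => y yj /=.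
  by rewrite -leqNgt.
apply/esym/negbTE; rewrite -leqNgt; have [kl|lk] := ltnP k (size (x :: la)).
  by apply: (allP xl); apply: mem_nth.
by rewrite nth_default.
Qed.

Lemma part_nth_le la i k : is_partition la -> (i <= k)%N ->
  (nth 0 la k <= nth 0 la i)%N.
Proof.
move=> lap ik; rewrite leqNgt; apply/negP; rewrite -ltn_col_len // => kc.
by have := leq_ltn_trans ik kc; rewrite ltn_col_len // ltnn.
Qed.

Lemma part_nth_gt0 la i : is_partition la -> (0 < nth 0 la i)%N = (i < size la)%N.
Proof.
move=> /andP[_ la0]; case: (ltnP i (size la)) => [il|li]; last by rewrite nth_default.
by rewrite lt0n; apply: contraNneq la0 => <-; apply: mem_nth.
Qed.

Lemma col_len_size la j : (col_len la j <= size la)%N.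
Proof. exact: count_size. Qed.

Lemma beads_partP la m p : reflect (exists2 i, (i < m)%N & p = bead la m i) (p \in beads la m).
Proof.
apply: (iffP (imfsetP _ _ _ _)) => -[k].
  by rewrite /= mem_iota => km ->; exists k.
by move=> km ->; exists k; rewrite //= mem_iota.
Qed.

Lemma iota_index n : iota 0 n = index_iota 0 n.
Proof. by rewrite /index_iota subn0. Qed.

Section Partition.
Variables (la : seq nat) (m : nat).
Hypotheses (lap : is_partition la) (lam : (size la <= m)%N).

Lemma bead_decr i k : (i < k)%N -> (k < m)%N -> (bead la m k < bead la m i)%N.
Proof.
by move=> ik km; have := part_nth_le lap (ltnW ik); clear lam; rewrite /bead; lia.
Qed.

Lemma bead_inj : {in iota 0 m &, injective (bead la m)}.
Proof.
move=> i k; rewrite !mem_iota /= => im km e.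
by case: (ltngtP i k) => // [/bead_decr/(_ km)|/bead_decr/(_ im)]; rewrite e ltnn.
Qed.

Lemma big_beads (R : Type) (idx : R) (op : Monoid.com_law idx) (f : nat -> R) :
  \big[op/idx]_(x <- beads la m) f x = \big[op/idx]_(i < m) f (bead la m i).
Proof.
rewrite -(big_mkord xpredT (fun i => f (bead la m i))).
rewrite -[RHS](big_map (bead la m) xpredT f); apply: perm_big; apply: uniq_perm.
- exact: fset_uniq.
- by rewrite map_inj_in_uniq ?iota_uniq // /index_iota subn0; apply: bead_inj.
- move=> p; apply/beads_partP/mapP => -[i im ->]; exists i => //.
    by rewrite mem_index_iota.
  by move: im; rewrite mem_index_iota.
Qed.

Lemma card_beads : #|` beads la m| = m.
Proof. by rewrite -[LHS]sum1_size big_beads sum1_card card_ord. Qed.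

Lemma sum_beads : (\sum_(x <- beads la m) x = sumn la + 'C(m, 2))%N.
Proof.
rewrite big_beads big_split /=; congr (_ + _)%N.
  rewrite sumnE [RHS](big_nth 0) big_mkord [RHS](big_ord_widen m (fun i => nth 0 la i)) //.
  rewrite [RHS]big_mkcond; apply: eq_bigr => i _; case: ltnP => // il.
  by rewrite nth_default.
rewrite -bin2_sum [RHS]big_mkord [RHS](reindex_inj rev_ord_inj).
exact: eq_bigr.
Qed.

Lemma ltn_hole_bead i j : (i < m)%N ->
  (j < nth 0 la i)%N = (hole la m j < bead la m i)%N.
Proof.
move=> im; have := leq_trans (col_len_size la j) lam.
rewrite -ltn_col_len // /hole /bead => cm.
have [ic|ci] := ltnP i (col_len la j).
  by have := ic; rewrite ltn_col_len //; move: ic im cm; lia.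
by have := ci; rewrite leqNgt ltn_col_len // -leqNgt; move: im cm ci; lia.
Qed.

Lemma hole_notin j : hole la m j \notin beads la m.
Proof.
apply/negP => /beads_partP[i im e].
have := ltn_hole_bead j im; rewrite -e ltnn => /negbT; rewrite -leqNgt => laj.
have := leq_trans (col_len_size la j) lam.
have : (col_len la j <= i)%N by rewrite leqNgt ltn_col_len // -leqNgt.
by move: e; rewrite /hole /bead; move: laj im; lia.
Qed.

Lemma hole_incr j k : (j < k)%N -> (hole la m j < hole la m k)%N.
Proof.
move=> jk; have := leq_trans (col_len_size la j) lam.
have : (col_len la k <= col_len la j)%N.
  by apply: sub_count => x /=; apply: ltn_trans.
by rewrite /hole; move: jk; lia.
Qed.

Lemma hole_inj : injective (hole la m).
Proof.
move=> i k e.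
by case: (ltngtP i k) => // [/hole_incr|/hole_incr]; rewrite e ltnn.
Qed.

Lemma holesP p : p \notin beads la m -> exists j, p = hole la m j.
Proof.
(* k is the number of beads above p, so p must be the hole of column p + k - m. *)
move=> pB; pose k := find (fun i => bead la m i < p)%N (iota 0 m).
have km : (k <= m)%N by rewrite -[leqRHS](size_iota 0 m) find_size.
have kE : (k < m)%N -> (bead la m k < p)%N.
  move=> km'; have := @nth_find nat 0 (fun i => bead la m i < p)%N (iota 0 m).
  by rewrite has_find size_iota nth_iota // => /(_ km').
have ltk i : (i < k)%N -> (p < bead la m i)%N.
  move=> ik; have im := leq_trans ik km; have := before_find 0 ik.
  rewrite nth_iota // add0n => /negbT; rewrite -leqNgt leq_eqVlt => /orP[/eqP e|//].
  by case/negP: pB; apply/beads_partP; exists i.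
have mpk : (m <= p + k)%N.
  move: km; rewrite leq_eqVlt => /orP[/eqP -> |km']; first exact: leq_addl.
  by have := kE km'; rewrite /bead; lia.
exists (p + k - m)%N; have -> : hole la m (p + k - m) = (p + k - m + m - k)%N.
  rewrite /hole; congr (_ - _)%N; apply/eqP; rewrite eqn_leq; apply/andP; split.
    rewrite leqNgt ltn_col_len // -leqNgt.
    move: (km); rewrite leq_eqVlt => /orP[/eqP e |km'].
      by rewrite e nth_default //; lia.
    by have := kE km'; rewrite /bead; lia.
  case: k ltk km mpk {kE} => // k ltk km mpk.
  by rewrite ltn_col_len //; have := ltk k (ltnSn k); rewrite /bead; lia.
by rewrite subnK // addnK.
Qed.

Lemma hook_length_hole i j : (j < nth 0 la i)%N -> (i < m)%N ->
  hook_length la (i, j) = (bead la m i - hole la m j)%N.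
Proof.
move=> jla im; have il : (i < size la)%N.
  by rewrite -part_nth_gt0 // (leq_ltn_trans _ jla).
have count_boxes (P : nat -> nat -> bool) :
    count (fun c => P c.1 c.2) (boxes la) =
    (\sum_(i' < size la) \sum_(j' < nth 0 la i') P i' j')%N.
  rewrite -sum1_count /boxes big_mkcond big_allpairs_dep /=.
  rewrite -(big_mkord xpredT (fun i' => \sum_(j' < nth 0 la i') P i' j')%N).
  rewrite /index_iota subn0; apply: eq_bigr => i' _.
  rewrite -(big_mkord xpredT (fun j' => P i' j' : nat)) /index_iota subn0.
  by apply: eq_bigr => j' _; case: (P i' j').
rewrite /hook_length (count_boxes (fun a b => (a == i) && (j < b)%N)).
rewrite (count_boxes (fun a b => (b == j) && (i < a)%N)).
have -> : (\sum_(i' < size la) \sum_(j' < nth 0 la i') ((i' == i :> nat) && (j < j'))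
    = nth 0 la i - j.+1)%N.
  rewrite (bigD1 (Ordinal il)) //= [X in (_ + X)%N]big1 => [|i' /negPf ii'].
    rewrite addn0; under eq_bigr do rewrite eqxx /=.
    rewrite -(big_mkord xpredT (fun j' => (j < j')%N : nat)).
    rewrite (@big_cat_nat _ _ _ j.+1) //= big_nat_cond big1 => [|k]; last first.
      by rewrite andbT ltnS => /= kj; rewrite ltnNge kj.
    rewrite add0n big_nat_cond (eq_bigr (fun=> 1%N)) => [|k]; last first.
      by rewrite andbT => /andP[-> _].
    by rewrite -big_nat_cond sum_nat_const_nat muln1.
  by rewrite big1 // => j' _; move: ii'; rewrite -val_eqE /= => ->.
have -> : (\sum_(i' < size la) \sum_(j' < nth 0 la i') ((j' == j :> nat) && (i < i'))
    = col_len la j - i.+1)%N.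
  transitivity (\sum_(i' < size la) ((i < i') && (i' < col_len la j)))%N.
    apply: eq_bigr => i' _; have [ii'|] := ltnP i i'; last first.
      by move=> _; rewrite big1 // => j' _; rewrite andbF.
    rewrite ltn_col_len //=; have [jla'|laj'] := ltnP j (nth 0 la i').
      rewrite (bigD1 (Ordinal jla')) //= eqxx big1 // => j' /negPf.
      by rewrite -val_eqE /= => ->.
    rewrite big1 // => j' _; rewrite ltn_eqF //.
    by rewrite (leq_trans (ltn_ord j')).
  have cs := col_len_size la j.
  rewrite -(big_mkord xpredT (fun i' => ((i < i') && (i' < col_len la j))%N : nat)).
  have ic : (i < col_len la j)%N by rewrite ltn_col_len.
  rewrite (@big_cat_nat _ _ _ i.+1) //= big_nat_cond big1 => [|k]; last first.
    by rewrite andbT ltnS => /= kj; rewrite ltnNge kj.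
  rewrite add0n (@big_cat_nat _ _ _ (col_len la j)) //=.
  rewrite [X in (_ + X)%N]big_nat_cond [X in (_ + X)%N]big1 ?addn0 => [|k]; last first.
    by rewrite andbT => /andP[ck _]; rewrite [(k < _)%N]ltnNge ck andbF.
  rewrite big_nat_cond (eq_bigr (fun=> 1%N)) => [|k]; last first.
    by rewrite andbT => /andP[-> ->].
  by rewrite -big_nat_cond sum_nat_const_nat muln1.
have ic : (i < col_len la j)%N by rewrite ltn_col_len.
have := leq_trans (col_len_size la j) lam.
by rewrite /bead /hole; move: jla ic im; lia.
Qed.

Lemma big_hooks (R : Type) (idx : R) (op : Monoid.com_law idx) (f : nat -> R) :
  \big[op/idx]_(h <- hooks la) f h = \big[op/idx]_(x <- beads la m)
    \big[op/idx]_(y < x | (y : nat) \notin beads la m) f (x - y)%N.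
Proof.
rewrite big_beads /hooks big_map /boxes big_allpairs_dep /=.
rewrite iota_index big_mkord.
rewrite (big_ord_widen m (fun i => \big[op/idx]_(j <- iota 0 (nth 0 la i))
  f (hook_length la (i, j)))) // big_mkcond.
apply: eq_bigr => i _; case: ltnP => [il|li].
  rewrite -(big_mkord (fun y => y \notin beads la m) (fun y => f (bead la m i - y)%N)).
  rewrite -[RHS]big_filter; under [LHS]eq_big_seq => j.
    rewrite mem_iota /= => jla; rewrite hook_length_hole //.
    over.
  rewrite -[LHS](big_map (hole la m) xpredT (fun y => f (bead la m i - y)%N)).
  apply: perm_big; apply: uniq_perm.
  - by rewrite map_inj_uniq ?iota_uniq //; apply: hole_inj.
  - by rewrite filter_uniq ?iota_uniq.
  - move=> y; rewrite mem_filter mem_index_iota /=; apply/mapP/andP => [[j]|[]].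
      rewrite mem_iota /= => jla ->; split; first exact: hole_notin.
      by rewrite -ltn_hole_bead.
    move=> /holesP[j ->]; rewrite -ltn_hole_bead // => jla; exists j => //.
    by rewrite mem_iota.
rewrite big_pred0 // => y; apply/negbTE; rewrite negbK; apply/negPn/negP => yB.
have [j yE] := holesP yB; have := ltn_ord y.
by rewrite [X in (X < _)%N]yE -ltn_hole_bead // nth_default.
Qed.

Lemma big_contents (R : Type) (idx : R) (op : Monoid.com_law idx) (f : int -> R) :
  \big[op/idx]_(c <- contents la) f c = \big[op/idx]_(i < m)
    \big[op/idx]_(j < nth 0 la i) f (j%:Z - i%:Z).
Proof.
rewrite /contents big_map /boxes big_allpairs_dep /=.
rewrite iota_index big_mkord.
rewrite (big_ord_widen m (fun i => \big[op/idx]_(j <- iota 0 (nth 0 la i))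
  f (content (i, j)))) // big_mkcond.
apply: eq_bigr => i _; case: ltnP => [il|li]; last by rewrite nth_default // big_ord0.
by rewrite iota_index big_mkord.
Qed.

End Partition.

Lemma beads_part_inj m la la' : is_partition la -> is_partition la' ->
  (size la <= m)%N -> (size la' <= m)%N -> beads la m = beads la' m -> la = la'.
Proof.
move=> lap lap' lam lam' e.
have nthE i : nth 0 la i = nth 0 la' i.
  have [im|mi] := ltnP i m; last by rewrite !nth_default // (leq_trans _ mi).
  suff : bead la m i = bead la' m i by move/addIn.
  elim/ltn_ind: i im => i IHi im.
  have le (l l' : seq nat) : is_partition l -> is_partition l' ->
      beads l m = beads l' m ->
      (forall k, (k < i)%N -> bead l m k = bead l' m k) -> (bead l m i <= bead l' m i)%N.
    move=> lp lp' ll' IH; have /beads_partP[k km bE] : bead l m i \in beads l' m.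
      by rewrite -ll'; apply/beads_partP; exists i.
    case: (ltngtP k i) => [ki|ik|e']; last by rewrite bE e'.
      by have := bead_decr lp ki im; rewrite (IH k ki) bE ltnn.
    by rewrite bE ltnW // bead_decr.
  apply/eqP; rewrite eqn_leq !le // => k ki; rewrite IHi // (ltn_trans ki) //.
have szE : size la = size la'.
  apply/eqP; rewrite eqn_leq; apply/andP; split; rewrite leqNgt; apply/negP.
    by rewrite -(part_nth_gt0 _ lap) nthE (part_nth_gt0 _ lap') ltnn.
  by rewrite -(part_nth_gt0 _ lap') -nthE (part_nth_gt0 _ lap) ltnn.
by apply: (@eq_from_nth _ 0%N) => // i _; apply: nthE.
Qed.

(** Induction on the number of beads: the largest bead M, above k others, is a first row of length M
    - k. *)
Lemma beads_part_surj B : exists la,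
  [/\ is_partition la, (size la <= #|` B|)%N & beads la #|` B| = B].
Proof.
elim: {B}#|` B| {-2}B (erefl #|` B|) => [|k IHk] B cB.
  exists [::]; split => //; move/eqP: cB; rewrite cardfs_eq0 => /eqP ->.
  by apply/fsetP => p; rewrite inE; apply/beads_partP => -[].
have B0 : B != fset0 by rewrite -cardfs_gt0 cB.
have [M MB Mmax] : exists2 M, M \in B & forall x, x \in B -> (x <= M)%N.
  have exB : exists x, x \in B by apply/fset0Pn.
  have bB x : x \in B -> (x <= \sum_(x <- B) x)%N by apply: fset_sum_ge.
  by case: (ex_maxnP exB bB) => M MB Mmax; exists M.
have cC : #|` B `\ M| = k by move: cB; rewrite (cardfsD1 M) MB => -[].
have [la [lap las laB]] := IHk _ cC; rewrite cC in las laB.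
have Mk : (k <= M)%N.
  have : B `<=` vacuum M.+1 by apply/fsubsetP => x /Mmax; rewrite in_vacuum ltnS.
  by move/fsubset_leq_card; rewrite cB card_vacuum ltnS.
have sub : (nth 0 la 0 <= M - k)%N.
  case: k {cB IHk} cC las laB Mk => [|k] cC las laB Mk.
    by rewrite nth_default //; move: las; case: (la).
  have : bead la k.+1 0 \in B `\ M by rewrite -laB; apply/beads_partP; exists 0%N.
  rewrite !inE => /andP[bM /Mmax]; rewrite leq_eqVlt (negPf bM) /= /bead.
  by move: Mk; lia.
(* If M = k, the new row would be a zero part; all rows are then zero and the empty partition is the
   preimage. *)
have [M0|Mgt0] := posnP (M - k).
  have la0 : la = [::].
    move: sub; rewrite M0 leqn0 => /eqP sub; case: (la) sub lap => //= x s ->.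
    by move=> /andP[_]; rewrite inE eqxx.
  exists [::]; rewrite cB; split=> //; rewrite -(fsetD1K MB) -laB la0.
  apply/fsetP => p; rewrite !inE; apply/beads_partP/orP => [[i ]|].
    case: i => [|i] ik ->; [left|right].
      by rewrite /bead nth_nil add0n subSS subn0; apply/eqP; lia.
    by apply/beads_partP; exists i; rewrite /bead // !nth_nil subSS.
  case=> [/eqP ->|/beads_partP[i ik ->]]; [exists 0%N => //|exists i.+1 => //].
    by rewrite /bead nth_nil; lia.
  by rewrite /bead !nth_nil subSS.
exists (M - k :: la)%N; rewrite cB; split=> //=.
- move: lap; rewrite /is_partition /= inE => /andP[sla la0].
  rewrite negb_or la0 andbT neq_ltn Mgt0 andbT.
  by case: (la) sla sub => //= x s -> ->.
- rewrite -(fsetD1K MB) -laB; apply/fsetP => p; rewrite !inE.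
  apply/beads_partP/orP => [[i ]|].
    case: i => [|i] ik ->; [left|right].
      by rewrite /bead /= subSS subn0 subnK.
    by apply/beads_partP; exists i; rewrite /bead //= subSS.
  case=> [/eqP ->|/beads_partP[i ik ->]]; [exists 0%N => //|exists i.+1 => //].
    by rewrite /bead /= subSS subn0 subnK.
Qed.

End Beads.

(** * Contents and hooks through bead power sums *)

Section PowerSums.
Local Open Scope fset_scope.
Local Open Scope ring_scope.
Variable F : numFieldType.
Implicit Types (B : {fset nat}).

Definition bead_sum (f : F -> F) B : F :=
  \sum_(b <- B) f (b%:R - #|` B|%:R) - \sum_(b < #|` B|) f (b%:R - #|` B|%:R).

Lemma eq_bead_sum f g B : f =1 g -> bead_sum f B = bead_sum g B.
Proof.
by move=> fg; rewrite /bead_sum; congr (_ - _); apply: eq_bigr => b _; rewrite fg.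
Qed.

Lemma bead_sum_lin (n : nat) (c : 'I_n -> F) (f : 'I_n -> F -> F) B :
  bead_sum (fun z => \sum_(l < n) c l * f l z) B = \sum_(l < n) c l * bead_sum (f l) B.
Proof.
rewrite /bead_sum exchange_big [X in _ - X]exchange_big -sumrB.
by apply: eq_bigr => l _; rewrite -!mulr_sumr -mulrBr.
Qed.

Lemma bead_sumB f g B :
  bead_sum (fun z => f z - g z) B = bead_sum f B - bead_sum g B.
Proof. by rewrite /bead_sum !sumrB; ring. Qed.

Lemma bead_sumX l B : bead_sum (fun z => z ^+ l) B = bead_psum F l B.
Proof. by []. Qed.

Lemma bead_sum_poly (P : {poly F}) B :
  bead_sum (horner P) B = \sum_(j < size P) P`_j * bead_psum F j B.
Proof.
transitivity (bead_sum (fun z => \sum_(j < size P) P`_j * z ^+ j) B).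
  by apply: eq_bead_sum => z; rewrite horner_coef.
exact: (bead_sum_lin (fun j : 'I__ => P`_j) (fun j z => z ^+ j) B).
Qed.

Lemma fil_bead_sum_poly (P : {poly F}) :
  fil S (bead_psum F) (size P) (bead_sum (horner P)).
Proof.
apply: fil_ext (fun B => esym (bead_sum_poly P B)) _.
apply: fil_sum => j _; apply: filZ; exact: fil_le (ltn_ord j) (fil_gen _ _ _).
Qed.

Lemma sum_antidiff (P : {poly F}) a n (f : F -> F) :
  (forall x, P.[x + 1] - P.[x] = f x) ->
  \sum_(i < n) f (a + i%:R) = P.[a + n%:R] - P.[a].
Proof.
move=> Pf; elim: n => [|n IHn]; first by rewrite big_ord0 addr0 subrr.
have -> : a + n.+1%:R = a + n%:R + 1 by rewrite -natr1 addrA.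
by rewrite big_ord_recr IHn -Pf /=; ring.
Qed.

Lemma contents_bead_sum k : exists P : {poly F}, forall la m,
  is_partition la -> (size la <= m)%N ->
  \sum_(c <- contents la) (c%:~R : F) ^+ k = bead_sum (horner P) (beads la m).
Proof.
have [Q Q0 QE] := antidifference ('X^k : {poly F}).
(* The contents of row i run from - i to la_i - i - 1, which is the normalised bead; the sum
   telescopes to Q one step further, hence the shift. The vacuum bead of the row accounts for Q(-
   i). *)
exists (Q \Po ('X + 1)) => la m lap lam.
have Pf x : Q.[x + 1] - Q.[x] = x ^+ k by rewrite QE hornerXn.
rewrite (big_contents lam) /bead_sum card_beads // big_beads //.
rewrite [X in _ - X](reindex_inj rev_ord_inj) -sumrB; apply: eq_bigr => i _ /=.
have im : (i.+1 <= m)%N by [].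
rewrite !horner_comp !hornerD !hornerX !hornerC /bead natrD natrB //.
transitivity (\sum_(j < nth 0%N la i) (- i%:R + j%:R : F) ^+ k).
  by apply: eq_bigr => j _; rewrite rmorphB /= [- _ + _]addrC.
rewrite (sum_antidiff _ _ Pf) -natr1; congr (_.[_] - _.[_]); ring.
Qed.

Lemma bead_sum_conv (n : nat) B :
  bead_sum (fun z => bead_sum (fun y => (z - y) ^+ n) B) B =
  \sum_(l < n.+1) 'C(n, l)%:R * (-1) ^+ l *
     (bead_psum F (n - l) B * bead_psum F l B).
Proof.
transitivity (bead_sum (fun z => \sum_(l < n.+1) ('C(n, l)%:R * (-1) ^+ l *
   bead_psum F l B) * z ^+ (n - l)) B).
  apply: eq_bead_sum => z.
  transitivity (bead_sum (fun y => \sum_(l < n.+1) ('C(n, l)%:R * (-1) ^+ l * z ^+ (n - l)) * y ^+ l) B).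
    apply: eq_bead_sum => y; rewrite exprDn; apply: eq_bigr => l _.
    rewrite (exprNn y) -[LHS]mulr_natl.
    by move: (z ^+ _) (y ^+ _) ((-1) ^+ _) => a b c; ring.
  etransitivity; first exact: (bead_sum_lin
    (fun l : 'I_n.+1 => 'C(n, l)%:R * (-1) ^+ l * z ^+ (n - l)) (fun l y => y ^+ l) B).
  apply: eq_bigr => l _; rewrite bead_sumX.
  by move: (z ^+ _) ((-1) ^+ _) => a b; ring.
etransitivity; first exact: (bead_sum_lin
  (fun l : 'I_n.+1 => 'C(n, l)%:R * (-1) ^+ l * bead_psum F l B)
  (fun l z => z ^+ (n - l)) B).
apply: eq_bigr => l _; rewrite bead_sumX.
by move: ((-1) ^+ _) (bead_psum F (n - l) B) => a b; ring.
Qed.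

(* Pairs of occupied positions are removed from the sum of (x - y)^(2k) over
   y < x; by parity they contribute half of the full double sum. *)
Lemma hooks_bead_sum k : (0 < k)%N -> exists P : {poly F}, forall B,
  \sum_(x <- B) \sum_(y < x | (y : nat) \notin B) ((x - y)%:R : F) ^+ k.*2 =
  bead_sum (horner P) B - 2%:R^-1 *
  bead_sum (fun z => bead_sum (fun y => (z - y) ^+ k.*2) B) B.
Proof.
move=> k0; have [P P0 PE] := antidifference (('X + 1) ^+ k.*2 : {poly F}).
have Pf x : P.[x + 1] - P.[x] = (x + 1) ^+ k.*2.
  by rewrite PE horner_exp hornerD hornerX hornerC.
exists P => B; set K := #|` B|.
pose f (z : F) := z ^+ k.*2.
have fN z : f (- z) = f z by rewrite /f exprNn -signr_odd odd_double mul1r.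
have f0 : f 0 = 0 by rewrite /f expr0n double_eq0 eqn0Ngt k0.
pose s (B : {fset nat}) (g : F -> F) := \sum_(b <- B) g (b%:R - K%:R).
pose v (g : F -> F) := \sum_(b < K) g (b%:R - K%:R).
pose h (B : {fset nat}) := \sum_(x <- B) \sum_(y < x | (y : nat) \notin B) ((x - y)%:R : F) ^+ k.*2.
(* The holes below x are all smaller positions, which total P(x), minus the beads among them. *)
have hE (C : {fset nat}) : h C = s C (fun z => P.[z + K%:R]) -
    2%:R^-1 * s C (fun z => s C (fun y => f (z - y))).
  have n2 : 2%:R != 0 :> F by rewrite pnatr_eq0.
  have tot (x : nat) : \sum_(y < x) ((x - y)%:R : F) ^+ k.*2 = P.[x%:R].
    rewrite (reindex_inj rev_ord_inj) /= -[RHS]subr0 -[X in _ = _ - X]P0.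
    have := sum_antidiff 0 x Pf; rewrite !add0r => <-; apply: eq_bigr => i _.
    by rewrite subKn // add0r natr1.
  have pairs : s C (fun z => s C (fun y => f (z - y))) =
      2%:R * \sum_(x <- C) \sum_(y <- C | (y < x)%N) ((x - y)%:R : F) ^+ k.*2.
    transitivity (\sum_(x <- C) \sum_(y <- C) f (x%:R - y%:R)).
      by apply: eq_bigr => x _; apply: eq_bigr => y _; congr f; ring.
    elim/fset1U_rect: C => [|c C cC IH]; first by rewrite !big_seq_fset0 mulr0.
    rewrite big_pairs_fsetU1 // mulrDr -IH big_fsetU1 //= big_fsetU1 //= subrr f0 add0r.
    under [X in _ + X]eq_bigr do rewrite big_fsetU1 //=.
    rewrite big_split /= addrA addrC; congr (_ + _).
    rewrite mulr_sumr -big_split; apply: eq_bigr => y _ /=.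
    have -> : f (y%:R - c%:R) = f (c%:R - y%:R) by rewrite -fN opprB.
    rewrite -mulr2n -[_ *+ 2]mulr_natl; congr (_ * _).
    case: ltnP => [yc|cy]; first by rewrite natrB 1?ltnW.
    by rewrite natrB // -fN opprB.
  rewrite pairs mulKf //; apply/eqP; rewrite -subr_eq0 opprB addrA subr_eq0.
  apply/eqP; rewrite /h -big_split; apply: eq_bigr => x _ /=.
  rewrite subrK -tot [RHS](bigID (fun y : 'I_x => (y : nat) \in C)) /= addrC.
  by rewrite -(big_ord_fset _ _ _ (fun y => ((x - y)%:R : F) ^+ k.*2)).
(* The vacuum has no hooks, so [hE] for it evaluates its double sum. *)
have vac : v (fun z => P.[z + K%:R]) = 2%:R^-1 * v (fun z => v (fun y => f (z - y))).
  have sv g : s (vacuum K) g = v g.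
    rewrite /s /v -(big_mkord xpredT (fun b => g (b%:R - K%:R))); apply: perm_big.
    apply: uniq_perm; rewrite ?fset_uniq ?iota_uniq // => b.
    by rewrite in_vacuum mem_index_iota.
  have : h (vacuum K) = 0.
    rewrite /h big1_seq // => x /=; rewrite in_vacuum => xK.
    rewrite big_pred0 // => y; rewrite in_vacuum; apply/negbTE; rewrite negbK.
    exact: ltn_trans (ltn_ord y) xK.
  rewrite hE sv => /eqP; rewrite subr_eq0 => /eqP ->; congr (_ * _).
  by rewrite sv; apply: eq_bigr => b _; rewrite sv.
have cross z : v (fun y => f (z - y)) = P.[z + K%:R] - P.[z].
  rewrite -(sum_antidiff z K Pf) /v (reindex_inj rev_ord_inj); apply: eq_bigr => i _ /=.
  by rewrite natrB // -natr1; congr f; ring.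
have sB g : s B g = bead_sum g B + v g by rewrite /bead_sum subrK.
have vsum : v (fun z => bead_sum (fun y => f (z - y)) B) =
    bead_sum (fun z => P.[z + K%:R]) B - bead_sum (horner P) B.
  rewrite -bead_sumB -(eq_bead_sum _ cross) /bead_sum /v sumrB.
  rewrite exchange_big; congr (_ - _); apply: eq_bigr => b _.
  by apply: eq_bigr => c _; rewrite -fN opprB.
have ssE : s B (fun z => s B (fun y => f (z - y))) =
    s B (fun z => bead_sum (fun y => f (z - y)) B) +
    (s B (fun z => P.[z + K%:R]) - s B (horner P)).
  rewrite /s -sumrB -big_split; apply: eq_bigr => b _ /=.
  by rewrite -cross -sB.
have n2 : 2%:R != 0 :> F by rewrite pnatr_eq0.
(* Comparing [vac] with [cross] gives this symmetry, by which the last terms depending on K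
   cancel. *)
have vK : v (fun z => P.[z + K%:R]) = - v (horner P).
  move: vac; rewrite {2}/v (eq_bigr _ (fun b _ => cross _)) sumrB.
  rewrite -/(v (fun z => P.[z + K%:R])) -/(v (horner P)) => e.
  have {e} : 2%:R * v (fun z => P.[z + K%:R]) = v (fun z => P.[z + K%:R]) - v (horner P).
    by rewrite {1}e mulVKf.
  move/eqP; rewrite mulr_natl mulr2n -subr_eq0 opprB addrACA subrr addr0 addr_eq0.
  by move/eqP.
by rewrite -/(h B) hE ssE !sB vsum vK; field.
Qed.

End PowerSums.

(** * Symmetric functions as polynomials in power sums *)

Section SymmetricFunctions.
Variable F : numFieldType.

(** Negating the power sums inverts the generating series of h, so its coefficients are (-1)^k
    e_k. *)
Definition elem_of_psum (q : nat -> F) k : F := (-1) ^+ k * hq (fun j => - q j) k.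

Lemma meval_mwiden n (p : {mpoly F[n]}) (v : 'I_n.+1 -> F) :
  (mwiden p).@[v] = p.@[fun i => v (widen_ord (leqnSn n) i)].
Proof.
elim/mpolyind: p => [|c m p _ _ IH]; first by rewrite mwiden0 !meval0.
rewrite mwidenD !mevalD IH mwidenZ !mevalZ mwidenX !mevalX; congr (_ * _ + _).
rewrite big_ord_recr /= mnmwiden_ordmax expr0 mulr1.
by apply: eq_bigr => i _; rewrite mnmwiden_widen.
Qed.

Lemma last0_mwiden n (p : {mpoly F[n]}) : mpoly_last0 (mwiden p) = p.
Proof.
rewrite /mpoly_last0; elim/mpolyind: p => [|c m p _ _ IH]; first by rewrite mwiden0 comp_mpoly0.
rewrite mwidenD comp_mpolyD IH mwidenZ comp_mpolyZ mwidenX comp_mpolyX.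
congr (_ *: _ + _); rewrite big_ord_recr /= mnmwiden_ordmax expr0 mulr1 [RHS]mpolyXE_id.
apply: eq_bigr => i _; rewrite mnmwiden_widen tnth_mktuple; congr (_ ^+ _).
have -> : widen_ord (leqnSn n) i = lift ord_max i by apply/val_inj/esym/lift_max.
by rewrite liftK.
Qed.

Lemma last0_mesym n k : mpoly_last0 (mesym n.+1 F k) = mesym n F k.
Proof.
case: k => [|k]; first by rewrite !mesym0E /mpoly_last0 comp_mpoly1.
rewrite mesymSS /mpoly_last0 comp_mpolyD rmorphM /= -!/(mpoly_last0 (mwiden _)).
rewrite !last0_mwiden comp_mpolyXU -tnth_nth tnth_mktuple.
by rewrite unlift_none mulr0 addr0.
Qed.

Lemma meval_mesym (s : seq F) k :
  (mesym (size s) F k).@[fun i => s`_i] = elem_of_psum (psum s) k.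
Proof.
elim/last_ind: s k => [|s c IHs] [|k].
- by rewrite mesym0E meval1 /elem_of_psum hq0 mulr1.
- rewrite mesym_geqnE // meval0 /elem_of_psum hq_null ?mulr0 // => i _.
  by rewrite /psum big_nil oppr0.
- by rewrite mesym0E meval1 /elem_of_psum hq0 mulr1.
rewrite size_rcons mesymSS mevalD mevalM !meval_mwiden mevalXU /=.
have sE i : (fun i : 'I_(size s) => (rcons s c)`_(widen_ord (leqnSn (size s)) i)) i = s`_i.
  by rewrite /= nth_rcons ltn_ord.
rewrite !(meval_eq _ sE) !IHs nth_rcons ltnn eqxx /elem_of_psum.
have -> : hq (fun j => - psum (rcons s c) j) k.+1 = hq (fun j => - psum s j - c ^+ j) k.+1.
  by apply: eq_hq => i _; rewrite /psum -cats1 big_cat big_seq1 opprD.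
by rewrite hq_remove exprS; ring.
Qed.

Lemma symfun_evalE (f : symfun F) n s : size s = n ->
  symfun_eval f s = (f n).@[fun i => s`_i].
Proof. by move=> <-. Qed.

Lemma symfun_eval_rcons0 (f : symfun F) s : symfun_eval f (rcons s 0) = symfun_eval f s.
Proof.
rewrite (@symfun_evalE _ (size s).+1) ?size_rcons // /symfun_eval.
rewrite -(symfun_last0 f (size s)) /mpoly_last0 comp_mpoly_meval; apply: meval_eq => i.
rewrite tnth_mktuple nth_rcons; case: unliftP => [j|] ->.
  by rewrite lift_max ltn_ord /= mevalXU.
by rewrite /= meval0 ltnn eqxx.
Qed.

Lemma symfun_eval_pad (f : symfun F) s n : symfun_eval f (s ++ nseq n 0) = symfun_eval f s.
Proof.
elim: n => [|n IHn]; first by rewrite cats0.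
by rewrite -addn1 nseqD -[nseq 1 0]/[:: 0] catA cats1 symfun_eval_rcons0.
Qed.

Lemma mpoly_last0_meval n (p : {mpoly F[n.+1]}) (v : 'I_n.+1 -> F) :
  {in msupp p, forall m : 'X_{1..n.+1}, m ord_max = 0%N} ->
  p.@[v] = (mpoly_last0 p).@[fun i => v (lift ord_max i)].
Proof.
move=> p0; rewrite /mpoly_last0 comp_mpoly_meval !mevalE !big_seq.
apply: eq_bigr => m mp; congr (_ * _); apply: eq_bigr => i _.
rewrite tnth_mktuple; case: unliftP => [j|] -> /=; first by rewrite mevalXU.
by rewrite p0 // !expr0.
Qed.

(** In n variables the fundamental theorem gives a polynomial [t n] in the e_i. Uniqueness makes
    these compatible, and bounded degree keeps e_(n+1) out of [t n.+1] for n >= d, so [t d] serves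
    for every length. *)
Lemma symfun_eval_psum (f : symfun F) : exists (d : nat) (t : {mpoly F[d]}),
  forall s, symfun_eval f s = t.@[fun i => elem_of_psum (psum s) i.+1].
Proof.
have [d fd] := symfun_bounded f.
pose S n := [tuple mesym n F i.+1 | i < n].
pose t n := sval (sym_fundamental (symfun_sym f n)).
have tS n : t n \mPo S n = f n by rewrite /t; case: sym_fundamental => /= q [].
have tw n : (mweight (t n) <= d)%N.
  by rewrite /t; case: sym_fundamental => /= q [_ /leq_trans]; apply.
have t_last n : mpoly_last0 (t n.+1) = t n.
  apply: msym_fundamental_un; rewrite -/(S n) tS -(symfun_last0 f n) -tS.
  elim/mpolyind: (t n.+1) => [|c m p _ _ IH]; first by rewrite /mpoly_last0 !comp_mpoly0.
  rewrite /mpoly_last0 !comp_mpolyD -!/(mpoly_last0 _) IH; congr (_ + _).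
  rewrite /mpoly_last0 !comp_mpolyZ; congr (_ *: _).
  rewrite !comp_mpolyX !rmorph_prod; apply: eq_bigr => i _ /=.
  rewrite !rmorphXn /= !tnth_mktuple -/(mpoly_last0 _) last0_mesym; congr (_ ^+ _).
  case: unliftP => [j|] ->; last by rewrite /= comp_mpoly0 mesym_geqnE.
  by rewrite lift_max /= comp_mpolyXU -tnth_nth tnth_mktuple.
(* A monomial containing e_(n+1) has weight at least n + 1 > d. *)
have t0 n : (d <= n)%N -> {in msupp (t n.+1), forall m : 'X_{1..n.+1}, m ord_max = 0%N}.
  move=> dn m mt; apply/eqP; rewrite -leqn0 leqNgt; apply/negP => m0.
  have := leq_trans (mmeasure_mnm_lt (Measure.clone _ (@mnmwgt n.+1) _) mt) (tw n.+1).
  rewrite /= /mnmwgt big_ord_recr /= => h.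
  have := leq_trans (leq_addl _ _) (ltnW h).
  by move=> h'; have := leq_trans (leq_pmull n.+1 m0) h'; rewrite ltnNge dn.
have evalE s k : size s = (d + k)%N ->
    symfun_eval f s = (t d).@[fun i => elem_of_psum (psum s) i.+1].
  move=> ss; rewrite (symfun_evalE _ ss) -tS comp_mpoly_meval.
  transitivity ((t (d + k)%N).@[fun i => elem_of_psum (psum s) i.+1]).
    have eE n j : size s = n -> (mesym n F j).@[fun i => s`_i] = elem_of_psum (psum s) j.
      by move=> <-; apply: meval_mesym.
    by apply: meval_eq => i; rewrite tnth_mktuple eE.
  move: (psum s) => q; elim: k {ss} => [|k IHk]; first by rewrite addn0.
  rewrite addnS mpoly_last0_meval; last by apply: t0; apply: leq_addr.
  by rewrite t_last -IHk; apply: meval_eq => i; rewrite lift_max.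
(* Padding with d zeros brings the length to at least d and changes no power sum of positive
   exponent. *)
exists d, (t d) => s; rewrite -(symfun_eval_pad f s d) (evalE _ (size s)); last first.
  by rewrite size_cat size_nseq addnC.
apply: meval_eq => i; rewrite /elem_of_psum; congr (_ * _); apply: eq_hq => j j0.
rewrite /psum big_cat [X in - (_ + X)]big1_seq ?addr0 // => x /=.
by rewrite mem_nseq => /andP[_ /eqP ->]; rewrite expr0n eqn0Ngt j0.
Qed.

End SymmetricFunctions.

(** * Mirrored bead sets *)

Section Mirror.
Local Open Scope fset_scope.
Implicit Types (la mu : seq nat) (B : {fset nat}).

(* Beads and holes are exchanged by p |-> 2m + d - 1 - p; for d = 1 the centre m
   is fixed and empty. *)
Definition mirrored (d : bool) m B :=
  [/\ forall p, p \in B -> (p < 2 * m + d)%N,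
      forall p, (p < 2 * m + d)%N -> ~~ (d && (p == m)) ->
        ((2 * m + d - p.+1)%N \in B) = (p \notin B)
    & d -> m \notin B].

Lemma mem_nthP (s : seq nat) (x : nat) :
  reflect (exists2 i, (i < size s)%N & (nth 0 s i = x)%N) (x \in s).
Proof. exact: nthP. Qed.

Lemma nth_conjugate la j : is_partition la -> nth 0%N (conjugate la) j = col_len la j.
Proof.
move=> lap; have [jl|lj] := ltnP j (head 0%N la).
  by rewrite (nth_map 0%N) ?size_iota // nth_iota.
rewrite nth_default ?size_map ?size_iota //; apply/esym/eqP.
by rewrite -leqn0 leqNgt ltn_col_len // -leqNgt nth0.
Qed.

Lemma conjugate_part la : is_partition la -> is_partition (conjugate la).
Proof.
move=> lap; apply/andP; split.
  apply/(sortedP 0%N) => i; rewrite size_map size_iota => il.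
  rewrite !nth_conjugate // /geq /=; apply: sub_count => x /=; exact: ltn_trans.
apply/mapP => -[j]; rewrite mem_iota add0n => /= jl /esym/eqP; apply/negP.
by rewrite -lt0n -/(col_len la j) ltn_col_len // nth0.
Qed.

(** Transposing reverses the border path: the bead of row i of the conjugate is 2m - 1 minus the
    hole of column i. *)
Lemma self_conjugate_mirrored la m : is_partition la -> (size la <= m)%N ->
  self_conjugate la <-> mirrored false m (beads la m).
Proof.
move=> lap lam; split=> [/eqP sc|[Bb Bm _]].
  have colE j : col_len la j = nth 0%N la j by rewrite -nth_conjugate // sc.
  have nm i : (nth 0%N la i <= m)%N by rewrite -colE (leq_trans (col_len_size _ _)).
  split=> // [p /beads_partP[i im ->]|p pm _].
    by rewrite /bead; have := nm i; lia.
  have [/beads_partP[i im pE]|pB] := boolP (p \in beads la m).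
    apply/negbTE; suff -> : (2 * m + false - p.+1 = hole la m i)%N by apply: hole_notin.
    by rewrite pE /hole colE /bead; have := nm i; lia.
  have [j pE] := holesP lap lam pB; have := nm j; rewrite pE /hole colE => mj.
  have jm : (j < m)%N.
    rewrite ltnNge; apply/negP => mj'; move: pm; rewrite pE /hole colE.
    by rewrite nth_default ?(leq_trans lam) //; lia.
  by apply/beads_partP; exists j => //; rewrite /bead; lia.
apply/eqP; have cp := conjugate_part lap.
have cm : (size (conjugate la) <= m)%N.
  rewrite size_map size_iota -nth0 leqNgt; apply/negP => m0.
  have [m_eq0|mgt0] := posnP m.
    by move: m0 lam; rewrite m_eq0 leqn0 => m0 /eqP/size0nil e; rewrite e in m0.
  have /Bb : bead la m 0 \in beads la m by apply/beads_partP; exists 0%N.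
  by rewrite /bead; move: m0; lia.
apply: (@beads_part_inj m) => //; apply/eqP; rewrite eqEfcard !card_beads // leqnn andbT.
apply/fsubsetP => p /beads_partP[i im ->].
have hE : bead (conjugate la) m i = (2 * m + false - (hole la m i).+1)%N.
  rewrite /bead /hole nth_conjugate //.
  by have := leq_trans (col_len_size la i) lam; lia.
rewrite hE Bm ?hole_notin // /hole.
by have := leq_trans (col_len_size la i) lam; lia.
Qed.

Lemma strict_nth mu i j : is_strict_partition mu -> (i <= j)%N -> (j < size mu)%N ->
  (nth 0%N mu j + (j - i) <= nth 0%N mu i)%N.
Proof.
move=> /andP[smu _] ij; rewrite -(subnKC ij); move: (j - i)%N => k; rewrite addKn.
elim: k => [|k IHk] kl; first by rewrite !addn0.
have kl' : (i + k < size mu)%N by apply: leq_trans kl; rewrite addnS.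
have := IHk kl'; move/(sortedP 0%N): smu => /(_ (i + k)%N); rewrite -addnS => /(_ kl) /=.
lia.
Qed.

Lemma strict_nth_gt0 mu i : is_strict_partition mu -> (i < size mu)%N ->
  (0 < nth 0%N mu i)%N.
Proof.
move=> /andP[_ mu0] il; rewrite lt0n; apply: contraNneq mu0 => <-; exact: mem_nth.
Qed.

Section DoubledDistinct.
Variables (la mu : seq nat).
Hypotheses (lap : is_partition la) (mup : is_strict_partition mu).
Hypothesis laE : forall i j, (j < nth 0%N la i)%N =
  in_shifted_diagram mu i j || in_added_column mu i j.

(** In Frobenius coordinates the doubled partition is (mu_i | mu_i - 1), each arm exceeding its leg
    by one; rows and columns below l are read off from this. *)
Lemma dd_row i : (i < size mu)%N -> nth 0%N la i = (i + nth 0%N mu i).+1.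
Proof.
move=> il; have jE j : (j < nth 0%N la i)%N = (j < (i + nth 0%N mu i).+1)%N.
  rewrite laE /in_shifted_diagram /in_added_column il /= addn1 ltnS.
  have [ij|ji] := ltnP i j; first by rewrite /= andbF orbF.
  have jl := leq_ltn_trans ji il.
  have := strict_nth mup ji il; have := strict_nth_gt0 mup il.
  by rewrite jl /=; lia.
by apply/eqP; rewrite eqn_leq leqNgt jE ltnn /= jE ltnSn.
Qed.

Lemma dd_row_ge i : (size mu <= i)%N -> (nth 0%N la i <= size mu)%N.
Proof.
move=> li; rewrite leqNgt laE /in_shifted_diagram /in_added_column ltnn.
by rewrite ltnNge li.
Qed.

Lemma dd_col j : (j < size mu)%N -> col_len la j = (j + nth 0%N mu j)%N.
Proof.
move=> jl; have kE k : (k < col_len la j)%N = (k < j + nth 0%N mu j)%N.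
  have [kl|lk] := ltnP k (size mu).
    rewrite ltn_col_len // dd_row // ltnS; have [kj|jk] := leqP k j.
      by have := strict_nth mup kj jl; have := strict_nth_gt0 mup jl; lia.
    by have := strict_nth mup (ltnW jk) kl; have := strict_nth_gt0 mup kl; lia.
  rewrite ltn_col_len // laE /in_shifted_diagram /in_added_column jl ltnNge lk /=.
  by rewrite (leq_trans (ltnW jl)).
apply/eqP; rewrite eqn_leq leqNgt kE ltnn /=.
by case: (j + _)%N (kE (j + nth 0%N mu j).-1) => [//|k] ->.
Qed.

Lemma dd_col_ge j : (size mu <= j)%N -> (col_len la j <= size mu)%N.
Proof.
move=> lj; rewrite leqNgt ltn_col_len // -leqNgt (leq_trans (dd_row_ge (leqnn _))) //.
Qed.

(** For i < l the bead of row i is m + mu_i and the hole of column i is m - mu_i, which is the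
    symmetry about the empty centre m. *)
Lemma dd_beads_gt m x : (size la <= m)%N -> (0 < x)%N ->
  ((m + x)%N \in beads la m) = (x \in mu).
Proof.
move=> lam x0; apply/beads_partP/mem_nthP => [[i im]|[i il <-]].
  have [il|li] := ltnP i (size mu).
    by rewrite /bead dd_row // => e; exists i => //; lia.
  by have := dd_row_ge li; rewrite /bead; lia.
have im : (i < m)%N.
  have := leq_trans (col_len_size la i) lam; rewrite dd_col //.
  by have := strict_nth_gt0 mup il; lia.
by exists i => //; rewrite /bead dd_row //; lia.
Qed.

Lemma dd_part_le m x : (size la <= m)%N -> x \in mu -> (x <= m)%N.
Proof.
move=> lam /mem_nthP[i il <-]; have := leq_trans (col_len_size la i) lam.
by rewrite dd_col //; lia.
Qed.

Lemma dd_beads_mid m : (size la <= m)%N -> m \notin beads la m.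
Proof.
move=> lam; apply/beads_partP => -[i im].
have [il|li] := ltnP i (size mu).
  by rewrite /bead dd_row //; have := strict_nth_gt0 mup il; lia.
by have := dd_row_ge li; rewrite /bead; lia.
Qed.

Lemma dd_beads_lt m x : (size la <= m)%N -> (0 < x)%N -> (x <= m)%N ->
  ((m - x)%N \in beads la m) = (x \notin mu).
Proof.
move=> lam x0 xm; apply/idP/idP.
  apply: contraL => /mem_nthP[i il xE].
  have -> : (m - x = hole la m i)%N by rewrite /hole dd_col // xE; lia.
  exact: hole_notin.
apply: contraR => /(holesP lap lam)[j jE].
have jl : (j < size mu)%N.
  rewrite ltnNge; apply/negP => lj; have := dd_col_ge lj.
  by move: jE; rewrite /hole; lia.
apply/mem_nthP; exists j => //; move: jE; rewrite /hole dd_col //.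
by have := leq_trans (col_len_size la j) lam; rewrite dd_col //; lia.
Qed.

Lemma dd_mirrored m : (size la <= m)%N -> mirrored true m (beads la m).
Proof.
move=> lam; split=> [p|p pm /= pnm|_]; last exact: dd_beads_mid.
  have [pm|mp] := leqP p m; first by move=> _; lia.
  rewrite -(subnKC (ltnW mp)) dd_beads_gt ?subn_gt0 // => /(dd_part_le lam).
  lia.
case: (ltngtP p m) => [ltpm|ltmp|e]; last by rewrite e eqxx in pnm.
  have [x0 xm] : (0 < m - p)%N /\ (m - p <= m)%N by lia.
  have -> : (2 * m + true - p.+1 = m + (m - p))%N by lia.
  by rewrite dd_beads_gt // -{2}(subKn (ltnW ltpm)) dd_beads_lt // negbK.
have [x0 xm] : (0 < p - m)%N /\ (p - m <= m)%N by lia.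
have -> : (2 * m + true - p.+1 = m - (p - m))%N by lia.
by rewrite dd_beads_lt // -{2}(subnKC (ltnW ltmp)) dd_beads_gt.
Qed.

End DoubledDistinct.

Lemma ltn_count_iota (P : pred nat) n j :
  (forall i k, (i <= k)%N -> P k -> P i) ->
  (j < count P (iota 0 n))%N = (j < n)%N && P j.
Proof.
move=> Pd; elim: n => [|n IHn]; first by rewrite ltn0.
have -> : iota 0 n.+1 = iota 0 n ++ [:: n] by rewrite -[n.+1]addn1 iotaD.
rewrite count_cat /= addn0 ltnS.
have cn : (count P (iota 0 n) <= n)%N by rewrite -[leqRHS](size_iota 0 n) count_size.
have [Pn|Pn] := boolP (P n); last first.
  rewrite addn0 IHn [in RHS]leq_eqVlt andb_orl; case: eqP => [-> |//].
  by rewrite ltnn (negPf Pn).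
have -> : count P (iota 0 n) = n.
  apply/eqP; rewrite -[X in _ == X](size_iota 0 n) -all_count; apply/allP => i.
  by rewrite mem_iota => /andP[_ /ltnW i_n]; apply: Pd Pn.
by rewrite addn1 ltnS; case: leqP => // jn; rewrite (Pd _ _ jn Pn).
Qed.

(** Column 0 consists of mu_0 added boxes, so there are [head 0 mu] rows; a row beyond l counts the
    added columns that reach it. *)
Definition dd_part mu : seq nat :=
  [seq if (i < size mu)%N then (i + nth 0%N mu i).+1
       else count (fun j => i < j + nth 0%N mu j)%N (iota 0 (size mu)) | i <- iota 0 (head 0%N mu)].

Lemma dd_partP mu : is_strict_partition mu -> is_partition (dd_part mu) /\
  forall i j, (j < nth 0%N (dd_part mu) i)%N =
    in_shifted_diagram mu i j || in_added_column mu i j.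
Proof.
move=> mup; set l := size mu.
have antit i k : (i <= k)%N -> (k < l)%N -> (k + nth 0%N mu k <= i + nth 0%N mu i)%N.
  by move=> ik kl; have := strict_nth mup ik kl; lia.
have headP i : (i < l)%N -> (i + nth 0%N mu i <= head 0%N mu)%N.
  by move=> il; have := antit 0%N i (leq0n i) il; rewrite add0n nth0.
have rowE i j : (j < count (fun j => i < j + nth 0%N mu j)%N (iota 0 l))%N =
    (j < l)%N && (i < j + nth 0%N mu j)%N.
  rewrite (@eq_in_count _ _ (fun j => (j < l) && (i < j + nth 0%N mu j))%N); last first.
    by move=> k; rewrite mem_iota => /= ->.
  rewrite ltn_count_iota ?andbA ?andbb // => k k' kk' /andP[k'l ik'].
  by rewrite (leq_ltn_trans kk') // (leq_trans ik') // antit.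
have rowD i : nth 0%N (dd_part mu) i = if (i < head 0%N mu)%N then
   (if (i < l)%N then (i + nth 0%N mu i).+1
    else count (fun j => i < j + nth 0%N mu j)%N (iota 0 l)) else 0%N.
  case: ltnP => ih; first by rewrite (nth_map 0%N) ?size_iota // nth_iota.
  by rewrite nth_default // size_map size_iota.
have cl i : (count (fun j => i < j + nth 0%N mu j)%N (iota 0 l) <= l)%N.
  by rewrite -[leqRHS](size_iota 0 l) count_size.
split.
  apply/andP; split.
    apply/(sortedP 0%N) => i; rewrite size_map size_iota => ih.
    rewrite !rowD ih (ltnW ih) /geq /=; case: (ltnP i.+1 l) => [i1l|li1].
      by rewrite (ltnW i1l); have := antit _ _ (leqnSn i) i1l; lia.
    case: ltnP => [il|li].
      by apply: leq_trans (cl _) _; lia.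
    by apply: sub_count => j /=; apply: ltn_trans.
  apply/mapP => -[i0]; rewrite mem_iota add0n => /=; move: i0 => i ih; case: ltnP => // li /esym/eqP.
  apply/negP; rewrite -lt0n rowE nth0 add0n ih andbT.
  by rewrite /l; case: (mu) ih.
move=> i j; rewrite rowD /in_shifted_diagram /in_added_column -/l.
case: (ltnP i l) => [il|li] /=.
  have -> : (i < head 0%N mu)%N.
    by apply: leq_trans (headP i il); have := strict_nth_gt0 mup il; lia.
  rewrite addn1 ltnS; have [ij|ji] := ltnP i j; first by rewrite /= andbF orbF.
  have jl := leq_ltn_trans ji il.
  have := strict_nth mup ji il; have := strict_nth_gt0 mup il.
  by rewrite jl /=; lia.
have -> : (j < (if (i < head 0%N mu) then count (fun j => i < j + nth 0%N mu j) (iota 0 l) else 0))%N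
   = (j < l)%N && (i < j + nth 0%N mu j)%N.
  case: (ltnP i (head 0%N mu)) => [_|hi]; first exact: rowE.
  rewrite ltn0; apply/esym/negbTE; rewrite negb_and -!leqNgt.
  by case: (leqP l j) => //= jl; apply: leq_trans (headP j jl) hi.
by case: ltnP => //= jl; rewrite (leq_trans (ltnW jl) li).
Qed.

Lemma doubled_distinct_mirrored la m : is_partition la -> (size la <= m)%N ->
  doubled_distinct la <-> mirrored true m (beads la m).
Proof.
move=> lap lam; split=> [[mu mup laE]|mB].
  exact: (dd_mirrored lap mup laE lam).
have [Bb Bm B0] := mB.
(* The distances from the centre to the beads above it. These determine a mirrored set, so
   comparison with [dd_part mu] above m suffices. *)
pose mu := rev [seq x <- iota 1 m | (m + x)%N \in beads la m].
have muE x : (x \in mu) = [&& (0 < x)%N, (x <= m)%N & (m + x)%N \in beads la m].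
  by rewrite mem_rev mem_filter mem_iota add1n ltnS andbC andbA.
have mup : is_strict_partition mu.
  apply/andP; split; last by rewrite muE.
  rewrite /mu rev_sorted; apply: sorted_filter (iota_ltn_sorted _ _).
  by move=> x y z; apply: ltn_trans.
have [la'p la'E] := dd_partP mup.
have colsize : (size (dd_part mu) <= m)%N.
  rewrite size_map size_iota; case: (posnP (head 0%N mu)) => [-> //|h0].
  have : head 0%N mu \in mu by case: (mu) h0 => //= x s _; rewrite inE eqxx.
  by rewrite muE => /and3P[].
suff e : la = dd_part mu by exists mu => // i j; rewrite {1}e la'E.
apply: (@beads_part_inj m) => //; apply/fsetP => p.
have [Bb' Bm' B0'] := dd_mirrored la'p mup la'E colsize.
have gtE x : (0 < x)%N -> (x <= m)%N -> ((m + x)%N \in beads (dd_part mu) m) = ((m + x)%N \in beads la m).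
  by move=> x0 xm; rewrite (dd_beads_gt la'p mup la'E colsize x0) muE x0 xm.
case: (ltngtP p m) => [pm|mp|->]; last by rewrite (negPf (B0 isT)) (negPf (B0' isT)).
  have pb : (p < 2 * m + true)%N by lia.
  have pn : ~~ (true && (p == m)) by rewrite /= neq_ltn pm.
  apply: negb_inj; rewrite -Bm // -Bm' //.
  have -> : (2 * m + true - p.+1 = m + (m - p))%N by lia.
  by rewrite gtE //; lia.
have [p2|p2] := leqP p (2 * m); first by rewrite -(subnKC (ltnW mp)) gtE //; lia.
by apply/idP/idP => [/Bb|/Bb']; lia.
Qed.

End Mirror.

(** * Residue classes of beads *)

Section Classes.
Local Open Scope fset_scope.
Local Open Scope ring_scope.
Implicit Types (B C T : {fset nat}).

Definition residue_class t N B r : {fset nat} :=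
  [fset k in vacuum N | (k * t + r)%N \in B].

Lemma in_residue_class t N B r k :
  (k \in residue_class t N B r) = (k < N)%N && ((k * t + r)%N \in B).
Proof. by rewrite in_fset /= inE /= in_vacuum. Qed.

Section Residues.
Variables (t N : nat) (B : {fset nat}).
Hypotheses (t0 : (0 < t)%N) (BN : forall p, p \in B -> (p < N * t)%N).
Variables (R : Type) (idx : R) (op : Monoid.com_law idx).

Local Notation cls := (residue_class t N B).

Lemma big_residue_class (f : nat -> R) :
  \big[op/idx]_(p <- B) f p =
  \big[op/idx]_(r < t) \big[op/idx]_(k <- cls r) f (k * t + r)%N.
Proof.
pose res (p : nat) : 'I_t := Ordinal (ltn_pmod p t0).
rewrite (partition_big res xpredT) //; apply: eq_bigr => r _.
rewrite (@big_seq_bij _ _ op _ _ (cls r) B xpredT (fun p => res p == r)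
  (fun k => (k * t + r)%N) (fun p => (p %/ t)%N)) ?fset_uniq //.
  move=> k; rewrite in_residue_class => /andP[kN kB] _; split=> //.
    by apply/eqP/val_inj; rewrite /= modnMDl modn_small.
  by rewrite divnMDl // divn_small // addn0.
move=> p pB /eqP pr; have pE : (p %/ t * t + r)%N = p by rewrite [RHS](divn_eq p t) -pr.
split=> //; rewrite in_residue_class pE pB andbT.
by rewrite ltn_divLR // BN.
Qed.

(** A bead and a hole at a distance divisible by t share a residue class: the hooks divisible by t
    are t times the hooks of the t-quotient. *)
Lemma big_gaps_residue_class (f : nat -> R) :
  \big[op/idx]_(x <- B) \big[op/idx]_(y < x | ((y : nat) \notin B) && (t %| x - y)%N) f (x - y)%N =
  \big[op/idx]_(r < t) \big[op/idx]_(k <- cls r)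
    \big[op/idx]_(l < k | (l : nat) \notin cls r) f ((k - l) * t)%N.
Proof.
rewrite big_residue_class; apply: eq_bigr => r _.
rewrite big_seq [RHS]big_seq; apply: eq_bigr => k.
rewrite in_residue_class => /andP[kN kB].
rewrite -(big_mkord (fun l => l \notin cls r) (fun l => f ((k - l) * t)%N)).
rewrite -(big_mkord (fun y => (y \notin B) && (t %| k * t + r - y)%N) (fun y => f (k * t + r - y)%N)).
rewrite (@big_seq_bij _ _ op _ _ (index_iota 0 k) (index_iota 0 (k * t + r))
  (fun l => l \notin cls r) _
  (fun k => (k * t + r)%N) (fun p => (p %/ t)%N)) ?iota_uniq //.
- by apply: eq_bigr => l _; rewrite subnDr mulnBl.
- move=> l; rewrite !mem_index_iota /= in_residue_class => lk lB; split.
  + by rewrite ltn_add2r ltn_pmul2r.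
  + rewrite subnDr -mulnBl dvdn_mull // andbT.
    by move: lB; rewrite (ltn_trans lk kN).
  + by rewrite divnMDl // divn_small // addn0.
- move=> y; rewrite !mem_index_iota /= => yk /andP[yB tky].
  have pE : (y %/ t * t + r)%N = y.
    rewrite [RHS](divn_eq y t); congr (_ + _)%N.
    have := tky; rewrite -eqn_mod_dvd ?(ltnW yk) // modnMDl modn_small //.
    by move/eqP.
  split=> //; last by rewrite in_residue_class pE (negPf yB) andbF.
  by move: yk; rewrite -{1}pE ltn_add2r ltn_pmul2r.
Qed.

End Residues.

(** Let c_r be the excess of class r over K beads. Twice the difference of the two sides is the sum
    of c_r (t c_r + 2r - t + 1), up to 2t times the size of the t-core. As |2r - t + 1| < t and c_r
    is an integer, each term is nonnegative and vanishes only for c_r = 0. *)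
Lemma residue_class_core t N K B : (0 < t)%N -> (forall p, p \in B -> (p < N * t)%N) ->
  #|` B| = (t * K)%N ->
  (\sum_(p <- B) p = t * (\sum_(r < t) \sum_(k <- residue_class t N B r)
      gaps_below (residue_class t N B r) k) + 'C(t * K, 2))%N <->
  forall r : 'I_t, #|` residue_class t N B r| = K.
Proof.
move=> t0 BN cB; set cls := residue_class t N B.
pose c (r : 'I_t) : int := #|` cls r|%:Z - K%:Z.
have bin2 n : ('C(n, 2)%:Z *+ 2 = n%:Z * (n%:Z - 1))%R.
  rewrite -mulr_natr -!natz -natrM mulnC -(mul_bin_diag n 1) bin1 natrM.
  by case: n => [|n]; rewrite ?mul0r // -[n.+1%:R]natr1 addrK.
have csum : \sum_r c r = 0.
  rewrite sumrB sumr_const card_ord.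
  have <- : (#|` B|)%:Z = \sum_(r < t) (#|` cls r|)%:Z.
    rewrite -sum1_size (big_residue_class t0 BN) -natz natr_sum; apply: eq_bigr => r _.
    by rewrite sum1_size natz.
  by rewrite cB PoszM -[K%:Z *+ t]mulr_natl natz subrr.
have main : (\sum_(p <- B) p)%:Z *+ 2 - (t * (\sum_(r < t) \sum_(k <- cls r)
      gaps_below (cls r) k) + 'C(t * K, 2))%:Z *+ 2 =
   \sum_r c r * (t%:Z * c r + (2%:Z * r%:Z - t%:Z + 1)).
  have nat_main : (\sum_(p <- B) p = t * (\sum_(r < t) \sum_(k <- cls r) gaps_below (cls r) k) +
      \sum_(r < t) (t * 'C(#|` cls r|, 2) + r * #|` cls r|))%N.
    rewrite (big_residue_class t0 BN) big_distrr -big_split; apply: eq_bigr => r _ /=.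
    rewrite addnA -mulnDr sum_gaps big_split /= -big_distrl /= mulnC; congr (_ + _)%N.
    by rewrite -sum1_size big_distrr /=; apply: eq_bigr => k _; rewrite muln1.
  rewrite nat_main !PoszD !mulrnDl opprD addrACA subrr add0r bin2.
  (* Any multiple of the sum of the c_r may be split off, since it is 0. *)
  transitivity (\sum_(r < t) (c r * (t%:Z * c r + (2%:Z * r%:Z - t%:Z + 1)) +
     ((2%:Z * K%:Z * t%:Z - 1) * c r + (t%:Z * K%:Z * (K%:Z - 1) + K%:Z * (2%:Z * r%:Z)))) -
     (t * K)%N%:Z * ((t * K)%N%:Z - 1)).
    congr (_ - _); rewrite -[Posz _]natz natr_sum -sumrMnl; apply: eq_bigr => r _.
    rewrite natz PoszD !PoszM mulrnDl -mulrnAr bin2 /c; ring.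
  rewrite !big_split /= -!mulr_sumr csum mulr0 add0r -addrA -[RHS]addr0; congr (_ + _).
  rewrite sumr_const card_ord.
  have -> : \sum_(r < t) (r%:Z : int) = 'C(t, 2)%:Z.
    rewrite -bin2_sum big_mkord -[RHS]natz natr_sum; apply: eq_bigr => r _.
    by rewrite natz.
  have -> : 2%:Z * 'C(t, 2)%:Z = t%:Z * (t%:Z - 1) by rewrite -bin2 -mulr_natl natz.
  rewrite PoszM -mulr_natr natz; ring.
have trichotomy r : c r = 0 \/
    (1 <= c r /\ 1 <= t%:Z * c r + (2%:Z * r%:Z - t%:Z + 1)) \/
    (c r <= -1 /\ t%:Z * c r + (2%:Z * r%:Z - t%:Z + 1) <= -1).
  have := ltn_ord r; move: (c r) => x rt.
  have [x0|[x1|x1]] : x = 0 \/ (1 <= x \/ x <= -1) by lia.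
  - by left.
  - right; left; split=> //; have : t%:Z * 1 <= t%:Z * x by apply: ler_wpM2l; lia.
    by lia.
  - right; right; split=> //; have : t%:Z * x <= t%:Z * (-1) by apply: ler_wpM2l; lia.
    by lia.
have nonneg r : 0 <= c r * (t%:Z * c r + (2%:Z * r%:Z - t%:Z + 1)).
  have [->|[[c1 e1]|[c1 e1]]] := trichotomy r; first by rewrite mul0r.
    by apply: mulr_ge0; lia.
  by rewrite -mulrNN; apply: mulr_ge0; lia.
have c_eq0 r : c r * (t%:Z * c r + (2%:Z * r%:Z - t%:Z + 1)) = 0 -> c r = 0.
  have [-> //|[[c1 e1]|[c1 e1]]] := trichotomy r => /eqP; rewrite mulf_eq0; lia.
split=> [e r|cK].
  move: main; rewrite e subrr => /esym/eqP; rewrite psumr_eq0 // => /allP/(_ r).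
  rewrite mem_index_enum => /(_ isT)/eqP/c_eq0; rewrite /c => /eqP; rewrite subr_eq0.
  by move/eqP => [].
have c0 r : c r = 0 by rewrite /c cK subrr.
move: main; rewrite [RHS]big1 => [|r _]; last by rewrite c0 mul0r.
by move/eqP; rewrite subr_eq0 => /eqP; lia.
Qed.

(** For K beads below 2K this encodes the conjugate partition. *)
Definition complement_mirror K C : {fset nat} :=
  [fset k in vacuum (2 * K) | (2 * K - k.+1)%N \notin C].

Lemma in_complement_mirror K C k :
  (k \in complement_mirror K C) = (k < 2 * K)%N && ((2 * K - k.+1)%N \notin C).
Proof. by rewrite in_fset /= inE /= in_vacuum. Qed.

Section ComplementMirror.
Variables (K : nat) (C : {fset nat}).
Hypothesis CK : forall k, k \in C -> (k < 2 * K)%N.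
Variables (R : Type) (idx : R) (op : Monoid.com_law idx).

Lemma big_fset_bounded L (D : {fset nat}) (f : nat -> R) : (forall k, k \in D -> (k < L)%N) ->
  \big[op/idx]_(k <- D) f k = \big[op/idx]_(k < L | (k : nat) \in D) f k.
Proof.
move=> DL; rewrite (big_ord_fset op D L f) big_seq [RHS]big_seq_cond.
by apply: eq_bigl => k; case kD: (k \in D) => //=; rewrite DL.
Qed.

Lemma big_complement_mirror (f : nat -> R) :
  op (\big[op/idx]_(k <- complement_mirror K C) f k)
     (\big[op/idx]_(k <- C) f (2 * K - k.+1)%N) = \big[op/idx]_(k < 2 * K) f k.
Proof.
rewrite (@big_fset_bounded (2 * K)); last first.
  by move=> k; rewrite in_complement_mirror => /andP[].
rewrite (@big_fset_bounded (2 * K) C) // [X in op _ X](reindex_inj rev_ord_inj) /=.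
rewrite [RHS](bigID (fun k : 'I__ => (2 * K - k.+1)%N \notin C)) /=; congr (op _ _).
  by apply: eq_bigl => k; rewrite in_complement_mirror ltn_ord.
apply: eq_big => k; first by rewrite negbK.
by move=> _; rewrite subnSK // subKn // ltnW.
Qed.

(** Conjugation preserves hooks: the pair (k, l) becomes (2K - 1 - l, 2K - 1 - k), at the same
    distance. *)
Lemma big_gaps_complement_mirror (f : nat -> R) :
  \big[op/idx]_(k <- complement_mirror K C)
    \big[op/idx]_(l < k | (l : nat) \notin complement_mirror K C) f (k - l)%N =
  \big[op/idx]_(k <- C) \big[op/idx]_(l < k | (l : nat) \notin C) f (k - l)%N.
Proof.
have unroll (D : {fset nat}) : (forall k, k \in D -> (k < 2 * K)%N) ->
    \big[op/idx]_(k <- D) \big[op/idx]_(l < k | (l : nat) \notin D) f (k - l)%N =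
    \big[op/idx]_(k < 2 * K) \big[op/idx]_(l < 2 * K)
      (if [&& (k : nat) \in D, (l : nat) \notin D & (l < k)%N] then f (k - l)%N else idx).
  move=> DK; rewrite (big_fset_bounded _ DK) big_mkcond; apply: eq_bigr => k _.
  case kD: (_ \in D) => /=; last by rewrite big1.
  rewrite (big_ord_widen_cond (2 * K) (fun l => l \notin D) (fun l => f (k - l)%N)) ?big_mkcond //.
  exact: ltnW.
rewrite !unroll //; last by move=> k; rewrite in_complement_mirror => /andP[].
rewrite exchange_big (reindex_inj rev_ord_inj); apply: eq_bigr => k _ /=.
rewrite (reindex_inj rev_ord_inj); apply: eq_bigr => l _ /=.
have [kK lK] : (k < 2 * K)%N /\ (l < 2 * K)%N by rewrite !ltn_ord.
have inD (i : nat) : (i < 2 * K)%N ->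
    ((2 * K - i.+1)%N \in complement_mirror K C) = (i \notin C).
  move=> iK; rewrite in_complement_mirror subnSK // (subKn (ltnW iK)).
  by rewrite leq_subr.
rewrite !inD // negbK.
have -> : (2 * K - k.+1 < 2 * K - l.+1)%N = (l < k)%N by lia.
rewrite andbCA; case: ifP => // /and3P[_ _ lk]; congr f; lia.
Qed.

End ComplementMirror.

End Classes.

(** * The class of 0, symmetric about K *)

Section CentralClass.
Local Open Scope fset_scope.
Local Open Scope ring_scope.
Implicit Types (B C T : {fset nat}).

Lemma big_square_pairs (R : Type) (idx : R) (op : Monoid.com_law idx) C (k : nat -> nat -> R) :
  \big[op/idx]_(x <- C) \big[op/idx]_(y <- C) k x y =
  op (\big[op/idx]_(x <- C) k x x)
     (\big[op/idx]_(x <- C) \big[op/idx]_(y <- C | (y < x)%N) op (k x y) (k y x)).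
Proof.
have -> : \big[op/idx]_(x <- C) \big[op/idx]_(y <- C | (y < x)%N) op (k x y) (k y x) =
    op (\big[op/idx]_(x <- C) \big[op/idx]_(y <- C | (y < x)%N) k x y)
       (\big[op/idx]_(x <- C) \big[op/idx]_(y <- C | (x < y)%N) k x y).
  rewrite [X in op _ X](exchange_big_dep xpredT) //= -big_split.
  by apply: eq_bigr => x _; rewrite big_split.
rewrite -!big_split big_seq [RHS]big_seq; apply: eq_bigr => x xC.
rewrite (bigID (fun y => y < x)%N) /= Monoid.mulmCA; congr (op _ _).
rewrite big_mkcond (big_fsetD1 x) //= ltnn /=; congr (op _ _).
rewrite [RHS]big_mkcond [RHS](big_fsetD1 x) //= ltnn Monoid.mul1m.
rewrite big_seq [RHS]big_seq; apply: eq_bigr => y; rewrite !inE -leqNgt => /andP[yx _].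
by rewrite [(x < y)%N]ltn_neqAle eq_sym yx.
Qed.

(* The class of 0: a bead at K + x for x in T, and at K - x for x not in T. *)
Definition central_class K T : {fset nat} :=
  [fset k in vacuum (2 * K).+1 |
    if (K < k)%N then (k - K)%N \in T else (k < K)%N && ((K - k)%N \notin T)].

Section Central.
Variables (K : nat) (T : {fset nat}).
Hypotheses (T0 : 0%N \notin T) (TK : forall x, x \in T -> (x <= K)%N).

Lemma in_central_class k : (k \in central_class K T) =
  if (K < k)%N then (k - K)%N \in T else (k < K)%N && ((K - k)%N \notin T).
Proof.
rewrite in_fset /= inE /= in_vacuum ltnS; apply: andb_idl.
by case: ltnP => [Kk /TK|kK _]; lia.
Qed.

Let T_gt0 x : x \in T -> (0 < x)%N.
Proof. by move=> xT; rewrite lt0n; apply: contraNneq T0 => <-. Qed.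

Variables (R : Type) (idx : R) (op : Monoid.com_law idx).

Lemma big_iota_fset (f : nat -> R) :
  \big[op/idx]_(z <- iota 1 K | z \in T) f z = \big[op/idx]_(x <- T) f x.
Proof.
rewrite -big_filter; apply: perm_big; apply: uniq_perm.
- by rewrite filter_uniq ?iota_uniq.
- exact: fset_uniq.
- move=> x; rewrite mem_filter mem_iota add1n ltnS; apply: andb_idr => xT.
  by rewrite T_gt0 // TK.
Qed.

Lemma big_central_class (f : nat -> R) :
  \big[op/idx]_(k <- central_class K T) f k =
  op (\big[op/idx]_(x <- T) f (K + x)%N)
     (\big[op/idx]_(z <- iota 1 K | z \notin T) f (K - z)%N).
Proof.
rewrite [LHS](bigID (fun k => K < k)%N) /=; congr (op _ _).
  rewrite (@big_seq_bij _ _ op _ _ T (central_class K T) xpredT _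
    (fun x => (K + x)%N) (fun k => (k - K)%N)) ?fset_uniq //.
    move=> x xT _; have x0 := T_gt0 xT; split; last by rewrite addKn.
      by rewrite in_central_class addKn -{1}[K]addn0 ltn_add2l x0.
    by rewrite -{1}[K]addn0 ltn_add2l.
  move=> k; rewrite in_central_class => + Kk; rewrite Kk => kT.
  by split=> //; rewrite subnKC // ltnW.
rewrite (@big_seq_bij _ _ op _ _ (iota 1 K) (central_class K T) (fun z => z \notin T) _
    (fun z => (K - z)%N) (fun k => (K - k)%N)) ?fset_uniq ?iota_uniq //.
  move=> z; rewrite mem_iota add1n ltnS => /andP[z0 zK] zT; split; last by rewrite subKn.
    rewrite in_central_class ltnNge leq_subr /= subKn // zT andbT.
    by move: z0 zK; lia.
  by rewrite ltnNge leq_subr.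
move=> k; rewrite in_central_class => + kK; rewrite (negPf kK) => /andP[k_K kT].
by split; rewrite ?(subKn (ltnW k_K)) // mem_iota; move: k_K; lia.
Qed.

(** A bead K + x sees the holes K - y for y in T, at distance x + y, and K + y for y not in T,
    including y = 0. The beads K - z repeat the distances y - z, but only for z > 0; the sum of f
    over T fills in the missing z = 0. *)
Lemma big_gaps_central_class (f : nat -> R) :
  op (\big[op/idx]_(k <- central_class K T)
        \big[op/idx]_(l < k | (l : nat) \notin central_class K T) f (k - l)%N)
     (\big[op/idx]_(x <- T) f x) =
  op (\big[op/idx]_(x <- T) \big[op/idx]_(y <- T) f (x + y)%N)
     (op (\big[op/idx]_(x <- T) \big[op/idx]_(y < x | (y : nat) \notin T) f (x - y)%N)
         (\big[op/idx]_(x <- T) \big[op/idx]_(y < x | (y : nat) \notin T) f (x - y)%N)).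
Proof.
rewrite big_central_class.
have upper x : x \in T -> \big[op/idx]_(l < K + x | (l : nat) \notin central_class K T) f (K + x - l)%N =
    op (\big[op/idx]_(y <- T) f (x + y)%N) (\big[op/idx]_(y < x | (y : nat) \notin T) f (x - y)%N).
  move=> xT; rewrite -(big_mkord (fun l => l \notin central_class K T) (fun l => f (K + x - l)%N)).
  rewrite (bigID (fun l => l < K)%N) /=; congr (op _ _).
    rewrite (@big_seq_bij _ _ op _ _ T (index_iota 0 (K + x)) xpredT _
      (fun y => (K - y)%N) (fun l => (K - l)%N)) ?fset_uniq ?iota_uniq //.
    - rewrite big_seq [RHS]big_seq; apply: eq_bigr => y /TK yK; congr f; lia.
    - move=> y yT _; have y0 := T_gt0 yT; have yK := TK yT.
      have -> : ((K - y)%N \notin central_class K T) = true.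
        by rewrite in_central_class ltnNge leq_subr /= subKn // yT andbF.
      by rewrite mem_index_iota; split; move: yK y0; lia.
    - move=> l; rewrite mem_index_iota in_central_class => _ /andP[+ lK].
      by rewrite ltnNge (ltnW lK) lK /= negbK => ->; rewrite subKn // ltnW.
  rewrite -(big_mkord (fun y => y \notin T) (fun y => f (x - y)%N)).
  rewrite (@big_seq_bij _ _ op _ _ (index_iota 0 x) (index_iota 0 (K + x)) (fun y => y \notin T) _
      (fun y => (K + y)%N) (fun l => (l - K)%N)) ?iota_uniq //.
  - by apply: eq_bigr => y _; rewrite subnDl.
  - move=> y; rewrite mem_index_iota => /= yx yT.
    have yZ : (K + y)%N \notin central_class K T.
      rewrite in_central_class addKn -[X in (X < _)%N]addn0 ltn_add2l.
      by case: posnP => [->|_ //]; rewrite addn0 ltnn.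
    by rewrite mem_index_iota /= ltn_add2l yx yZ -leqNgt leq_addr addKn.
  - move=> l; rewrite !mem_index_iota in_central_class -leqNgt => /= lKx /andP[lZ Kl].
    split; [lia| |by rewrite subnKC].
    by move: lZ; case: ltnP => // lK _; have -> : (l - K)%N = 0%N by lia.
have lower z : (1 <= z <= K)%N -> z \notin T ->
    \big[op/idx]_(l < K - z | (l : nat) \notin central_class K T) f (K - z - l)%N =
    \big[op/idx]_(y <- T | (z < y)%N) f (y - z)%N.
  move=> zK zT; rewrite -(big_mkord (fun l => l \notin central_class K T) (fun l => f (K - z - l)%N)).
  rewrite (@big_seq_bij _ _ op _ _ T (index_iota 0 (K - z)) (fun y => z < y)%N _
      (fun y => (K - y)%N) (fun l => (K - l)%N)) ?fset_uniq ?iota_uniq //.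
  - rewrite big_seq_cond [RHS]big_seq_cond; apply: eq_bigr => y /andP[/TK yK zy].
    by congr f; lia.
  - move=> y yT zy; have yK := TK yT; rewrite in_central_class.
    rewrite [(K < _)%N]ltnNge leq_subr /= subKn // yT andbF.
    by rewrite mem_index_iota; split=> //; move: yK zy zK; lia.
  - move=> l; rewrite mem_index_iota in_central_class => lz.
    have lK : (l < K)%N by move: lz; lia.
    by rewrite ltnNge (ltnW lK) lK /= negbK => ->; split=> //; move: lz zK; lia.
have -> : \big[op/idx]_(x <- T) \big[op/idx]_(l < K + x | (l : nat) \notin central_class K T) f (K + x - l)%N =
    op (\big[op/idx]_(x <- T) \big[op/idx]_(y <- T) f (x + y)%N)
       (\big[op/idx]_(x <- T) \big[op/idx]_(y < x | (y : nat) \notin T) f (x - y)%N).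
  by rewrite -big_split big_seq [RHS]big_seq; apply: eq_bigr => x /upper ->.
have -> : \big[op/idx]_(z <- iota 1 K | z \notin T)
      \big[op/idx]_(l < K - z | (l : nat) \notin central_class K T) f (K - z - l)%N =
    \big[op/idx]_(y <- T) \big[op/idx]_(z <- iota 1 K | (z \notin T) && (z < y)%N) f (y - z)%N.
  rewrite (exchange_big_dep (fun z => z \notin T)) /=; last by move=> y z _ /andP[].
  rewrite big_seq_cond [RHS]big_seq_cond; apply: eq_bigr => z /andP[].
  rewrite mem_iota add1n ltnS => zK zT; rewrite lower //.
  by apply: eq_bigl => y; rewrite zT.
have AC (a b c e : R) : op (op (op a b) c) e = op a (op b (op e c)).
  have ce : op c e = op e c by apply: Monoid.mulmC.
  by rewrite -ce !Monoid.mulmA.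
rewrite AC; congr (op _ (op _ _)).
rewrite -big_split big_seq [RHS]big_seq; apply: eq_bigr => y yT /=.
have y0 := T_gt0 yT; have yK := TK yT.
rewrite -[RHS](big_mkord (fun z => z \notin T) (fun z => f (y - z)%N)).
rewrite [RHS]big_ltn_cond // T0 subn0; congr (op _ _).
rewrite -big_filter -[RHS]big_filter; apply: perm_big; apply: uniq_perm.
- by rewrite filter_uniq ?iota_uniq.
- by rewrite filter_uniq ?iota_uniq.
- move=> z; rewrite !mem_filter mem_iota mem_index_iota -andbA; congr (_ && _).
  by apply/idP/idP; lia.
Qed.

End Central.

End CentralClass.

(** * Weights and power sums of a single class *)

Section ClassWeights.
Local Open Scope fset_scope.
Local Open Scope ring_scope.
Variable F : numFieldType.
Implicit Types (B C T : {fset nat}).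

Lemma fact_gaps C x : \prod_(y < x | (y : nat) \notin C) (x - y)%N%:R *
  \prod_(y <- C | (y < x)%N) (x - y)%N%:R = x`!%:R :> F.
Proof.
rewrite -(big_ord_fset _ _ _ (fun y => (x - y)%N%:R)) mulrC.
rewrite -(bigID (fun y : 'I_x => (y : nat) \in C) xpredT (fun y => (x - y)%N%:R)) /=.
rewrite fact_prod big_add1 /= big_mkord natr_prod (reindex_inj rev_ord_inj) /=.
by apply: eq_bigr => i _; rewrite subKn.
Qed.

(** x! is the product of the distances to all smaller positions; dividing out those to beads leaves
    those to holes, the hooks. *)
Lemma hook_inv_gaps C : hook_inv F C =
  (\prod_(x <- C) \prod_(y < x | (y : nat) \notin C) (x - y)%N%:R)^-1.
Proof.
rewrite /hook_inv -(eq_bigr _ (fun x _ => fact_gaps C x)) big_split /=.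
set p := \prod_(x <- C) _; set q := \prod_(x <- C) _.
have q0 : q != 0.
  rewrite /q prodf_seq_neq0; apply/allP => x _ /=.
  rewrite prodf_seq_neq0; apply/allP => y _ /=; apply/implyP => yx.
  by rewrite pnatr_eq0 -lt0n subn_gt0.
by rewrite invfM -mulrA mulVf // mulr1.
Qed.

(** In [big_gaps_central_class] the diagonal sums x + x give 2^l times the product of the parts,
    which cancels the extra product over T. What remains is 2^l times a square. *)
Lemma strict_weight_gaps K T : 0%N \notin T -> (forall x, x \in T -> (x <= K)%N) ->
  (\prod_(k <- central_class K T)
     \prod_(l < k | (l : nat) \notin central_class K T) (k - l)%N%:R)^-1 =
  strict_weight F T.
Proof.
move=> T0 TK.
have := big_gaps_central_class T0 TK *%R (fun n => n%:R : F).
set P := \prod_(k <- central_class K T) _.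
rewrite (big_square_pairs _ T (fun x y => (x + y)%N%:R)).
set D := \prod_(x <- T) \prod_(y < x | _) _; set X := \prod_(x <- T) x%:R.
set E := \prod_(x <- T) _ => /= e.
have T_neq0 (x : nat) : x \in T -> x%:R != 0 :> F.
  by move=> xT; rewrite pnatr_eq0; apply: contraNneq T0 => <-.
have X0 : X != 0 by rewrite prodf_seq_neq0; apply/allP => x /= /T_neq0.
have EE : E = 2%:R ^+ #|` T| * X.
  rewrite /E /X -[#|` T|]sum1_size (big_morph (fun n => 2%:R ^+ n) (exprD _) (expr0 _)) -big_split.
  by apply: eq_bigr => x _; rewrite addnn -mul2n natrM expr1.
pose S := \prod_(x <- T) \prod_(y <- T | (y < x)%N) ((x + y)%N%:R : F).
have SE : \prod_(x <- T) \prod_(y <- T | (y < x)%N) ((x + y)%N%:R * (y + x)%N%:R) = S ^+ 2 :> F.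
  rewrite expr2 /S -big_split; apply: eq_bigr => x _; rewrite /= -big_split.
  by apply: eq_bigr => y _; rewrite [(y + x)%N]addnC.
have PE : P = 2%:R ^+ #|` T| * (S * D) ^+ 2.
  by apply: (mulIf X0); rewrite e SE EE; move: (2%:R ^+ _) => z; ring.
rewrite PE invfM /strict_weight; congr (_ * _); rewrite -exprVn; congr (_ ^+ 2).
rewrite /shook_inv -(eq_bigr _ (fun x _ => fact_gaps T x)) big_split /= -/D.
pose Q := \prod_(x <- T) \prod_(y <- T | (y < x)%N) ((x - y)%N%:R : F).
have -> : \prod_(x <- T) \prod_(y <- T | (y < x)%N) ((x - y)%N%:R / (x + y)%N%:R) = Q / S :> F.
  by rewrite /Q /S -prodf_div; apply: eq_bigr => x _; rewrite -prodf_div.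
have Q0 : Q != 0.
  rewrite /Q prodf_seq_neq0; apply/allP => x _ /=.
  rewrite prodf_seq_neq0; apply/allP => y _ /=; apply/implyP => yx.
  by rewrite pnatr_eq0 -lt0n subn_gt0.
by rewrite -/Q !invfM -mulrA [Q^-1 * _]mulrA mulVf // mul1r mulrC.
Qed.

Lemma card_central_class K T : 0%N \notin T -> (forall x, x \in T -> (x <= K)%N) ->
  #|` central_class K T| = K.
Proof.
move=> T0 TK; rewrite -[LHS]sum1_size (big_central_class T0 TK) /=.
rewrite -(big_iota_fset T0 TK addn (fun=> 1%N)).
rewrite -(bigID (fun z => z \in T) xpredT (fun=> 1%N)) /=.
by rewrite sum1_size size_iota.
Qed.

Lemma gaps_central_class K T : 0%N \notin T -> (forall x, x \in T -> (x <= K)%N) ->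
  (\sum_(k <- central_class K T) gaps_below (central_class K T) k =
   2 * \sum_(x <- T) x)%N.
Proof.
move=> T0 TK; have /= := big_gaps_central_class T0 TK addn (fun=> 1%N).
rewrite -/(gaps_below _) (big_square_pairs _ T (fun x y => 1%N)) /=.
have -> : (\sum_(x <- T) \sum_(y <- T | (y < x)%N) (1 + 1) = 2 * 'C(#|` T|, 2))%N.
  rewrite -sum_pairs big_distrr /=; apply: eq_bigr => x _.
  by rewrite big_distrr.
have := sum_gaps T; rewrite /gaps_below.
set b := \sum_(k <- central_class K T) _; set n := \sum_(x <- T) \sum_(y < x | _) _.
set s := \sum_(x <- T) x; set l := \sum_(x <- T) 1.
by move: 'C(_, 2) b n s l => c b n s l /=; lia.
Qed.

Lemma card_complement_mirror K C : (forall k, k \in C -> (k < 2 * K)%N) ->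
  (#|` complement_mirror K C| + #|` C| = 2 * K)%N.
Proof.
move=> CK; have /= := big_complement_mirror CK addn (fun=> 1%N).
rewrite -[#|` complement_mirror K C|]sum1_size -[#|` C|]sum1_size => ->.
by rewrite sum_nat_const card_ord muln1.
Qed.

(** Normalised positions are reflected by z |-> - 1 - z; the exchange of beads and holes reverses
    the sign relative to the vacuum. *)
Lemma bead_sum_complement_mirror K C (g : F -> F) :
  (forall k, k \in C -> (k < 2 * K)%N) -> #|` C| = K ->
  bead_sum g (complement_mirror K C) = - bead_sum (fun z => g (- 1 - z)) C.
Proof.
move=> CK cC; have cM : #|` complement_mirror K C| = K.
  by have := card_complement_mirror CK; rewrite cC; lia.
rewrite /bead_sum cM cC.
have := big_complement_mirror CK +%R (fun k => g (k%:R - K%:R)) => /= e.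
have -> : \sum_(b <- complement_mirror K C) g (b%:R - K%:R) =
  \sum_(k < 2 * K) g (k%:R - K%:R) - \sum_(k <- C) g ((2 * K - k.+1)%N%:R - K%:R).
  by rewrite -e addrK.
have -> : \sum_(k <- C) g ((2 * K - k.+1)%N%:R - K%:R) =
          \sum_(b <- C) g (- 1 - (b%:R - K%:R)).
  rewrite big_seq [RHS]big_seq; apply: eq_bigr => k /CK kK.
  by rewrite natrB // natrM -natr1; congr g; ring.
have -> : \sum_(b < K) g (- 1 - (b%:R - K%:R)) = \sum_(k < K) g (k%:R).
  rewrite (reindex_inj rev_ord_inj); apply: eq_bigr => k _ /=.
  by rewrite natrB // -natr1; congr g; ring.
have -> : \sum_(k < 2 * K) g (k%:R - K%:R) =
    \sum_(b < K) g (b%:R - K%:R) + \sum_(k < K) g (k%:R).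
  rewrite mul2n -addnn big_split_ord /=; congr (_ + _); apply: eq_bigr => k _.
  by rewrite natrD; congr g; ring.
by ring.
Qed.

(** Relative to the vacuum, each x in T carries the bead at K - x to K + x. *)
Lemma bead_sum_central_class K T (g : F -> F) :
  0%N \notin T -> (forall x, x \in T -> (x <= K)%N) ->
  bead_sum g (central_class K T) = \sum_(x <- T) (g x%:R - g (- x%:R)).
Proof.
move=> T0 TK; rewrite /bead_sum card_central_class // (big_central_class T0 TK) /=.
have -> : \sum_(b < K) g (b%:R - K%:R) = \sum_(z <- iota 1 K) g (- z%:R).
  rewrite -[iota 1 K]/(iota (1 + 0) K) iotaDl big_map -[iota 0 K]/(iota 0 K).
  rewrite iota_index big_mkord (reindex_inj rev_ord_inj); apply: eq_bigr => k _ /=.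
  by rewrite natrB // add1n; congr g; ring.
have -> : \sum_(z <- iota 1 K) g (- z%:R) =
    \sum_(x <- T) g (- x%:R) + \sum_(z <- iota 1 K | z \notin T) g (- z%:R).
  rewrite (bigID (fun z => z \in T)) /=; congr (_ + _).
  exact: (big_iota_fset T0 TK +%R (fun z => g (- z%:R))).
rewrite sumrB.
have -> : \sum_(x <- T) g ((K + x)%N%:R - K%:R) = \sum_(x <- T) g x%:R.
  by apply: eq_bigr => x _; rewrite natrD; congr g; ring.
have -> : \sum_(z <- iota 1 K | z \notin T) g ((K - z)%N%:R - K%:R) =
          \sum_(z <- iota 1 K | z \notin T) g (- z%:R).
  rewrite big_seq_cond [RHS]big_seq_cond; apply: eq_bigr => z /andP[+ _].
  by rewrite mem_iota add1n ltnS => /andP[_ zK]; rewrite natrB //; congr g; ring.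
by ring.
Qed.

End ClassWeights.

(** * The reflection acting on residue classes *)

Section MirroredClasses.
Local Open Scope fset_scope.
Variables (d : bool) (t K : nat) (B : {fset nat}).
Hypotheses (t0 : (0 < t)%N) (dt : (d <= t)%N) (Bm : mirrored d (t * K) B).

Local Notation cls := (residue_class t (2 * K).+1 B).

(** The bound 2K + 1 leaves room for the position 2tK, which may be occupied when d = 1. *)
Lemma mirrored_bound p : p \in B -> (p < (2 * K).+1 * t)%N.
Proof. by have [Bb _ _] := Bm => /Bb; nia. Qed.

Lemma residue_class_bound r k : (d <= r)%N -> k \in cls r -> (k < 2 * K)%N.
Proof.
by have [Bb _ _] := Bm => dr; rewrite in_residue_class => /andP[_ /Bb]; nia.
Qed.

(** The reflection sends k t + r to (2K - 1 - k) t + (t + d - 1 - r), and the second remainder is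
    below t precisely when d <= r. *)
Lemma residue_class_partner r : (d <= r)%N -> (r < t)%N ->
  cls (t + d - r.+1) = complement_mirror K (cls r).
Proof.
have [Bb Br B0] := Bm => dr rt; apply/fsetP; move=> k.
have r't : (d <= t + d - r.+1)%N by lia.
rewrite in_complement_mirror; have [kK|Kk] /= := ltnP k (2 * K); last first.
  by apply/negbTE/negP => /(residue_class_bound r't); lia.
rewrite !in_residue_class.
have -> : (k < (2 * K).+1)%N by lia.
have -> : (2 * K - k.+1 < (2 * K).+1)%N by lia.
have [j jE] : exists j, (2 * K = k + j.+1)%N by exists (2 * K - k.+1)%N; lia.
have -> : (2 * K - k.+1 = j)%N by lia.
rewrite /= -Br.
- congr (_ \in B); have : (2 * (t * K) = t * k + t * j + t)%N by nia.
  by nia.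
- by nia.
- case dd: (d) dr => //= r0; apply/eqP => e.
  have : (j * t + r = K * t)%N by rewrite e mulnC.
  by move/(congr1 (modn^~ t)); rewrite modnMDl modnMl modn_small //; lia.
Qed.

Definition central_parts : {fset nat} := [fset x in vacuum K.+1 | (K + x)%N \in cls 0].

Lemma in_central_parts (x : nat) :
  (x \in central_parts) = (x <= K)%N && ((t * K + t * x)%N \in B).
Proof.
rewrite in_fset /= inE /= in_vacuum ltnS in_residue_class addn0.
case: (leqP x K) => //= xK; have -> : (K + x < (2 * K).+1)%N by lia.
by rewrite mulnC mulnDr.
Qed.

Lemma central_parts0 : d -> 0%N \notin central_parts.
Proof.
by have [_ _ B0] := Bm => /B0; rewrite in_central_parts muln0 addn0.
Qed.

(** For d = 1 the reflection sends k t to (2K - k) t, so class 0 is its own partner, with empty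
    centre K. *)
Lemma residue_class0 : d -> cls 0 = central_class K central_parts.
Proof.
have [Bb Br B0] := Bm => dd; apply/fsetP; move=> k.
rewrite in_central_class ?central_parts0 //; last by move=> x; rewrite in_central_parts => /andP[].
rewrite in_residue_class addn0 !in_central_parts; case: (ltngtP K k) => [Kk|kK|kK].
- have -> : (t * K + t * (k - K) = k * t)%N by nia.
  by congr (_ && _); lia.
- have -> : (k < (2 * K).+1)%N by lia.
  have -> : (K - k <= K)%N by lia.
  have [j jE] : exists j, (K = k + j.+1)%N by exists (K - k.+1)%N; lia.
  rewrite /= -[LHS]negbK -Br; first last.
  + by rewrite dd /=; apply/eqP; nia.
  + by nia.
  congr (~~ (_ \in B)); rewrite dd jE addKn.
  by nia.
- by rewrite -kK [(K * t)%N]mulnC (negPf (B0 dd)) andbF.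
Qed.

End MirroredClasses.

(** * Families of components *)

Section StateLevels.
Local Open Scope fset_scope.
Local Open Scope ring_scope.
Variable F : numFieldType.
Implicit Types (B T : {fset nat}) (bs : seq {fset nat}).

Definition gap_sum B := (\sum_(x <- B) gaps_below B x)%N.

Lemma mem_bead_level_gaps K n B :
  (B \in bead_level K n) = (#|` B| == K) && (gap_sum B == n).
Proof.
rewrite mem_bead_level; case: eqP => //= <-.
by rewrite -sum_gaps eqn_add2r.
Qed.

Fixpoint tuple_level (s K n : nat) : seq (seq {fset nat}) :=
  if s is s'.+1 then
    flatten [seq [seq B :: bs | B <- bead_level K i, bs <- tuple_level s' K (n - i)%N]
            | i <- index_iota 0 n.+1]
  else if n == 0%N then [:: [::]] else [::].

Lemma tuple_levelS s K n : tuple_level s.+1 K n =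
  flatten [seq [seq B :: bs | B <- bead_level K i, bs <- tuple_level s K (n - i)%N]
          | i <- index_iota 0 n.+1].
Proof. by []. Qed.

(** For d = 0 the strict component is pinned to the empty set, of weight 1, so that both parities
    share one type of state. *)
Definition state_level (d : bool) (s K n : nat) : seq ({fset nat} * seq {fset nat}) :=
  if d then
    flatten [seq [seq (T, bs) | T <- strict_level i, bs <- tuple_level s K (n - i)%N]
            | i <- index_iota 0 n.+1]
  else [seq (fset0, bs) | bs <- tuple_level s K n].

Lemma state_levelT s K n : state_level true s K n =
  flatten [seq [seq (T, bs) | T <- strict_level i, bs <- tuple_level s K (n - i)%N]
          | i <- index_iota 0 n.+1].
Proof. by []. Qed.

Lemma mem_tuple_level s K n bs : (bs \in tuple_level s K n) =
  [&& size bs == s, all (fun B => #|` B| == K) bs & (\sum_(B <- bs) gap_sum B)%N == n].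
Proof.
elim: s n bs => [|s IHs] n bs.
  by case: bs => [|B bs]; case: n => [|n]; rewrite ?big_nil ?inE.
rewrite tuple_levelS; apply/flatten_mapP/and3P => [[i ]|[]].
  rewrite mem_index_iota ltnS => /= ni /allpairsP[[B bs'] /= [Bi bs'i ->]].
  move: Bi bs'i; rewrite mem_bead_level_gaps IHs => /andP[/eqP cB /eqP gB] /and3P[/eqP <- abs /eqP sbs].
  by rewrite /= cB !eqxx abs big_cons gB sbs subnKC.
case: bs => //= B bs; rewrite eqSS => /eqP sbs /andP[cB abs]; rewrite big_cons => /eqP sn.
exists (gap_sum B); first by rewrite mem_index_iota ltnS -sn leq_addr.
apply/allpairsP; exists (B, bs); rewrite /= mem_bead_level_gaps cB eqxx IHs sbs abs eqxx.
by rewrite -sn addKn eqxx.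
Qed.

Lemma mem_state_level d s K n x : (x \in state_level d s K n) =
  [&& 0%N \notin x.1, d || (x.1 == fset0), size x.2 == s, all (fun B => #|` B| == K) x.2
    & (\sum_(c <- x.1) c + \sum_(B <- x.2) gap_sum B)%N == n].
Proof.
case: x => T bs; rewrite [(T, bs).1]/= [(T, bs).2]/=.
case: d; last first.
  apply/mapP/and5P => [[bs' + [-> ->]]|[T0 /eqP -> sb ab e]].
    rewrite mem_tuple_level => /and3P[sb ab e].
    by rewrite sb ab eqxx big_seq_fset0 add0n e inE.
  by exists bs; rewrite // mem_tuple_level sb ab; rewrite big_seq_fset0 add0n in e.
rewrite state_levelT orTb andTb; apply/flatten_mapP/and4P => [[i ]|[T0 sb ab /eqP e]].
  rewrite mem_index_iota ltnS => /= ni /allpairsP[[T' bs'] /= [+ + [-> ->]]].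
  rewrite mem_strict_level mem_tuple_level => /andP[T0 /eqP sT] /and3P[sb ab /eqP e].
  by rewrite T0 sb ab sT e subnKC.
exists (\sum_(c <- T) c)%N; first by rewrite mem_index_iota ltnS -e leq_addr.
apply/allpairsP; exists (T, bs); rewrite /= mem_strict_level T0 eqxx mem_tuple_level sb ab.
by rewrite -e addKn eqxx.
Qed.

Lemma flatten_map_uniq (I X : eqType) (r : seq I) (f : I -> seq X) (key : X -> I) :
  uniq r -> (forall i, uniq (f i)) -> (forall i x, x \in f i -> key x = i) ->
  uniq (flatten [seq f i | i <- r]).
Proof.
move=> + uf kf; elim: r => //= i r IHr /andP[ir ur].
rewrite cat_uniq uf IHr // andbT /=; apply/hasPn => x /flatten_mapP[j jr xj].
apply/negP => /kf e; move: xj => /kf e'; move: ir.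
by rewrite -e e' jr.
Qed.

Lemma tuple_level_uniq s K n : uniq (tuple_level s K n).
Proof.
elim: s n => [|s IHs] n; first by rewrite /=; case: ifP.
rewrite tuple_levelS; apply: (flatten_map_uniq (key := fun bs => gap_sum (head fset0 bs))).
- exact: iota_uniq.
- move=> i; apply: allpairs_uniq; rewrite ?bead_level_uniq //.
  by move=> [B bs] [B' bs'] _ _ [-> ->].
- move=> i x /allpairsP[[B bs] /= [Bi _ ->]] /=.
  by move: Bi; rewrite mem_bead_level_gaps => /andP[_ /eqP].
Qed.

Lemma state_level_uniq d s K n : uniq (state_level d s K n).
Proof.
case: d; last by rewrite map_inj_uniq ?tuple_level_uniq // => ? ? [].
rewrite state_levelT; apply: (flatten_map_uniq (key := fun x : {fset nat} * seq {fset nat} => (\sum_(c <- x.1) c)%N)).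
- exact: iota_uniq.
- move=> i; apply: allpairs_uniq; rewrite ?strict_level_uniq ?tuple_level_uniq //.
  by move=> [B bs] [B' bs'] _ _ [-> ->].
- move=> i x /allpairsP[[T bs] /= [Ti _ ->]] /=.
  by move: Ti; rewrite mem_strict_level => /andP[_ /eqP].
Qed.

Definition state_weight s (x : {fset nat} * seq {fset nat}) : F :=
  strict_weight F x.1 * \prod_(r < s) hook_inv F (nth fset0 x.2 r) ^+ 2.

(** Sums of products with one factor for each component: over families of total size n these become
    convolutions of sums over single components. *)
Inductive tensor s : ({fset nat} * seq {fset nat} -> F) -> Prop :=
| tensor_pure g0 gs : (exists d, fil S (strict_psum F) d g0) ->
    (forall r, exists d, fil S (bead_psum F) d (gs r)) ->
    tensor s (fun x => g0 x.1 * \prod_(r < s) gs (r : nat) (nth fset0 x.2 r))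
| tensor_add g h : tensor s g -> tensor s h -> tensor s (fun x => g x + h x).

Lemma tensor_ext s g h : g =1 h -> tensor s g -> tensor s h.
Proof. by move=> /funext ->. Qed.

Lemma tensor_mul s g h : tensor s g -> tensor s h -> tensor s (fun x => g x * h x).
Proof.
move=> sg sh; elim: sg => [g0 gs [d0 dg0] dgs|g1 g2 _ IH1 _ IH2]; last first.
  by apply: tensor_ext (tensor_add IH1 IH2) => x; rewrite mulrDl.
elim: sh => [h0 hs [e0 eh0] ehs|h1 h2 _ IH1 _ IH2]; last first.
  by apply: tensor_ext (tensor_add IH1 IH2) => x; rewrite mulrDr.
apply: (@tensor_ext _ (fun x => (g0 x.1 * h0 x.1) *
    \prod_(r < s) (fun i B => gs i B * hs i B) (r : nat) (nth fset0 x.2 r))) => [x|].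
  by rewrite big_split /=; ring.
apply: (@tensor_pure s (fun T => g0 T * h0 T) (fun i B => gs i B * hs i B)); first by exists (d0 + e0)%N; apply: fil_mul.
by move=> r; have [d dg] := dgs r; have [e eh] := ehs r; exists (d + e)%N; apply: fil_mul.
Qed.

Lemma tensor_const s c : tensor s (fun=> c).
Proof.
apply: (@tensor_ext _ (fun x => (fun=> c) x.1 *
    \prod_(r < s) (fun (i : nat) B => 1) (r : nat) (nth fset0 x.2 r))) => [x|].
  by rewrite big1 // mulr1.
by apply: (@tensor_pure s (fun=> c) (fun _ _ => 1)) => [|r]; exists 0%N; apply: fil_const.
Qed.

Lemma big_flatten_levels (X Y Z : Type) (f : X -> Y -> Z) (u : nat -> seq X) (v : nat -> seq Y)
    n (g : Z -> F) :
  \sum_(z <- flatten [seq [seq f x y | x <- u i, y <- v (n - i)%N] | i <- index_iota 0 n.+1]) g z =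
  \sum_(i < n.+1) \sum_(x <- u i) \sum_(y <- v (n - i)%N) g (f x y).
Proof.
rewrite big_flatten big_map big_mkord; apply: eq_bigr => i _.
by rewrite big_allpairs_dep.
Qed.

Lemma tuple_expoly s gs : (forall r, exists d, fil S (bead_psum F) d (gs r)) ->
  expoly s%:R (fun K n => \sum_(bs <- tuple_level s K n)
    \prod_(r < s) (hook_inv F (nth fset0 bs r) ^+ 2 * gs (r : nat) (nth fset0 bs r))).
Proof.
elim: s gs => [|s IHs] gs dgs.
  (* No components: the constant is 0, and 0^n selects n = 0. *)
  exists 1 => K n nK; rewrite hornerC mulr1; case: n nK => [|n] _ /=.
    by rewrite big_seq1 big_ord0 fact0 mulr1.
  by rewrite big_nil mulr0 expr0n.
have [d dg] := dgs 0%N.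
have := expoly_conv _ (charged_expoly dg) (IHs (fun r => gs r.+1) (fun r => dgs r.+1)).
rewrite addrC natr1 pnatr_eq0 => /(_ isT); apply: eq_expoly => K n nK.
rewrite tuple_levelS big_flatten_levels; apply: eq_bigr => i _.
rewrite mulr_suml; apply: eq_bigr => B _; rewrite mulr_sumr; apply: eq_bigr => bs _.
by rewrite big_ord_recl.
Qed.

Lemma state_expoly (d : bool) s g : (0 < 2 * s + d)%N -> tensor s g ->
  expoly ((2 * s + d)%N%:R / 2%:R)
    (fun K n => \sum_(x <- state_level d s K n) state_weight s x * g x).
Proof.
move=> t0; elim=> [g0 gs [e0 eg0] egs|g1 g2 _ IH1 _ IH2]; last first.
  apply: eq_expoly (expolyD IH1 IH2) => K n _; rewrite -big_split.
  by apply: eq_bigr => x _; rewrite mulrDr.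
have n2 : 2%:R != 0 :> F by rewrite pnatr_eq0.
have tE := tuple_expoly s egs; case: d t0 => t0; last first.
  have -> : (2 * s + false)%N%:R / 2%:R = s%:R :> F.
    by rewrite addn0 natrM mulrAC divff // mul1r.
  have [P PE] := tE; exists (g0 fset0 *: P) => K n nK.
  rewrite hornerZ mulrCA -(PE K) // mulrCA; congr (_ * _).
  rewrite /state_level big_map mulr_sumr; apply: eq_bigr => bs _.
  rewrite /state_weight /= [in RHS]big_split /= /strict_weight /shook_inv cardfs0 !big_seq_fset0.
  by rewrite expr0 !invr1 !mul1r expr1n mul1r; ring.
have -> : (2 * s + true)%N%:R / 2%:R = 2%:R^-1 + s%:R :> F.
  by rewrite natrD natrM mulrDl mulrAC divff // mul1r addrC mul1r.
have c0 : 2%:R^-1 + s%:R != 0 :> F.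
  by rewrite gt_eqF // ltr_pwDl // ?ler0n // invr_gt0 ltr0n.
apply: eq_expoly (expoly_conv c0 (strict_expoly eg0) tE) => K n nK.
rewrite state_levelT big_flatten_levels; apply: eq_bigr => i _.
rewrite mulr_suml; apply: eq_bigr => T _; rewrite mulr_sumr; apply: eq_bigr => bs _.
by rewrite /state_weight /= [in RHS]big_split /=; ring.
Qed.

End StateLevels.

(** * Statistics of a partition as functions of its components *)

Section Representable.
Local Open Scope fset_scope.
Local Open Scope ring_scope.
Variables (F : numFieldType) (d : bool) (s : nat).
Implicit Types (B T : {fset nat}) (la : seq nat).

Local Notation t := (2 * s + d)%N.
Local Notation cls K la := (residue_class t (2 * K).+1 (beads la (t * K))).

Definition balanced K la :=
  [/\ is_partition la, (size la <= t * K)%N, mirrored d (t * K) (beads la (t * K))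
    & forall r, (r < t)%N -> #|` cls K la r| = K].

Definition encode K la : {fset nat} * seq {fset nat} :=
  (if d then central_parts t K (beads la (t * K)) else fset0,
   [seq cls K la (r + d) | r <- iota 0 s]).

(** One g has to serve all K at once, which keeps the resulting polynomial independent of the
    truncation. *)
Definition representable (h : nat -> seq nat -> F) :=
  exists2 g, tensor s g & forall K la, balanced K la -> h K la = g (encode K la).

Lemma representable_ext h h' : (forall K la, balanced K la -> h K la = h' K la) ->
  representable h -> representable h'.
Proof. by move=> hh' [g sg hg]; exists g => // K la b; rewrite -hh' // hg. Qed.

Lemma representable_const c : representable (fun _ _ => c).
Proof. by exists (fun=> c) => //; apply: tensor_const. Qed.

Lemma representable_add h h' : representable h -> representable h' ->
  representable (fun K la => h K la + h' K la).
Proof.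
move=> [g sg hg] [g' sg' hg']; exists (fun x => g x + g' x); first exact: tensor_add.
by move=> K la b; rewrite hg // hg'.
Qed.

Lemma representable_mul h h' : representable h -> representable h' ->
  representable (fun K la => h K la * h' K la).
Proof.
move=> [g sg hg] [g' sg' hg']; exists (fun x => g x * g' x); first exact: tensor_mul.
by move=> K la b; rewrite hg // hg'.
Qed.

Lemma representable_scale c h : representable h -> representable (fun K la => c * h K la).
Proof. by move=> rh; apply: representable_mul => //; apply: representable_const. Qed.

Lemma representable_sum (I : Type) (r : seq I) (P : pred I) (h : I -> nat -> seq nat -> F) :
  (forall i, P i -> representable (h i)) ->
  representable (fun K la => \sum_(i <- r | P i) h i K la).
Proof.
move=> rh; elim: r => [|i r IHr].
  by apply: representable_ext (representable_const 0) => K la _; rewrite big_nil.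
case Pi: (P i); last by apply: representable_ext IHr => K la _; rewrite big_cons Pi.
by apply: representable_ext (representable_add (rh i Pi) IHr) => K la _; rewrite big_cons Pi.
Qed.

Lemma representable_prod (I : Type) (r : seq I) (P : pred I) (h : I -> nat -> seq nat -> F) :
  (forall i, P i -> representable (h i)) ->
  representable (fun K la => \prod_(i <- r | P i) h i K la).
Proof.
move=> rh; elim: r => [|i r IHr].
  by apply: representable_ext (representable_const 1) => K la _; rewrite big_nil.
case Pi: (P i); last by apply: representable_ext IHr => K la _; rewrite big_cons Pi.
by apply: representable_ext (representable_mul (rh i Pi) IHr) => K la _; rewrite big_cons Pi.
Qed.

Lemma representable_exp h n : representable h -> representable (fun K la => h K la ^+ n).
Proof.
move=> rh; elim: n => [|n IHn].
  by apply: representable_ext (representable_const 1) => K la _; rewrite expr0.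
by apply: representable_ext (representable_mul rh IHn) => K la _; rewrite exprS.
Qed.

Lemma representable_hq (q : nat -> nat -> seq nat -> F) :
  (forall i, (0 < i)%N -> representable (q i)) ->
  forall k, representable (fun K la => hq (fun i => q i K la) k).
Proof.
move=> rq; elim/ltn_ind => -[|k] IHk.
  by apply: representable_ext (representable_const 1) => K la _; rewrite hq0.
apply: (@representable_ext (fun K la => k.+1%:R^-1 *
    \sum_(i < k.+1) q i.+1 K la * hq (fun i => q i K la) (k - i))) => [K la _|].
  by rewrite -hqE mulKf // pnatr_eq0.
apply/representable_scale/representable_sum => i _; apply: representable_mul; first exact: rq.
by apply: IHk; rewrite ltnS leq_subr.
Qed.

Lemma representable_meval n (p : {mpoly F[n]}) (v : 'I_n -> nat -> seq nat -> F) :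
  (forall i, representable (v i)) -> representable (fun K la => p.@[fun i => v i K la]).
Proof.
move=> rv; apply: (@representable_ext (fun K la =>
   \sum_(m <- msupp p) p@_m * \prod_i v i K la ^+ m i)) => [K la _|]; first by rewrite mevalE.
apply: representable_sum => m _; apply: representable_scale.
by apply: representable_prod => i _; apply: representable_exp.
Qed.

Lemma nth_encode K la r : (r < s)%N -> nth fset0 (encode K la).2 r = cls K la (r + d).
Proof. by move=> rs; rewrite (nth_map 0%N) ?size_iota // nth_iota. Qed.

Lemma representable_class_fil e Q r : fil S (bead_psum F) e Q -> (r < s)%N ->
  representable (fun K la => Q (cls K la (r + d))).
Proof.
move=> eQ rs; exists (fun x => (fun=> 1) x.1 *
    \prod_(i < s) (fun i B => if i == r then Q B else 1) (i : nat) (nth fset0 x.2 i)).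
  apply: (@tensor_pure _ s (fun=> 1) (fun i B => if i == r then Q B else 1)).
    by exists 0%N; apply: fil_const.
  move=> i; case: (i == r); first by exists e.
  by exists 0%N; apply: fil_const.
move=> K la _; rewrite mul1r (bigD1 (Ordinal rs)) //= eqxx nth_encode // big1 ?mulr1 //.
by move=> i; rewrite -val_eqE /= => /negPf ->.
Qed.

Lemma representable_central_fil e Q : fil S (strict_psum F) e Q -> d ->
  representable (fun K la => Q (central_parts t K (beads la (t * K)))).
Proof.
move=> eQ dd; exists (fun x => Q x.1 *
    \prod_(i < s) (fun (i : nat) B => 1) (i : nat) (nth fset0 x.2 i)).
  apply: (@tensor_pure _ s Q (fun _ _ => 1)); first by exists e.
  by move=> i; exists 0%N; apply: fil_const.
by move=> K la _; rewrite big1 // mulr1 /= dd.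
Qed.

(** P(x) - P(- x) keeps the odd powers of x, so it is a combination of [strict_psum]. *)
Lemma central_sum_fil (P : {poly F}) : exists e,
  fil S (strict_psum F) e (fun T => \sum_(x <- T) (P.[x%:R] - P.[- x%:R])).
Proof.
exists (size P); apply: (@fil_ext _ _ _ _ _ _ (fun T => \sum_(i < size P)
    (if odd i then 2%:R * P`_i * strict_psum F i./2 T else 0))) => [T|].
  transitivity (\sum_(x <- T) \sum_(i < size P) (if odd i then 2%:R * P`_i * x%:R ^+ i else 0)).
    rewrite exchange_big; apply: eq_bigr => i _; case oi: (odd i); last by rewrite big1.
    rewrite /strict_psum mulr_sumr; apply: eq_bigr => x _; congr (_ * _ ^+ _).
    by rewrite -[RHS]odd_double_half oi.
  apply: eq_bigr => x _; rewrite !horner_coef -sumrB; apply: eq_bigr => i _.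
  rewrite exprNn -signr_odd; case: (odd i); last by rewrite expr0 mul1r subrr.
  by rewrite expr1; ring.
apply: fil_sum => i _; case: (odd i); last exact: fil0.
apply: filZ; apply: fil_le (fil_gen _ _ _).
by have := ltn_ord i; lia.
Qed.

Hypothesis t0 : (0 < t)%N.

Lemma representable_class_sum (P : {poly F}) r : (r < t)%N ->
  representable (fun K la => bead_sum (horner P) (cls K la r)).
Proof.
move=> rt; have dt : (d <= t)%N by lia.
have direct (Q : {poly F}) r' : (d <= r')%N -> (r' - d < s)%N ->
    representable (fun K la => bead_sum (horner Q) (cls K la r')).
  move=> dr rs; have := representable_class_fil (fil_bead_sum_poly Q) rs.
  by rewrite subnK.
have [dr|rd] := leqP d r.
  have [rs|sr] := ltnP (r - d) s; first exact: direct.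
  (* A class that [encode] does not store is expressed through its stored partner r1, at the price
     of z |-> - 1 - z and a sign. *)
  pose r1 := (t + d - r.+1)%N.
  have [dr1 rs1 r1t] : [/\ (d <= r1)%N, (r1 - d < s)%N & (r1 < t)%N] by rewrite /r1; split; lia.
  have rE : r = (t + d - r1.+1)%N by rewrite /r1; lia.
  apply: representable_ext (representable_scale (-1)
    (direct (P \Po (- 1 - 'X)) r1 dr1 rs1)) => K la [lap lam Bm cK].
  rewrite rE (residue_class_partner t0 dt Bm dr1 r1t).
  rewrite bead_sum_complement_mirror ?mulN1r; first last.
  - exact: cK.
  - by move=> k; apply: (residue_class_bound t0 dt Bm dr1).
  congr (- _); apply: eq_bead_sum => z.
  by rewrite horner_comp hornerD !hornerN hornerX -polyC1 hornerC.
have [dd r0] : d /\ r = 0%N by case: (d) rd => //; case: (r).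
have [e eQ] := central_sum_fil P.
apply: representable_ext (representable_central_fil eQ dd) => K la [lap lam Bm cK].
rewrite r0 (residue_class0 t0 dt Bm dd) bead_sum_central_class //.
  exact: central_parts0 t0 dt Bm dd.
by move=> x; rewrite (in_central_parts t0 dt Bm) => /andP[].
Qed.

Lemma representable_bead_psum j :
  representable (fun K la => bead_psum F j (beads la (t * K))).
Proof.
(* Normalised positions satisfy k t + r - t K = t (k - K) + r; the vacuum of t K beads splits into t
   vacua of K beads. *)
pose P (r : 'I_t) : {poly F} := (t%:R *: 'X + (r : nat)%:R%:P) ^+ j.
apply: (@representable_ext (fun K la => \sum_(r < t) bead_sum (horner (P r)) (cls K la r))).
  move=> K la [lap lam Bm cK]; have dt : (d <= t)%N by lia.
  have PE (r : 'I_t) (k : nat) :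
      (P r).[k%:R - K%:R] = ((k * t + r)%N%:R - (t * K)%N%:R) ^+ j.
    rewrite /P horner_exp hornerD hornerZ hornerX hornerC; congr (_ ^+ _).
    by rewrite natrD !natrM; ring.
  rewrite /bead_psum card_beads // /bead_sum sumrB.
  rewrite (big_residue_class t0 (mirrored_bound t0 dt Bm) +%R
    (fun p => (p%:R - (t * K)%N%:R : F) ^+ j)); congr (_ - _).
    by apply: eq_bigr => r _; rewrite cK //; apply: eq_bigr => k _; rewrite PE.
  transitivity (\sum_(r < t) \sum_(k < K) ((k * t + r)%N%:R - (t * K)%N%:R : F) ^+ j).
    by apply: eq_bigr => r _; rewrite cK //; apply: eq_bigr => k _; rewrite PE.
  have bV p : p \in vacuum (t * K) -> (p < K * t)%N by rewrite in_vacuum mulnC.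
  have vE n (f : nat -> F) : \sum_(k <- vacuum n) f k = \sum_(k < n) f k.
    rewrite -(big_mkord xpredT f); apply: perm_big.
    by apply: uniq_perm; rewrite ?fset_uniq ?iota_uniq // => b; rewrite in_vacuum mem_index_iota.
  rewrite -(vE _ (fun p => (p%:R - (t * K)%N%:R) ^+ j)) (big_residue_class t0 bV).
  apply: eq_bigr => r _.
  have -> : residue_class t K (vacuum (t * K)) r = vacuum K.
    apply/fsetP; move=> k; rewrite in_residue_class !in_vacuum; apply: andb_idr => kK.
    by have := ltn_ord r; nia.
  by rewrite (vE _ (fun k => ((k * t + r)%N%:R - (t * K)%N%:R) ^+ j)).
by apply: representable_sum => r _; apply: representable_class_sum.
Qed.

Lemma representable_bead_sum (P : {poly F}) :
  representable (fun K la => bead_sum (horner P) (beads la (t * K))).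
Proof.
apply: (@representable_ext (fun K la => \sum_(j < size P) P`_j * bead_psum F j (beads la (t * K)))).
  by move=> K la _; rewrite bead_sum_poly.
by apply: representable_sum => j _; apply: representable_scale; apply: representable_bead_psum.
Qed.

Lemma representable_contents k :
  representable (fun _ la => psum [seq c%:~R : F | c <- contents la] k).
Proof.
have [P PE] := contents_bead_sum F k.
apply: representable_ext (representable_bead_sum P) => K la [lap lam _ _].
by rewrite -(PE _ _ lap lam) /psum [RHS]big_map.
Qed.

Lemma representable_hooks k : (0 < k)%N ->
  representable (fun _ la => psum [seq (h ^ 2)%N%:R : F | h <- hooks la] k).
Proof.
move=> k0; have [P PE] := hooks_bead_sum F k0.
apply: (@representable_ext (fun K la => bead_sum (horner P) (beads la (t * K)) +
  - 2%:R^-1 * \sum_(l < (k.*2).+1) 'C(k.*2, l)%:R * (-1) ^+ l *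
     (bead_psum F (k.*2 - l) (beads la (t * K)) * bead_psum F l (beads la (t * K))))).
  move=> K la [lap lam _ _]; rewrite mulNr -bead_sum_conv -PE /psum big_map.
  rewrite -(big_hooks lap lam +%R (fun h => (h%:R : F) ^+ k.*2)); apply: eq_bigr => h _.
  by rewrite natrX -exprM mul2n.
apply: representable_add; first exact: representable_bead_sum.
apply/representable_scale/representable_sum => l _; apply: representable_scale.
by apply: representable_mul; apply: representable_bead_psum.
Qed.

Lemma representable_symfun (f : symfun F) (u : seq nat -> seq F) :
  (forall k, (0 < k)%N -> representable (fun _ la => psum (u la) k)) ->
  representable (fun _ la => symfun_eval f (u la)).
Proof.
move=> ru; have [n [p pE]] := symfun_eval_psum f.
apply: (@representable_ext (fun _ la => p.@[fun i => elem_of_psum (psum (u la)) i.+1])).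
  by move=> K la _; rewrite pE.
apply: (representable_meval p (v := fun i _ la => elem_of_psum (psum (u la)) i.+1)) => i.
apply: representable_scale; apply: (representable_hq (q := fun j _ la => - psum (u la) j)) => j j0.
by apply: representable_ext (representable_scale (-1) (ru j j0)) => K la _; rewrite mulN1r.
Qed.

End Representable.

(** * The correspondence between partitions and families *)

Section Encoding.
Local Open Scope fset_scope.
Local Open Scope ring_scope.
Variables (d : bool) (s : nat).
Implicit Types (B T : {fset nat}) (la : seq nat) (x : {fset nat} * seq {fset nat}).

Local Notation t := (2 * s + d)%N.
Local Notation cls K B := (residue_class t (2 * K).+1 B).
Hypothesis t0 : (0 < t)%N.

Let dt : (d <= t)%N. Proof. lia. Qed.

(** Class 0 if d = 1, then s pairs of partners. *)
Lemma big_classes (R : Type) (idx : R) (op : Monoid.com_law idx) (f : nat -> R) :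
  \big[op/idx]_(r < t) f r = op (if d then f 0%N else idx)
    (\big[op/idx]_(r < s) op (f (r + d)%N) (f (t + d - (r + d).+1)%N)).
Proof.
have -> : t = (d + (s + s))%N by lia.
rewrite !big_split_ord /=; congr (op _ _).
  by case: d => /=; rewrite ?big_ord1 ?big_ord0.
rewrite big_split; congr (op _ _); first by apply: eq_bigr => r _; rewrite addnC.
rewrite (reindex_inj rev_ord_inj); apply: eq_bigr => r _ /=; congr f.
by have := ltn_ord r; lia.
Qed.

(** The classes from s + d on are rebuilt as mirrors of the stored ones. *)
Definition decode_class K x r : {fset nat} :=
  if (r < d)%N then central_class K x.1
  else if (r - d < s)%N then nth fset0 x.2 (r - d)
  else complement_mirror K (nth fset0 x.2 (2 * s - (r - d).+1)).

Definition decode K x : {fset nat} :=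
  [fset p in vacuum ((2 * K).+1 * t) | (p %/ t)%N \in decode_class K x (p %% t)].

Lemma in_decode K x p : (p \in decode K x) =
  (p < (2 * K).+1 * t)%N && ((p %/ t)%N \in decode_class K x (p %% t)).
Proof. by rewrite in_fset /= inE /= in_vacuum. Qed.

Lemma encode_decode K la : mirrored d (t * K) (beads la (t * K)) ->
  beads la (t * K) = decode K (encode d s K la).
Proof.
move=> Bm; apply/fsetP; move=> p; rewrite in_decode.
have [pN|Np] := ltnP p _; last by apply/negbTE/negP => /(mirrored_bound t0 dt Bm); rewrite ltnNge Np.
have rt := ltn_pmod p t0; set r := (p %% t)%N in rt *.
have -> : (p \in beads la (t * K)) = ((p %/ t)%N \in cls K (beads la (t * K)) r).
  by rewrite in_residue_class -divn_eq ltn_divLR // pN.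
rewrite /decode_class; case: ltnP => [rd|dr].
  have [dd r0] : d /\ r = 0%N by case: (d) rd => //; case: (r).
  by rewrite r0 (residue_class0 t0 dt Bm dd) /= dd.
case: ltnP => [rs|sr]; first by rewrite nth_encode // subnK.
rewrite nth_encode; last by lia.
have dr1 : (d <= t + d - r.+1)%N by lia.
have r1t : (t + d - r.+1 < t)%N by lia.
have -> : (2 * s - (r - d).+1 + d = t + d - r.+1)%N by lia.
rewrite -(residue_class_partner t0 dt Bm dr1 r1t).
by have -> : (t + d - (t + d - r.+1).+1 = r)%N by lia.
Qed.

Lemma big_gaps_classes (R : Type) (idx : R) (op : Monoid.com_law idx) (f : nat -> R) K la :
  mirrored d (t * K) (beads la (t * K)) ->
  let B := beads la (t * K) in
  let gaps C := \big[op/idx]_(k <- C) \big[op/idx]_(l < k | (l : nat) \notin C) f (k - l)%N in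
  \big[op/idx]_(r < t) gaps (cls K B r) =
  op (if d then gaps (central_class K (encode d s K la).1) else idx)
     (\big[op/idx]_(r < s) op (gaps (nth fset0 (encode d s K la).2 r))
                              (gaps (nth fset0 (encode d s K la).2 r))).
Proof.
move=> Bm B gaps; rewrite (big_classes op (fun r => gaps (cls K B r))); congr (op _ _).
  have E : d -> gaps (cls K B 0) = gaps (central_class K (encode d s K la).1).
    by move=> dd; rewrite /B (residue_class0 t0 dt Bm dd) /encode /= ifT.
  by move: E; rewrite /B; case: (d) => // ->.
apply: eq_bigr => r _; rewrite nth_encode //; congr (op _ _).
have rs := ltn_ord r.
rewrite /B (residue_class_partner t0 dt Bm) ?leq_addl //; last by lia.
apply: big_gaps_complement_mirror => k.
by apply: (residue_class_bound t0 dt Bm); rewrite leq_addl.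
Qed.

Lemma encode_central K la : mirrored d (t * K) (beads la (t * K)) ->
  [/\ 0%N \notin (encode d s K la).1, forall c, c \in (encode d s K la).1 -> (c <= K)%N
    & ~~ d -> (encode d s K la).1 = fset0].
Proof.
move=> Bm; rewrite /encode /=; split; last by move=> /negPf ->.
  by case: ifP => [dd|_]; [apply: (central_parts0 t0 dt Bm) | rewrite inE].
move=> c; case: ifP => _; last by rewrite inE.
by rewrite (in_central_parts t0 dt Bm) => /andP[].
Qed.

Lemma gap_sum_classes K la : mirrored d (t * K) (beads la (t * K)) ->
  (\sum_(r < t) gap_sum (cls K (beads la (t * K)) r) =
   2 * (\sum_(c <- (encode d s K la).1) c + \sum_(B <- (encode d s K la).2) gap_sum B))%N.
Proof.
move=> Bm; have [T0 TK Td] := encode_central Bm.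
rewrite (big_gaps_classes addn (fun=> 1%N) Bm) mulnDr; congr (_ + _)%N.
  set T := (encode d s K la).1 in T0 TK Td *.
  case: ifP => [_|/negbT/Td ->]; last by rewrite big_seq_fset0.
  exact: gaps_central_class T0 TK.
have -> : (\sum_(B <- (encode d s K la).2) gap_sum B =
    \sum_(r < s) gap_sum (nth fset0 (encode d s K la).2 r))%N.
  by rewrite (big_nth fset0) size_map size_iota big_mkord.
rewrite mul2n -addnn -[RHS]big_split; apply: eq_bigr => r _ /=.
by [].
Qed.

Lemma size_hooks_div K la : is_partition la -> (size la <= t * K)%N ->
  mirrored d (t * K) (beads la (t * K)) ->
  size (hooks_div t la) = (\sum_(r < t) gap_sum (cls K (beads la (t * K)) r))%N.
Proof.
move=> lap lam Bm; rewrite -sum1_size /hooks_div big_filter big_mkcond.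
rewrite (big_hooks lap lam addn (fun h => if (t %| h)%N then 1%N else 0%N)).
have := big_gaps_residue_class t0 (mirrored_bound t0 dt Bm) addn (fun=> 1%N).
rewrite /gap_sum /gaps_below => <-; apply: eq_bigr => x _.
by rewrite -big_mkcondr.
Qed.

(** Every hook divisible by t yields one factor t, and partner classes have the same hooks, whence
    the squares in [state_weight]. *)
Lemma hook_prod_weight (F : numFieldType) K la : is_partition la -> (size la <= t * K)%N ->
  mirrored d (t * K) (beads la (t * K)) ->
  (hook_prod t la)%:R^-1 = t%:R ^- size (hooks_div t la) * state_weight F s (encode d s K la).
Proof.
move=> lap lam Bm; rewrite (size_hooks_div lap lam Bm).
rewrite /hook_prod /hooks_div natr_prod big_filter big_mkcond.
rewrite (big_hooks lap lam *%R (fun h => if (t %| h)%N then h%:R else 1 : F)).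
have := big_gaps_residue_class t0 (mirrored_bound t0 dt Bm) *%R (fun h => h%:R : F).
set Q := \prod_(x <- _) _ => e.
have {}e : \prod_(x <- beads la (t * K)) \prod_(y < x | (y : nat) \notin beads la (t * K))
   (if (t %| x - y)%N then (x - y)%N%:R else 1 : F) =
   t%:R ^+ (\sum_(r < t) gap_sum (cls K (beads la (t * K)) r)) *
   \prod_(r < t) \prod_(k <- cls K (beads la (t * K)) r)
      \prod_(l < k | (l : nat) \notin cls K (beads la (t * K)) r) (k - l)%N%:R.
  transitivity Q; first by apply: eq_bigr => x _; rewrite -big_mkcondr.
  rewrite e expr_sum -big_split; apply: eq_bigr => r _ /=.
  rewrite expr_sum -big_split; apply: eq_bigr => k _ /=.
  rewrite /gaps_below expr_sum -big_split; apply: eq_bigr => l _ /=.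
  by rewrite natrM mulrC expr1.
rewrite e invfM; congr (_ * _).
have [T0 TK Td] := encode_central Bm.
rewrite (big_gaps_classes *%R (fun h => h%:R : F) Bm) invfM; congr (_ * _).
  set T := (encode d s K la).1 in T0 TK Td *.
  case: ifP => [_|/negbT/Td ->]; first exact: strict_weight_gaps.
  by rewrite invr1 /strict_weight /shook_inv cardfs0 !big_seq_fset0 expr0 !invr1 !mul1r expr1n.
rewrite -prodfV; apply: eq_bigr => r _.
by rewrite hook_inv_gaps exprVn expr2.
Qed.

End Encoding.

(** * Every small family comes from a mirrored bead set *)

Section Decoding.
Local Open Scope fset_scope.
Local Open Scope ring_scope.
Variables (d : bool) (s K : nat) (x : {fset nat} * seq {fset nat}).
Implicit Types (B T : {fset nat}) (la : seq nat).

Local Notation t := (2 * s + d)%N.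
Hypothesis t0 : (0 < t)%N.
Hypotheses (x0 : 0%N \notin x.1) (xd : ~~ d -> x.1 = fset0) (xs : size x.2 = s).
Hypothesis xT : forall c, c \in x.1 -> (c <= K)%N.
Hypothesis xc : forall r, (r < s)%N -> #|` nth fset0 x.2 r| = K.
Hypothesis xB : forall r k, (r < s)%N -> k \in nth fset0 x.2 r -> (k < 2 * K)%N.

Let dt : (d <= t)%N. Proof. lia. Qed.

Lemma decode_class_bound r k : (r < t)%N ->
  k \in decode_class d s K x r -> (k < 2 * K + (r < d)%N)%N.
Proof.
move=> rt; rewrite /decode_class; case: ltnP => rd.
  by rewrite in_fset /= inE /= in_vacuum addn1 => /andP[].
case: ltnP => rs; first by rewrite addn0; apply: xB.
by rewrite in_complement_mirror addn0 => /andP[].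
Qed.

Lemma card_decode_class r : (r < t)%N -> #|` decode_class d s K x r| = K.
Proof.
move=> rt; rewrite /decode_class; case: ltnP => rd; first exact: card_central_class.
case: ltnP => rs; first exact: xc.
have r's : (2 * s - (r - d).+1 < s)%N by move: rt rd rs; lia.
have := card_complement_mirror (fun k => xB r's (k := k)); rewrite xc //.
by rewrite (mul2n K) -addnn => /eqP; rewrite eqn_add2r => /eqP.
Qed.

Lemma residue_class_decode r : (r < t)%N ->
  residue_class t (2 * K).+1 (decode d s K x) r = decode_class d s K x r.
Proof.
move=> rt; apply/fsetP; move=> k; rewrite in_residue_class in_decode.
rewrite divnMDl // modnMDl modn_small // divn_small // addn0.
apply/idP/idP => [/and3P[] //|kx].
have := decode_class_bound rt kx; have := leq_b1 (r < d)%N.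
by rewrite kx andbT; move: (r < d)%N => b b1 kK; apply/andP; split; [lia|nia].
Qed.

Lemma decode_bound p : p \in decode d s K x -> (p < (2 * K).+1 * t)%N.
Proof. by rewrite in_decode => /andP[]. Qed.

Lemma card_decode : #|` decode d s K x| = (t * K)%N.
Proof.
rewrite -[LHS]sum1_size (big_residue_class t0 decode_bound addn (fun=> 1%N)) /=.
under eq_bigr do rewrite residue_class_decode // sum1_size card_decode_class //.
by rewrite sum_nat_const card_ord.
Qed.

Lemma decode_partner r k : (d <= r < t)%N -> (k < 2 * K)%N ->
  ((2 * K - k.+1)%N \in decode_class d s K x (t + d - r.+1)) = (k \notin decode_class d s K x r).
Proof.
move=> /andP[dr rt] kK; rewrite /decode_class.
have [rd r'd] : (r < d)%N = false /\ (t + d - r.+1 < d)%N = false by split; lia.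
rewrite rd r'd; have -> : (t + d - r.+1 - d = 2 * s - (r - d).+1)%N by lia.
have [rs|sr] := ltnP (r - d) s.
  have -> : (2 * s - (r - d).+1 < s)%N = false by lia.
  have -> : (2 * s - (2 * s - (r - d).+1).+1 = r - d)%N by lia.
  rewrite in_complement_mirror; have -> : (2 * K - (2 * K - k.+1).+1 = k)%N by lia.
  by have -> : (2 * K - k.+1 < 2 * K)%N by lia.
have -> : (2 * s - (r - d).+1 < s)%N by lia.
by rewrite in_complement_mirror kK /= negbK.
Qed.

Lemma decode_mirrored : mirrored d (t * K) (decode d s K x).
Proof.
have rt p : (p %% t < t)%N by apply: ltn_pmod.
have mt a b : (a <= b)%N -> (a * t <= b * t)%N by move=> ab; rewrite leq_mul2r ab orbT.
have dt1 := leq_b1 d; have d1 : (0 < d)%N -> d by rewrite lt0b.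
split=> [p|p pm pK|dd].
- rewrite in_decode => /andP[_ /(decode_class_bound (rt p))].
  rewrite {3}(divn_eq p t); have := rt p; move: (p %/ t)%N (p %% t)%N => k r.
  case: (ltnP r d) => rd; rewrite /= ?addn0 ?addn1 => rt' kK.
    by have := mt _ _ kK; move: dt rd rt'; move: (2 * s + d)%N => u; lia.
  by have := mt _ _ kK; move: dt rd rt'; move: (2 * s + d)%N => u; lia.
- have [pd|dp] := ltnP (p %% t) d; last first.
    have kK : (p %/ t < 2 * K)%N.
      rewrite ltnNge; apply/negP => /mt; have := rt p; have := divn_eq p t; move: pm dp.
      by move: (p %/ t)%N (p %% t)%N (2 * s + d)%N => k r u; lia.
    have rr : (t + d - (p %% t).+1 < t)%N by have := rt p; lia.
    have -> : (2 * (t * K) + d - p.+1 = (2 * K - (p %/ t).+1) * t + (t + d - (p %% t).+1))%N.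
      rewrite mulnBl; have := mt _ _ kK; have := divn_eq p t; move: pm dp (rt p) rr.
      by move: (p %/ t)%N (p %% t)%N (2 * s + d)%N => k r u; lia.
    rewrite !in_decode divnMDl // modnMDl (modn_small rr) (divn_small rr) addn0.
    rewrite decode_partner ?dp ?rt //.
    have -> : (p < (2 * K).+1 * t)%N by move: pm; move: (2 * s + d)%N dt => u; lia.
    have -> : ((2 * K - (p %/ t).+1) * t + (t + d - (p %% t).+1) < (2 * K).+1 * t)%N.
      rewrite mulnBl; have := mt _ _ kK; move: rr (rt p).
      by move: (p %/ t)%N (p %% t)%N (2 * s + d)%N => k r u; lia.
    by [].
  (* Only d = 1 and residue 0 are left: here the quotient is reflected about K, by k |-> 2K - k. *)
  have r0 : (p %% t = 0)%N by lia.
  have d1' : d by apply: d1; lia.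
  have pE : (p = p %/ t * t)%N by rewrite {1}(divn_eq p t) r0 addn0.
  have kK : (p %/ t <= 2 * K)%N.
    rewrite leqNgt; apply/negP => /mt; have := pE; move: pm.
    by move: (p %/ t)%N (2 * s + d)%N t0 => k u; lia.
  have -> : (2 * (t * K) + d - p.+1 = (2 * K - p %/ t) * t)%N.
    rewrite mulnBl; have := mt _ _ kK; move: pm pE d1'; case: (d) => // + + _.
    by move: (p %/ t)%N (2 * s + true)%N => k u; lia.
  have d0 : (0 < d)%N = true by rewrite lt0b.
  rewrite !in_decode mulnK // modnMl r0 /decode_class d0.
  have -> : (p < (2 * K).+1 * t)%N.
    by have := mt _ _ kK; move: pE t0; move: (p %/ t)%N (2 * s + d)%N => k u; lia.
  have -> : ((2 * K - p %/ t) * t < (2 * K).+1 * t)%N by rewrite ltn_mul2r t0 ltnS leq_subr.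
  have pK' : (p %/ t != K)%N by apply: contraNneq pK => <-; rewrite mulnC -pE eqxx andbT.
  rewrite !in_central_class //; case: (ltngtP K (p %/ t)%N) pK' => // [Kp|pK'] _.
    have [-> ->] : (K < 2 * K - p %/ t)%N = false /\ (2 * K - p %/ t < K)%N by split; lia.
    by have -> : (K - (2 * K - p %/ t) = p %/ t - K)%N by lia.
  have -> : (K < 2 * K - p %/ t)%N by lia.
  by rewrite /= negbK; have -> : (2 * K - p %/ t - K = K - p %/ t)%N by lia.
- have d0 : (0 < d)%N = true by rewrite lt0b.
  rewrite in_decode mulnC modnMl mulnK // /decode_class d0.
  by rewrite in_central_class // ltnn andbF.
Qed.

Lemma encode_decodeK la : beads la (t * K) = decode d s K x -> encode d s K la = x.
Proof.
move=> laE; rewrite /encode laE; have dm := decode_mirrored.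
rewrite [RHS]surjective_pairing; congr (_, _).
  have E : d -> central_parts t K (decode d s K x) = x.1.
    move=> dd; have d0 : (0 < d)%N = true by rewrite lt0b.
    apply/fsetP => c; rewrite (in_central_parts t0 dt dm) in_decode.
    rewrite [(t * K)%N]mulnC [(t * c)%N]mulnC -mulnDl modnMl mulnK // /decode_class d0.
    rewrite in_central_class // ltn_mul2r t0 /= addKn.
    have [->|c0] := posnP c; first by rewrite (negPf x0) addn0 ltnn !andbF.
    have -> : (K < K + c)%N by rewrite -[X in (X < _)%N]addn0 ltn_add2l.
    apply/and3P/idP => [[] //|cx]; have cK := xT cx; split=> //.
    by rewrite ltnS mul2n -addnn leq_add2l.
  by move: E xd; case: (d) => [-> //|_ ->].
apply: (@eq_from_nth _ fset0); rewrite size_map size_iota ?xs // => r rs.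
rewrite (nth_map 0%N) ?size_iota // nth_iota // residue_class_decode; last by lia.
rewrite /decode_class addnK rs; have -> : (r + d < d)%N = false by lia.
by [].
Qed.

End Decoding.

(** * The sum over partitions as a sum over families *)

Section PartitionSum.
Local Open Scope fset_scope.
Local Open Scope ring_scope.
Variables (d : bool) (s : nat).
Implicit Types (B T : {fset nat}) (la : seq nat) (x : {fset nat} * seq {fset nat}).

Local Notation t := (2 * s + d)%N.
Local Notation cls K B := (residue_class t (2 * K).+1 B).
Hypothesis t0 : (0 < t)%N.

Let dt : (d <= t)%N. Proof. lia. Qed.

(** n <= K bounds the strict parts by K and the beads of each component by 2K, so the decoded set
    fits into the mirrored window. *)
Lemma state_level_preimage K n x : (n <= K)%N -> x \in state_level d s K n ->
  exists2 la, balanced d s K la & encode d s K la = x.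
Proof.
move=> nK; rewrite mem_state_level => /and5P[x0 xd /eqP xs /allP xc /eqP xn].
have xd' : ~~ d -> x.1 = fset0 by move=> dd; apply/eqP; rewrite (negPf dd) in xd.
have xT c : c \in x.1 -> (c <= K)%N.
  by move=> /fset_sum_ge cx; apply: leq_trans (leq_trans cx _) nK; rewrite -xn leq_addr.
have xm r : (r < s)%N -> nth fset0 x.2 r \in x.2 by move=> rs; rewrite mem_nth ?xs.
have xK r : (r < s)%N -> #|` nth fset0 x.2 r| = K by move=> /xm/xc/eqP.
have xB r k : (r < s)%N -> k \in nth fset0 x.2 r -> (k < 2 * K)%N.
  move=> rs kr; have Bl : nth fset0 x.2 r \in bead_level K (gap_sum (nth fset0 x.2 r)).
    by rewrite mem_bead_level_gaps xK ?eqxx.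
  apply: leq_trans (bead_level_bound Bl kr) _; rewrite mul2n -addnn leq_add2r.
  apply: leq_trans nK; rewrite -xn; apply: leq_trans (leq_addl _ _).
  by rewrite (big_rem _ (xm r rs)) leq_addr.
have [la [lap lam laE]] := beads_part_surj (decode d s K x).
rewrite (card_decode t0 x0 xd' xs xT xK xB) in lam laE; exists la; last first.
  exact: (encode_decodeK t0 x0 xd' xs xT xB).
split=> //; rewrite laE; first exact: (decode_mirrored t0 x0 xd' xs xT xB).
by move=> r rt; rewrite residue_class_decode // card_decode_class.
Qed.

Lemma encode_inj K la la' : balanced d s K la -> balanced d s K la' ->
  encode d s K la = encode d s K la' -> la = la'.
Proof.
move=> [lap lam laB _] [lap' lam' laB' _] e; apply: beads_part_inj lap lap' lam lam' _.
by rewrite (encode_decode t0 laB) (encode_decode t0 laB') e.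
Qed.

(** Equality of the size with t times the number of hooks divisible by t says that the t-core is
    empty; [residue_class_core] reads this off the bead counts. *)
Lemma size_hooks_div_balanced K la : is_partition la -> (size la <= t * K)%N ->
  mirrored d (t * K) (beads la (t * K)) ->
  (sumn la = t * size (hooks_div t la))%N <-> balanced d s K la.
Proof.
move=> lap lam laB; have BN := mirrored_bound t0 dt laB.
have core := residue_class_core t0 BN (card_beads (t * K) lap).
rewrite (sum_beads lap lam) -(size_hooks_div t0 lap lam laB) in core.
split=> [e|[_ _ _ c]].
  split=> // r rt; have /core c : (sumn la + 'C(t * K, 2) = t * size (hooks_div t la) + 'C(t * K, 2))%N.
    by rewrite e.
  exact: (c (Ordinal rt)).
by apply/eqP; rewrite -(eqn_add2r 'C(t * K, 2)); apply/eqP/core => r; apply: c.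
Qed.

(** The factor 2: partner classes count each component twice, and the central class has size twice
    that of its strict partition. *)
Lemma encode_state_level K n la : balanced d s K la ->
  (encode d s K la \in state_level d s K n) = (size (hooks_div t la) == 2 * n)%N.
Proof.
move=> [lap lam laB c]; have [T0 TK Td] := encode_central t0 laB.
rewrite mem_state_level T0 (size_hooks_div t0 lap lam laB) (gap_sum_classes t0 laB).
have -> : d || ((encode d s K la).1 == fset0) by case: (boolP d) Td => //= _ /(_ isT)/eqP.
have -> : size (encode d s K la).2 == s by rewrite size_map size_iota.
have -> : all (fun B => #|` B| == K) (encode d s K la).2.
  apply/allP => B /mapP[r]; rewrite mem_iota add0n => /= rs ->.
  by apply/eqP/c; lia.
by rewrite /= eqn_pmul2l.
Qed.

Variables (F : numFieldType) (pd : pred (seq nat)).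
Hypothesis pdP : forall m la, is_partition la -> (size la <= m)%N ->
  pd la <-> mirrored d m (beads la m).

Lemma size_partition la : is_partition la -> (size la <= sumn la)%N.
Proof.
move=> /andP[_]; elim: la => //= x la IHla; rewrite inE negb_or eq_sym -lt0n => /andP[x1 la0].
by rewrite -add1n leq_add // IHla.
Qed.

(** K = 2n makes t K equal to the size of the partitions summed over, which bounds their number of
    rows. *)
Lemma perm_encode n : perm_eq
  [seq encode d s (2 * n) la | la <- partitions (2 * n * t)
     & pd la && (size (hooks_div t la) == 2 * n)%N]
  (state_level d s (2 * n) n).
Proof.
have balP la : la \in [seq la <- partitions (2 * n * t) | pd la && (size (hooks_div t la) == 2 * n)%N] ->
    balanced d s (2 * n) la /\ size (hooks_div t la) = (2 * n)%N.
  rewrite mem_filter mem_partitions => /andP[/andP[lad /eqP sh] /andP[lap /eqP sla]].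
  have lam : (size la <= t * (2 * n))%N by rewrite mulnC -sla size_partition.
  split=> //; apply/size_hooks_div_balanced => //; first exact/pdP.
  by rewrite sla sh mulnC.
apply: uniq_perm.
- rewrite map_inj_in_uniq; first exact/filter_uniq/partitions_uniq.
  move=> la la' /balP[b _] /balP[b' _].
  exact: encode_inj.
- exact: state_level_uniq.
move=> x; apply/mapP/idP => [[la /balP[b sh] ->]|xl].
  by rewrite encode_state_level // sh.
have n2 : (n <= 2 * n)%N by rewrite leq_pmull.
have [la b laE] := state_level_preimage n2 xl.
exists la => //; have [lap lam laB _] := b.
have sh : size (hooks_div t la) = (2 * n)%N.
  by apply/eqP; rewrite -(encode_state_level _ b) laE.
rewrite mem_filter mem_partitions lap sh eqxx andbT; apply/andP; split; first exact/(pdP lap lam).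
by rewrite (iffRL (size_hooks_div_balanced lap lam laB) b) sh [(t * _)%N]mulnC /=.
Qed.

Lemma partition_sum_poly (h : seq nat -> F) : representable d s (fun _ => h) ->
  exists P : {poly F}, forall n,
    ((2 * t) ^ n * n`!)%N%:R *
    \sum_(la <- partitions (2 * n * t) | pd la && (size (hooks_div t la) == 2 * n)%N)
       (h la / (hook_prod t la)%:R) = P.[n%:R].
Proof.
move=> [g sg hg]; have [P PE] := state_expoly t0 sg; exists P => n.
have tn0 : t%:R != 0 :> F by rewrite pnatr_eq0 -lt0n.
have n20 : 2%:R != 0 :> F by rewrite pnatr_eq0.
have -> : \sum_(la <- partitions (2 * n * t) | pd la && (size (hooks_div t la) == 2 * n)%N)
       (h la / (hook_prod t la)%:R) =
    t%:R ^- (2 * n) * \sum_(x <- state_level d s (2 * n) n) state_weight F s x * g x.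
  rewrite -(perm_big _ (perm_encode n)) big_map mulr_sumr -big_filter.
  rewrite big_seq [RHS]big_seq; apply: eq_bigr => la.
  rewrite mem_filter mem_partitions => /andP[/andP[lad /eqP sh] /andP[lap /eqP sla]].
  have lam : (size la <= t * (2 * n))%N by rewrite mulnC -sla size_partition.
  have laB := iffLR (pdP lap lam) lad.
  rewrite (hook_prod_weight t0 F lap lam laB) sh (hg (2 * n)%N) 1?mulrC ?mulrA //.
  by apply/size_hooks_div_balanced => //; rewrite sla sh mulnC.
rewrite mulrCA natrM -mulrA PE ?leq_pmull // natrX natrM.
move: t%:R tn0 => u u0; rewrite exprM -exprVn [_ * (_ * _)]mulrA -exprMn mulrA -exprMn.
suff -> : (u ^+ 2)^-1 * (2%:R * u) * (u / 2%:R) = 1 by rewrite expr1n mul1r.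
by field; rewrite ?u0 ?n20.
Qed.

End PartitionSum.

Theorem theorem1p2 (R : realType) (t : nat) (ht : (0 < t)%N)
    (F1 F2 : symfun R[i]) :
  (odd t ->
    exists P : {poly R[i]}, forall n : nat, (0 < n)%N ->
      ((2 * t) ^ n * n`!)%N%:R *
      \sum_(la <- partitions (2 * n * t) |
              `[< doubled_distinct la >] && (size (hooks_div t la) == 2 * n)%N)
         (symfun_eval F1 [seq (h ^ 2)%N%:R | h <- hooks la] *
          symfun_eval F2 [seq c%:~R | c <- contents la] /
          (hook_prod t la)%:R)
      = P.[n%:R]) /\
  (~~ odd t ->
    exists P : {poly R[i]}, forall n : nat, (0 < n)%N ->
      ((2 * t) ^ n * n`!)%N%:R *
      \sum_(la <- partitions (2 * n * t) |
              self_conjugate la && (size (hooks_div t la) == 2 * n)%N)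
         (symfun_eval F1 [seq (h ^ 2)%N%:R | h <- hooks la] *
          symfun_eval F2 [seq c%:~R | c <- contents la] /
          (hook_prod t la)%:R)
      = P.[n%:R]).
Proof.
have rep (d : bool) (s : nat) : (0 < 2 * s + d)%N -> representable d s (fun _ la =>
    symfun_eval F1 [seq (h ^ 2)%N%:R | h <- hooks la] *
    symfun_eval F2 [seq c%:~R | c <- contents la]).
  move=> t0; apply: representable_mul; apply: representable_symfun => k k0.
    exact: representable_hooks.
  exact: representable_contents.
split=> [t_odd|t_even].
  have tE : t = (2 * t./2 + true)%N by rewrite -[LHS]odd_double_half t_odd mul2n addnC.
  have t0 : (0 < 2 * t./2 + true)%N by rewrite -tE.
  have pdP m la : is_partition la -> (size la <= m)%N ->
      `[< doubled_distinct la >] <-> mirrored true m (beads la m).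
    move=> lap lam; rewrite -(doubled_distinct_mirrored lap lam).
    by split=> [/asboolP|?]; last exact/asboolP.
  by have [P PE] := partition_sum_poly t0 pdP (rep _ _ t0); rewrite -tE in PE; exists P.
have tE : t = (2 * t./2 + false)%N by rewrite -[LHS]odd_double_half (negPf t_even) mul2n addnC.
have t0 : (0 < 2 * t./2 + false)%N by rewrite -tE.
have [P PE] := partition_sum_poly t0 (fun m la => @self_conjugate_mirrored la m) (rep _ _ t0).
by rewrite -tE in PE; exists P.
Qed.
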